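(* For each $n$, let $n=n_c+n_j$ with $n_c\ge n_j$ (where $n_c,n_j\ge1$ may depend on $n$), and let $(A,B)=(A_n,B_n)\sim \mathrm{CorrER}(Q_1,Q_2,R)$ on the vertex set $[n]$ (where $Q_1,Q_2,R$ may depend on $n$), with $R$ of the form $R=R_c\oplus 0_{n_j}$ where $R_c\in(0,1]^{n_c\times n_c}$ and $0_{n_j}$ is the $n_j\times n_j$ zero matrix. Assume that for each $i=1,2$: (i) there exists $r_i=r_i(n)\in[0,1]$ such that $Q_i\le r_i$ entry-wise; (ii) $\min_j\sum_\ell Q_i(j,\ell)=\omega(\log n)$; (iii) there exists $d_i=d_i(n)=o(n)$ such that $\sum_{j>d_i}s_j^2(Q_i)=O(n r_i d_i)$, where $s_1(Q_i)\ge s_2(Q_i)\ge\cdots\ge s_n(Q_i)$ are the singular values of $Q_i$. For $k\ge1$ let $\mathcal{P}^{\mathcal{C}}_{n,k}=\{P\in\Pi(n):\sum_{i=1}^{n_c}P(i,i)=n_c-k\}$ (empty for $k>n_c$), and for $P\in\Pi(n)$ let $$\mathcal{X}_P=\frac12\sum_{u,v\in[n]}\Big(\mathrm{Cov}\big[A(u,v),B(u,v)\big]-\mathrm{Cov}\big[A(u,v),(PBP^T)(u,v)\big]\Big).$$ Suppose there exists $\delta=\delta(n)\ge0$ such that for all $k\in[n_c]$ and all $Q\in\mathcal{P}^{\mathcal{C}}_{n,k}$ (uniformly in $k$ and $Q$, as $n\to\infty$) $$\frac{\mathcal{X}_Q}{k}=\omega\big(n_c^{1/2+\delta}\sqrt{\log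 n_c}\big),\qquad \frac{\mathcal{X}_Q}{\sqrt k}=\omega\big(\sqrt{n_c\,n_j\log n_j}\big).$$ Then there exist constants $a_1,a_2>0$ such that the following holds. Let $\widehat Q_1$ be the USVT estimate computed from $A$ with threshold $t_1=a_1\sqrt{nr_1}$, let $\widehat Q_2$ be the USVT estimate computed from $B$ with threshold $t_2=a_2\sqrt{nr_2}$, and set $\widehat A=A-\widehat Q_1$, $\widehat B=B-\widehat Q_2$. If $k_0=k_0(n)$ is a sequence of positive integers with $$k_0=\omega\left(\frac{n_c^{1-\delta}}{\sqrt{\log n_c}}\big(\sqrt{r_1}+\sqrt{r_2}\big)\big(\sqrt{r_1d_1}+\sqrt{r_2d_2}\big)\right),$$ then for all sufficiently large $n$ $$\mathbb{P}\left(\operatorname{argmin}_{P\in\Pi(n)}\|\widehat A-P\widehat BP^T\|_F\ \cap\ \bigcup_{k=k_0+1}^{\infty}\mathcal{P}^{\mathcal{C}}_{n,k}=\emptyset\right)\ \ge\ 1-5n^{-2}.$$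
   Context: Notation: $[n]=\{1,\dots,n\}$; $\Pi(n)$ is the set of $n\times n$ permutation matrices; $\|\cdot\|_F$ is the Frobenius norm; $\operatorname{argmin}$ denotes the set of all minimizers; $M\oplus N$ denotes the block-diagonal matrix with diagonal blocks $M$ and $N$. Graphs are identified with their symmetric, hollow (zero diagonal) $0/1$ adjacency matrices. The vertices in $\mathcal{C}=[n_c]$ are the core vertices and those in $[n]\setminus[n_c]$ are the junk vertices. Model: $(A,B)\sim\mathrm{CorrER}(Q_1,Q_2,R)$, for symmetric matrices $Q_1,Q_2,R\in\mathbb{R}^{n\times n}$ ($Q_1,Q_2$ being edge-probability matrices with entries in $[0,1]$), means: (1) $A$ is the adjacency matrix of a random simple graph on $[n]$ with independent edges and no self-loops, with $A(u,v)\sim\mathrm{Bernoulli}(Q_1(u,v))$ for each unordered pair $\{u,v\}$, $u\ne v$; (2) $B$ is likewise an independent-edge loop-free random graph with $B(u,v)\sim\mathrm{Bernoulli}(Q_2(u,v))$; (3) the edges across the two graphs are collectively independent except that, for each pair $\{u,v\}$, the correlation between $A(u,v)$ and $B(u,v)$ is $R(u,v)\ge 0$, i.e. $\mathrm{Cov}(A(u,v),B(u,v))=R(u,v)\sqrt{\mathrm{Var}(A(u,v))\mathrm{Var}(B(u,v))}$. (Thus the random pairs $(A(u,v),B(u,v))$ are independent over distinct $\{u,v\}$.) The diagonals of $Q_1,Q_2$ are not assumed to be zero, but $A,B$ have zero diagonal. USVT (Universal Singular Value Thresholding) estimate from an adjacency matrix $A$ with threshold $t>0$: let $A=\sum_{i=1}^n\sigma_iu_iv_i^T$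 be a singular value decomposition with $\sigma_1\ge\cdots\ge\sigma_n$, and let $\breve A=\sum_{i:\sigma_i>t}\sigma_iu_iv_i^T$. The output is $\widehat Q\in[0,1]^{n\times n}$ with $\widehat Q(i,i)=0$ for all $i$, and for $i\ne j$, $\widehat Q(i,j)=\breve A(i,j)$ if $\breve A(i,j)\in[0,1]$, $\widehat Q(i,j)=0$ if $\breve A(i,j)<0$, and $\widehat Q(i,j)=1$ if $\breve A(i,j)>1$. Asymptotic notation, as $n\to\infty$: for nonnegative $f,g$, $f=o(g)$ means $f(n)/g(n)\to0$; $f=\omega(g)$ means $g=o(f)$; $f=O(g)$ means $f(n)<Cg(n)$ for some constant $C>0$ and all large $n$. *)

(* Defs.v *)
From HB Require Import structures.
From mathcomp Require Import all_boot all_order all_algebra.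
From mathcomp Require Import all_classical all_reals all_analysis.

Set Implicit Arguments.
Unset Strict Implicit.
Unset Printing Implicit Defensive.

Import Order.TTheory GRing.Theory Num.Theory.
Import numFieldNormedType.Exports.

Local Open Scope classical_set_scope.
Local Open Scope ring_scope.

(* For nonnegative f and g, this is f = omega(g).  The library's little-o is
   in its epsilon form, so it never divides by a vanishing function. *)
Definition is_omega (R : realType) (f g : nat -> R) : Prop := g =o_\oo f.

Section Matrices.
Variable R : realType.

Definition frobenius (n : nat) (M : 'M[R]_n) : R :=
  Num.sqrt (\sum_(i < n) \sum_(j < n) M i j ^+ 2).

(* The singular vectors u_i and v_i are the columns of U and V; both families
   are orthonormal bases. *)
Definition is_svd (n : nat) (M U : 'M[R]_n) (s : 'rV[R]_n) (V : 'M[R]_n) :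
    Prop :=
  [/\ U^T *m U = 1%:M,
      V^T *m V = 1%:M,
      forall i, 0 <= s 0 i,
      forall i j : 'I_n, (i <= j)%N -> s 0 j <= s 0 i
    & M = \sum_(i < n) s 0 i *: (col i U *m (col i V)^T)].

(* An arbitrary choice of a singular value decomposition (U, s, V). Every real
   square matrix has one, so the default value is never used. *)
Definition svd (n : nat) (M : 'M[R]_n) : 'M[R]_n * 'rV[R]_n * 'M[R]_n :=
  xget (1%:M, 0, 1%:M)
    [set usv | is_svd M usv.1.1 usv.1.2 usv.2].

(* Entry j (counted from 0) is the (j+1)-st largest singular value. *)
Definition singular_values (n : nat) (M : 'M[R]_n) : 'rV[R]_n := (svd M).1.2.

(* The truncation does not depend on the decomposition chosen by [svd]. *)
Definition svd_trunc (n : nat) (M : 'M[R]_n) (t : R) : 'M[R]_n :=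
  let: (U, s, V) := svd M in
  \sum_(i < n | t < s 0 i) s 0 i *: (col i U *m (col i V)^T).

Definition usvt (n : nat) (M : 'M[R]_n) (t : R) : 'M[R]_n :=
  \matrix_(i, j)
    let x := svd_trunc M t i j in
    if i == j then 0 else if x < 0 then 0 else if 1 < x then 1 else x.

(* The infimum ranges over a finite set, nonempty when 0 < n, and is then a
   minimum. *)
Definition min_row_sum (n : nat) (Q : 'M[R]_n) : R :=
  inf [set \sum_(l < n) Q j l | j in [set: 'I_n]].

Definition is_graph (n : nat) (G : 'M[R]_n) : Prop :=
  [/\ G^T = G, forall u, G u u = 0 & forall u v, G u v = 0 \/ G u v = 1].

Definition argmin_match (n : nat) (M N : 'M[R]_n) : set 'M[R]_n :=
  [set P | is_perm_mx P /\
    forall P' : 'M[R]_n, is_perm_mx P' ->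
      frobenius (M - P *m N *m P^T) <= frobenius (M - P' *m N *m P'^T)].

(* The core vertices are the first c of the c + j vertices.  The equation is
   read in R, so that no P satisfies it when c < k. *)
Definition core_perms (c j k : nat) : set 'M[R]_(c + j) :=
  [set P | is_perm_mx P /\
    \sum_(i < c) P (lshift j i) (lshift j i) = c%:R - k%:R].

End Matrices.

Section Probability.
Context (d : measure_display) (T : measurableType d) (R : realType).
Variable P : probability T R.

Definition mutually_independent (d' : measure_display) (E : measurableType d')
    (I : finType) (X : I -> T -> E) : Prop :=
  forall (J : {set I}) (S : I -> set E), (forall i, measurable (S i)) ->
    P (\bigcap_(i in [set` J]) X i @^-1` S i) =
    (\prod_(i in J) P (X i @^-1` S i))%E.

(* Unordered pairs of distinct vertices, each listed with its smaller vertex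
   first. *)
Definition vertex_pair (n : nat) := {uv : 'I_n * 'I_n | (uv.1 < uv.2)%N}.

(* Independence of the pairs (A(u,v), B(u,v)) over distinct {u,v} contains the
   independence of the edges within each of the two graphs. *)
Record corrER (n : nat) (Q1 Q2 rho : 'M[R]_n) (A B : T -> 'M[R]_n) : Prop := {
  corrER_symQ1 : Q1^T = Q1 ;
  corrER_symQ2 : Q2^T = Q2 ;
  corrER_symrho : rho^T = rho ;
  corrER_Q1_01 : forall u v, 0 <= Q1 u v <= 1 ;
  corrER_Q2_01 : forall u v, 0 <= Q2 u v <= 1 ;
  corrER_rho_ge0 : forall u v, 0 <= rho u v ;
  corrER_measA : forall u v, measurable_fun setT (fun w => A w u v) ;
  corrER_measB : forall u v, measurable_fun setT (fun w => B w u v) ;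
  corrER_graphA : forall w, is_graph (A w) ;
  corrER_graphB : forall w, is_graph (B w) ;
  corrER_probA : forall u v, u != v ->
    P [set w | A w u v = 1] = (Q1 u v)%:E ;
  corrER_probB : forall u v, u != v ->
    P [set w | B w u v = 1] = (Q2 u v)%:E ;
  corrER_cov : forall u v, u != v ->
    covariance P (fun w => A w u v) (fun w => B w u v) =
    (rho u v * Num.sqrt (fine (variance P (fun w => A w u v)) *
                         fine (variance P (fun w => B w u v))))%:E ;
  corrER_indep :
    mutually_independent (fun (e : vertex_pair n) (w : T) =>
      (A w (val e).1 (val e).2, B w (val e).1 (val e).2))
}.

(* The covariances are finite because the entries of A and B are bounded. *)
Definition chiX (n : nat) (A B : T -> 'M[R]_n) (M : 'M[R]_n) : R :=
  2^-1 * \sum_(u < n) \sum_(v < n)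
    (fine (covariance P (fun w => A w u v) (fun w => B w u v)) -
     fine (covariance P (fun w => A w u v)
                        (fun w => (M *m B w *m M^T) u v))).

End Probability.

(* Main.v *)
Require Import Defs.
From HB Require Import structures.
From mathcomp Require Import all_boot all_order all_algebra.
From mathcomp Require Import all_classical all_reals all_analysis.
From mathcomp Require Import perm spectral ring lra zify.
From mathcomp Require complex.

Set Implicit Arguments.
Unset Strict Implicit.
Unset Printing Implicit Defensive.

Import Order.TTheory GRing.Theory Num.Theory.
Import numFieldNormedType.Exports.

Local Open Scope classical_set_scope.
Local Open Scope ring_scope.

(* A permutation P moving k core vertices is beaten by a permutation P' that fixes
   the core and differs from P at no more than 2k vertices.  Only core pairs are
   correlated, so in the difference of the two centered inner products P' loses
   none of the signal and the mean is 2 X_P.  This difference has bounded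
   differences of total square O(kn) in the edges, and the two growth conditions
   on X_P beat the number c^k (k+j)^(k+j) of such permutations P.

   The estimation errors are controlled by Cauchy-Schwarz from the spectral bound
   |A - E A| = O(sqrt (n r)).  The first growth condition forces n r >= sqrt n, so
   that bound follows from a moment computation E tr (A - E A)^(2m) <= n (9 n r)^m
   with m of order log n: walks are counted by following them step by step, with
   a potential that pays for the choice among several edges to backtrack along.
   Given this bound, thresholding retains O(d) singular values and the resulting
   estimate is within O(n r d) of E A in squared Frobenius norm.

   The law of (A, B) is carried by finitely many graphs, so all probabilities are
   computed on a finite product space indexed by the pairs of vertices. *)

(** * Weighted counting of walks *)

(** The identity is not a suitable competitor of P: it may differ from P at every junk vertex, and
    the total square of the differences would then grow with the number of junk vertices even for k
    = 1.

    The bound on k0 comes from balancing the estimation errors against the signal. In Frobenius norm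
    the centered graphs have order n sqrt r and the estimation errors sqrt (n r d), so the cross
    terms have order n^(3/2) (sqrt r1 sqrt (r2 d2) + sqrt r2 sqrt (r1 d1)). When more than k0 core
    vertices move, the signal exceeds k0 c^(1/2+delta) sqrt (log c). Against the factor c^(1-delta)
    / sqrt (log c) in the bound on k0, both delta and the logarithms cancel and c^(3/2) remains,
    which is of the order of n^(3/2) because n <= 2c.

    The effect of the noise on singular values is handled without variational formulas: a dimension
    count limits how many values are retained, and Parseval's identity in the singular bases of the
    graph and of its mean measures the error.

    Apart from the last step everything concerns a single n: the asymptotic conditions enter with
    fixed constants such as 1/256. *)

Section Algebra.
Variable F : fieldType.
Implicit Types a x y b B h t r n : F.

(** These rearrangements serve the cases of [walk_weight_le]. Over bare variables, [ring] and
    [field] never meet exponents that are sums of cardinals. *)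
Lemma walk_alg_close a x b B h : b != 0 ->
  a * x * (b^-1 * B) * b * h = a * (x * h) * B.
Proof. by move=> b0; field. Qed.

Lemma walk_alg_old a c x y b B r :
  r * a * c * (x * y) * (b^-1 * B) = a * c * x * B * (r * y / b).
Proof. by ring. Qed.

Lemma walk_alg_new a c x b B n : b != 0 -> n != 0 ->
  b ^+ 2 / n * a * c * x * (b^-1 * B) = a * c * x * B * b * n^-1.
Proof. by move=> b0 n0; field; rewrite n0. Qed.

Lemma walk_alg_end a c x b B : a * c * x * B * b * 3 = a * (3 * b * c) * x * B.
Proof. by ring. Qed.

End Algebra.

Section WalkCount.
Variables (R : realType) (V : finType).
Implicit Types (S D : {set {set V}}) (u v w : V).

Definition single_degree S w : nat := #|[set v | [set w; v] \in S]%SET|.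

(* [S] is the set of edges used exactly once so far and [u] the endpoint of the
   walk.  While the walk explores a tree and backtracks, [S] is the path from
   the root to [u], every vertex has excess 0, and backtracking is forced. *)
Definition excess S u : nat := (\sum_w (single_degree S w + (w == u) - 2))%N.

Lemma set2_eq u v w x : u != v ->
  ([set w; x] == [set u; v])%SET = ((w == u) && (x == v)) || ((w == v) && (x == u)).
Proof.
move=> uv; apply/eqP/idP => [/setP e|].
  have := e u; have := e v; have := e w; have := e x; rewrite !inE !eqxx /= orbT /=.
  by move: uv; repeat (case: eqVneq => [?|?] //=; subst => //=); rewrite ?eqxx.
case/orP=> /andP[/eqP-> /eqP->] //; exact: finset.setUC.
Qed.

Lemma single_degreeU1 S u v w : u != v -> ([set u; v] \notin S)%SET ->
  single_degree ([set u; v] |: S)%SET w = (single_degree S w + (w == u) + (w == v))%N.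
Proof.
move=> uv eS; rewrite /single_degree.
have -> : [set x | [set w; x] \in [set u; v] |: S]%SET =
    ([set x | [set w; x] \in S] :|: [set x | (w == u) && (x == v)]
      :|: [set x | (w == v) && (x == u)])%SET.
  by apply/setP=> x; rewrite !inE set2_eq //; case: (_ \in S); rewrite ?orbT //= orbF.
rewrite !cardsU !disjoint_setI0 ?cards0 ?subn0.
- congr (_ + _ + _)%N; (case: eqVneq => _ /=; last by rewrite eq_card0 // => x; rewrite !inE).
  + by rewrite (_ : [set _ | _]%SET = [set v]%SET) ?cards1 //; apply/setP=> x; rewrite !inE.
  + by rewrite (_ : [set _ | _]%SET = [set u]%SET) ?cards1 //; apply/setP=> x; rewrite !inE.
- rewrite finset.disjoints_subset; apply/fintype.subsetP => x; rewrite !inE => xS.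
  apply/negP => /andP[/eqP wv /eqP xu]; move: xS; rewrite wv xu finset.setUC (negPf eS).
  by rewrite [v == u]eq_sym (negPf uv).
- rewrite finset.disjoints_subset; apply/fintype.subsetP => x; rewrite !inE => xS.
  by apply/negP => /andP[/eqP wu /eqP xv]; move: xS; rewrite wu xv (negPf eS).
Qed.

(** Because subtraction is truncated, the sums are compared vertex by vertex; only the new endpoint
    [v] may overspend, by [a]. *)
Lemma excess_step S S' u v (a : nat) :
  (forall w, single_degree S' w + (w == v) - 2 <= single_degree S w + (w == u) - 2 + (w == v) * a)%N ->
  (excess S' v <= excess S u + a)%N.
Proof.
move=> h; rewrite /excess (_ : a = \sum_w (w == v) * a)%N.
  by rewrite -big_split; apply: leq_sum => w _; exact: h.
rewrite (bigD1 v) //= eqxx mul1n big1 ?addn0 // => w wv.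
by rewrite (negPf wv) mul0n.
Qed.

(** The fresh vertex ends with one single edge and the endpoint mark, which the subtraction of 2
    absorbs; [u] trades its endpoint mark for an edge. *)
Lemma excess_new S u v : u != v -> ([set u; v] \notin S)%SET -> single_degree S v = 0%N ->
  (excess ([set u; v] |: S)%SET v <= excess S u)%N.
Proof.
move=> uv eS hv; rewrite -[X in (_ <= X)%N]addn0; apply: excess_step => w.
rewrite single_degreeU1 // muln0 addn0; case: (eqVneq w v) => [->|_]; last by lia.
by rewrite hv eq_sym (negPf uv); lia.
Qed.

Lemma excess_new_old S u v : u != v -> ([set u; v] \notin S)%SET ->
  (excess ([set u; v] |: S)%SET v <= excess S u + 2)%N.
Proof. by move=> uv eS; apply: excess_step => w; rewrite single_degreeU1 //; lia. Qed.

Lemma excess_reuse S u v : (excess S v <= excess S u + 1)%N.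
Proof. by apply: excess_step => w; lia. Qed.

(* Leaving a vertex where several edges are still waiting for their second use
   pays for the choice of the edge. *)
Lemma excess_close S u v : u != v -> ([set u; v] \in S)%SET ->
  (excess (S :\ [set u; v])%SET v + (1 < single_degree S u) <= excess S u)%N.
Proof.
move=> uv eS; set S' := (S :\ _)%SET.
have eS' : ([set u; v] \notin S')%SET by rewrite !inE eqxx.
have hS w : single_degree S w = (single_degree S' w + (w == u) + (w == v))%N.
  by rewrite -single_degreeU1 // /S' finset.setD1K.
rewrite /excess (bigD1 u) //= [X in (_ <= X)%N](bigD1 u) //= eqxx.
rewrite addnAC leq_add //; first by rewrite hS eqxx (negPf uv); lia.
by apply: leq_sum => w wu; rewrite hS; lia.
Qed.

Lemma disjoint_setU1 (T : finType) (x : T) (A B : {set T}) :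
  [disjoint (x |: A)%SET & B]%B = (x \notin B) && [disjoint A & B]%B.
Proof.
by rewrite -finset.setI_eq0 finset.setIUl finset.setU_eq0 !finset.setI_eq0 disjoints1.
Qed.

(* The sum over the walks of length [L] from [u] of [r] to the number of distinct
   edges, restricted to walks that end with every edge used at least twice;
   [S] and [D] are the edges already used once, resp. at least twice. *)
Fixpoint walk_weight (r : R) (L : nat) S D u : R :=
  if L is L'.+1 then
    \sum_(v | v != u)
      let e := [set u; v]%SET in
      if e \in D then walk_weight r L' S D v
      else if e \in S then walk_weight r L' (S :\ e)%SET (e |: D)%SET v
      else walk_weight r L' (e |: S)%SET D v
  else (S == finset.set0)%:R * r ^+ #|D|.

(* Every new edge must be closed later, so new vertices (|V| r = b^2 each) amount
   to a factor b per step.  Any other free choice costs at most T, raises the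
   excess by at most 2 and loses a factor b >= T^2. *)
Lemma walk_weight_le (r b : R) (T L : nat) S D u (U : {set V}) :
  0 < r <= 1 -> 0 < b -> b ^+ 2 = #|V|%:R * r -> T%:R ^+ 2 <= b ->
  (forall e, e \in S :|: D -> e \subset U)%SET -> u \in U ->
  (#|U| + L <= T)%N -> [disjoint S & D]%B ->
  walk_weight r L S D u <=
    r ^+ (#|S| + #|D|) * (3 * b) ^+ L * T%:R ^+ excess S u / b ^+ #|S|.
Proof.
move=> /andP[r0 r1] b0 b2 Tb; elim: L S D u U => [|L IH] S D u U SDU uU UT SD.
  have T1 : 1 <= T%:R :> R.
    by rewrite ler1n; apply: leq_trans UT; rewrite addn0; apply/card_gt0P; exists u.
  rewrite /= expr0 mulr1; case: eqVneq => [->|_]; last first.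
    by rewrite mul0r !mulr_ge0 ?invr_ge0 ?exprn_ge0 ?ler0n ?ltW.
  by rewrite cards0 mul1r expr0 invr1 mulr1 ler_peMr ?exprn_ge0 ?(ltW r0) // exprn_ege1.
have TU : (#|U| < T)%N by lia.
have ULT : (#|U| + L <= T)%N by lia.
have T1 : 1 <= T%:R :> R by rewrite ler1n; lia.
have T0 : 0 < T%:R :> R by lra.
have V0 : (0 < #|V|)%N by apply/card_gt0P; exists u.
have V0R : 0 < #|V|%:R :> R by rewrite ltr0n.
(* [X] is a third of the target bound. Each step is charged to one of three shares of it: [1/|V|]
   for a fresh vertex, [1/T] for a vertex of [U], [1/single_degree S u] for closing an edge. Each
   share sums to at most 1 over [v], whence the base [3 b]. *)
have [X XE] : exists X, X = r ^+ (#|S| + #|D|) * (3 * b) ^+ L * T%:R ^+ excess S u / b ^+ #|S| * b.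
  by eexists.
have X0 : 0 <= X by rewrite XE !mulr_ge0 ?invr_ge0 ?exprn_ge0 ?mulr_ge0 ?ler0n ?ltW.
have hdu : (single_degree S u <= #|U|)%N.
  apply: subset_leq_card; apply/fintype.subsetP => v; rewrite inE => uvS.
  have /SDU/fintype.subsetP -> // : ([set u; v] \in S :|: D)%SET by rewrite inE uvS.
  by rewrite !inE eqxx orbT.
have stepU v (S' D' : {set {set V}}) : v \in U ->
    ((S' :|: D') \subset [set u; v] |: (S :|: D))%SET ->
    forall e, (e \in S' :|: D' -> e \subset U)%SET.
  move=> vU /fintype.subsetP sub e /sub; rewrite in_setU1 => /orP[/eqP ->|/SDU //].
  by rewrite finset.subUset !finset.sub1set uU vU.
have term v : v != u ->
    (let e := [set u; v]%SET in
      if e \in D then walk_weight r L S D v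
      else if e \in S then walk_weight r L (S :\ e)%SET (e |: D)%SET v
      else walk_weight r L (e |: S)%SET D v) <=
    X * (#|V|%:R^-1 + (v \in U)%:R / T%:R
         + ([set u; v]%SET \in S)%:R / (single_degree S u)%:R).
  move=> vu; have uv : u != v by rewrite eq_sym.
  have le1 x : 0 <= x <= 1 -> X * x <= X by move=> /andP[_ x1]; rewrite ler_piMr.
  have Xsplit (a b' c : R) : 0 <= a -> 0 <= b' -> 0 <= c ->
      (X * a <= X * (a + b' + c)) && (X * b' <= X * (a + b' + c))
      && (X * c <= X * (a + b' + c)).
    by move=> a0 b0' c0; clear -X0 a0 b0' c0; apply/andP; split; [apply/andP; split|]; apply: ler_wpM2l => //; lra.
  have /andP[/andP[Xa Xb] Xc] := Xsplit (#|V|%:R^-1) ((v \in U)%:R / T%:R)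
    (([set u; v]%SET \in S)%:R / (single_degree S u)%:R)
    ltac:(by rewrite invr_ge0) ltac:(by rewrite divr_ge0) ltac:(by rewrite divr_ge0).
  move=> /=; case: ifPn => eD; last case: ifPn => eS.
  - have vU : v \in U.
      have /SDU/fintype.subsetP -> // : ([set u; v] \in S :|: D)%SET by rewrite inE eD orbT.
      by rewrite !inE eqxx orbT.
    apply: le_trans Xb; rewrite vU mul1r.
    apply: le_trans (IH S D v U SDU vU ULT SD) _.
    rewrite XE -!mulrA ler_wpM2l ?exprn_ge0 ?(ltW r0) // ler_wpM2l ?exprn_ge0 ?mulr_ge0 ?(ltW b0) //.
    rewrite [X in _ <= X]mulrCA mulrC ler_wpM2l ?invr_ge0 ?exprn_ge0 ?(ltW b0) //.
    rewrite mulrA ler_pdivlMr //.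
    apply: (@le_trans _ _ (T%:R ^+ (excess S u + 1) * T%:R)).
      by rewrite ler_wpM2r ?ler0n // ler_weXn2l // excess_reuse.
    rewrite exprD -mulrA ler_wpM2l ?exprn_ge0 ?ler0n //.
  - have vU : v \in U.
      have /SDU/fintype.subsetP -> // : ([set u; v] \in S :|: D)%SET by rewrite inE eS.
      by rewrite !inE eqxx orbT.
    rewrite eS in Xc; apply: le_trans Xc; rewrite mul1r.
    have hd0 : (0 < single_degree S u)%N by apply/card_gt0P; exists v; rewrite inE.
    have SE : #|S| = #|(S :\ [set u; v])%SET|.+1 by rewrite (cardsD1 [set u; v]%SET) eS.
    apply: le_trans (IH (S :\ [set u; v])%SET ([set u; v] |: D)%SET v U _ vU ULT _) _.
    + apply: (stepU v (S :\ [set u; v])%SET ([set u; v] |: D)%SET vU); apply/fintype.subsetP => e; rewrite !inE.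
      by case/orP=> [/andP[_ ->]|/orP[->|->]] //; rewrite ?orbT.
    + rewrite disjoint_sym disjoint_setU1 !inE eqxx /=.
      by rewrite disjoint_sym; apply: disjointWl SD; exact: subsetDl.
    rewrite cardsU1 eD XE SE /= exprS invfM.
    rewrite add1n addnS -addSn.
    set c := #|_ :\ _|%N.
    rewrite walk_alg_close ?gt_eqF //.
    rewrite ler_wpM2r ?invr_ge0 ?exprn_ge0 ?(ltW b0) //.
    rewrite ler_wpM2l ?mulr_ge0 ?exprn_ge0 ?(ltW r0) ?mulr_ge0 ?(ltW b0) //.
    rewrite ler_pdivlMr ?ltr0n //.
    have := excess_close uv eS; case: (ltnP 1 (single_degree S u)) => h1 ex.
      apply: (@le_trans _ _ (T%:R ^+ (excess (S :\ [set u; v]) v)%SET * T%:R)).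
        by rewrite ler_wpM2l ?exprn_ge0 // ler_nat (leq_trans hdu) // ltnW.
      by rewrite -exprSr ler_weXn2l // -addn1.
    have -> : single_degree S u = 1%N by apply/eqP; rewrite eqn_leq h1 hd0.
    by rewrite mulr1 ler_weXn2l // (leq_trans _ ex) // leq_addr.
  rewrite (negPf eS) in Xa Xb.
  have SE : #|([set u; v] |: S)%SET| = #|S|.+1 by rewrite cardsU1 eS.
  have SD' : [disjoint ([set u; v] |: S)%SET & D]%B by rewrite disjoint_setU1 eD.
  have [vU|vU] : (v \in U) \/ (v \notin U) by case: (v \in U); [left|right].
  - apply: le_trans Xb; rewrite vU mul1r.
    apply: le_trans (IH ([set u; v] |: S)%SET D v U _ vU ULT SD') _.
      by apply: (stepU v ([set u; v] |: S)%SET D vU); rewrite finset.setUA.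
    rewrite SE addSn exprS [in X in _ * X]exprS invfM XE.
    (* A new edge between old vertices costs [r], raises the excess by up to 2 and enlarges [S]: the
       factor [r T^2 / b] has to fit into the share [b / T]. *)
    have T3 : r * T%:R ^+ 3 <= b ^+ 2.
      apply: (@le_trans _ _ (T%:R ^+ 2 * T%:R ^+ 2)).
        apply: (@le_trans _ _ (T%:R ^+ 3)); first by rewrite ler_piMl ?exprn_ge0.
        by rewrite -exprD ler_weXn2l.
      by rewrite [leRHS]expr2 ler_pM ?exprn_ge0.
    apply: (@le_trans _ _ (r * r ^+ (#|S| + #|D|) * (3 * b) ^+ L *
       T%:R ^+ (excess S u + 2) * (b^-1 / b ^+ #|S|))).
      rewrite ler_wpM2r ?mulr_ge0 ?invr_ge0 ?exprn_ge0 ?(ltW b0) //.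
      rewrite ler_wpM2l ?mulr_ge0 ?exprn_ge0 ?(ltW r0) ?mulr_ge0 ?(ltW b0) //.
      by rewrite ler_weXn2l // excess_new_old.
    rewrite (exprD T%:R) walk_alg_old.
    rewrite -[X in _ <= X]mulrA ler_wpM2l ?mulr_ge0 ?invr_ge0 ?exprn_ge0 ?(ltW r0) ?mulr_ge0 ?(ltW b0) //.
    by rewrite ler_pdivlMr // mulrAC ler_pdivrMr // -expr2; apply: le_trans T3; rewrite -mulrA -exprSr.
  - apply: le_trans Xa.
    have hv : single_degree S v = 0%N.
      apply: eq_card0 => x; rewrite !inE; apply/negP => xS.
      have /SDU/fintype.subsetP/(_ v) : ([set v; x] \in S :|: D)%SET by rewrite inE xS.
      by rewrite !inE eqxx (negPf vU) => /(_ isT).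
    apply: le_trans (IH ([set u; v] |: S)%SET D v (v |: U)%SET _ _ _ SD') _.
    + move=> e; rewrite -finset.setUA in_setU1 => /orP[/eqP ->|/SDU h].
        by rewrite finset.subUset !finset.sub1set !inE eqxx uU orbT.
      exact: fintype.subset_trans h (finset.subsetUr _ _).
    + by rewrite !inE eqxx.
    + by rewrite cardsU1 vU -addnA add1n -addnS.
    rewrite SE addSn exprS [in X in _ * X]exprS invfM XE.
    apply: (@le_trans _ _ (r * r ^+ (#|S| + #|D|) * (3 * b) ^+ L *
       T%:R ^+ (excess S u) * (b^-1 / b ^+ #|S|))).
      rewrite ler_wpM2r ?mulr_ge0 ?invr_ge0 ?exprn_ge0 ?(ltW b0) //.
      rewrite ler_wpM2l ?mulr_ge0 ?exprn_ge0 ?(ltW r0) ?mulr_ge0 ?(ltW b0) //.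
      by rewrite ler_weXn2l // excess_new.
    have rE : r = b ^+ 2 / #|V|%:R by rewrite b2 mulrAC divff ?mul1r // gt_eqF.
    by rewrite [X in X * r ^+ _]rE walk_alg_new ?gt_eqF.
apply: (@le_trans _ _ (\sum_(v | v != u) X * (#|V|%:R^-1 + (v \in U)%:R / T%:R
         + ([set u; v]%SET \in S)%:R / (single_degree S u)%:R))).
  exact: ler_sum.
apply: (@le_trans _ _ (\sum_v X * (#|V|%:R^-1 + (v \in U)%:R / T%:R
         + ([set u; v]%SET \in S)%:R / (single_degree S u)%:R))).
  rewrite [leRHS](bigID (fun v => v != u)) /= lerDl sumr_ge0 // => v _.
  by rewrite mulr_ge0 // !addr_ge0 ?invr_ge0 ?divr_ge0.
rewrite -mulr_sumr !big_split /= -!mulr_suml.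
have -> : \sum_(v : V) #|V|%:R^-1 = 1 :> R.
  by rewrite sumr_const -[_ *+ _]mulr_natr mulVf // gt_eqF.
have -> : \sum_v (v \in U)%:R = #|U|%:R :> R.
  by rewrite -sum1_card natr_sum [RHS]big_mkcond /=; apply: eq_bigr => v _; case: (_ \in _).
have -> : \sum_v ([set u; v]%SET \in S)%:R = (single_degree S u)%:R :> R.
  rewrite /single_degree -sum1_card natr_sum [RHS]big_mkcond /=; apply: eq_bigr => v _.
  by rewrite inE; case: (_ \in _).
have h1 : #|U|%:R / T%:R <= 1 :> R by rewrite ler_pdivrMr // mul1r ler_nat ltnW.
have h2 : (single_degree S u)%:R / (single_degree S u)%:R <= 1 :> R.
  by case: (single_degree S u) => [|k]; rewrite ?mul0r // divff // pnatr_eq0.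
apply: (@le_trans _ _ (X * 3)).
  by apply: ler_wpM2l => //; clear -h1 h2; lra.
by rewrite XE walk_alg_end -exprS.
Qed.

End WalkCount.

(** * Moments on a finite product space *)

Section FiniteProduct.
Variables (R : realType) (E W : finType) (p : E -> W -> R).

(* Expectation on the product of the finite probability spaces (W, p e). *)
Definition Ex (f : {ffun E -> W} -> R) : R :=
  \sum_(x : {ffun E -> W}) (\prod_e p e (x e)) * f x.

Hypothesis p_ge0 : forall e w, 0 <= p e w.
Hypothesis p_sum1 : forall e, \sum_w p e w = 1.

Lemma weight_ge0 (x : {ffun E -> W}) : 0 <= \prod_e p e (x e).
Proof. by apply: prodr_ge0. Qed.

Lemma eq_Ex f g : f =1 g -> Ex f = Ex g.
Proof. by move=> fg; apply: eq_bigr => x _; rewrite fg. Qed.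

Lemma Ex_le f g : (forall x, f x <= g x) -> Ex f <= Ex g.
Proof. by move=> fg; apply: ler_sum => x _; rewrite ler_wpM2l ?weight_ge0. Qed.

Lemma Ex_prod (g : E -> W -> R) :
  Ex (fun x => \prod_e g e (x e)) = \prod_e \sum_w p e w * g e w.
Proof.
rewrite /Ex (bigA_distr_bigA (fun e w => p e w * g e w)) /=.
by apply: eq_bigr => x _; rewrite big_split.
Qed.

Lemma Ex_cst c : Ex (fun=> c) = c.
Proof.
rewrite /Ex -mulr_suml.
have -> : \sum_(x : {ffun E -> W}) \prod_e p e (x e) = 1.
  rewrite -(bigA_distr_bigA p) big1 // => e _; exact: p_sum1.
by rewrite mul1r.
Qed.

Lemma Ex_sum (I : finType) (P : pred I) (F : I -> {ffun E -> W} -> R) :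
  Ex (fun x => \sum_(i | P i) F i x) = \sum_(i | P i) Ex (F i).
Proof.
by rewrite /Ex exchange_big /=; apply: eq_bigr => x _; rewrite mulr_sumr.
Qed.

Lemma ExD f g : Ex (fun x => f x + g x) = Ex f + Ex g.
Proof. by rewrite /Ex -big_split; apply: eq_bigr => x _; rewrite mulrDr. Qed.

Lemma ExZ c f : Ex (fun x => c * f x) = c * Ex f.
Proof. by rewrite /Ex mulr_sumr; apply: eq_bigr => x _; rewrite mulrCA. Qed.

Lemma ExN f : Ex (fun x => - f x) = - Ex f.
Proof. by rewrite /Ex -sumrN; apply: eq_bigr => x _; rewrite mulrN. Qed.

Lemma ExB f g : Ex (fun x => f x - g x) = Ex f - Ex g.
Proof. by rewrite ExD ExN. Qed.

Lemma norm_Ex_le f : `|Ex f| <= Ex (fun x => `|f x|).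
Proof.
apply: (le_trans (ler_norm_sum _ _ _)); apply: ler_sum => x _.
by rewrite normrM (ger0_norm (weight_ge0 x)).
Qed.

Lemma Ex_coord e (g : W -> R) : Ex (fun x => g (x e)) = \sum_w p e w * g w.
Proof.
transitivity (Ex (fun x => \prod_a (if a == e then g (x a) else 1))).
  apply: eq_Ex => x; rewrite (bigD1 e) //= eqxx big1 ?mulr1 // => a ae.
  by rewrite (negPf ae).
rewrite (Ex_prod (fun a w => if a == e then g w else 1)) (bigD1 e) //= eqxx.
rewrite [X in _ * X]big1 ?mulr1 // => a ae; rewrite (negPf ae) -[RHS](p_sum1 a).
by apply: eq_bigr => w _; rewrite mulr1.
Qed.

Lemma Ex_coord2 e e' (g h : W -> R) : e != e' ->
  Ex (fun x => g (x e) * h (x e')) = Ex (fun x => g (x e)) * Ex (fun x => h (x e')).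
Proof.
move=> ee'; have e'e : e' != e by rewrite eq_sym.
rewrite !Ex_coord.
transitivity (Ex (fun x => \prod_a (if a == e then g (x a)
    else if a == e' then h (x a) else 1))).
  apply: eq_Ex => x; rewrite (bigD1 e) //= eqxx (bigD1 e') //= (negPf e'e) eqxx big1 ?mulr1 // => a /andP[ae ae'].
  by rewrite (negPf ae) (negPf ae').
rewrite (Ex_prod (fun a w => if a == e then g w else if a == e' then h w else 1)).
rewrite (bigD1 e) //= eqxx (bigD1 e') //= (negPf e'e) eqxx [X in _ * (_ * X)]big1 ?mulr1 // => a /andP[ae ae'].
rewrite (negPf ae) (negPf ae') -[RHS](p_sum1 a).
by apply: eq_bigr => w _; rewrite mulr1.
Qed.

Definition Pr (b : pred {ffun E -> W}) : R := Ex (fun x => (b x)%:R).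

Lemma Pr_sub (a b : pred {ffun E -> W}) :
  (forall x, a x -> b x) -> Pr a <= Pr b.
Proof. by move=> ab; apply: Ex_le => x; rewrite ler_nat; case: (a x) (ab x) => // ->. Qed.

Lemma Pr_or (a b : pred {ffun E -> W}) : Pr (predU a b) <= Pr a + Pr b.
Proof.
rewrite /Pr -ExD; apply: Ex_le => x; rewrite -natrD ler_nat /=.
by case: (a x) (b x) => [] [].
Qed.

Lemma Pr_exists (I : finType) (Q : pred I) (b : I -> pred {ffun E -> W}) :
  Pr (fun x => [exists i, Q i && b i x]) <= \sum_(i | Q i) Pr (b i).
Proof.
rewrite /Pr -Ex_sum; apply: Ex_le => x.
case: existsP => [[i /andP[Qi bi]]|_]; last by rewrite sumr_ge0 // => i _; case: (b i x).
by rewrite (bigD1 i) //= bi lerDl sumr_ge0.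
Qed.

Lemma PrC (a : pred {ffun E -> W}) : Pr (predC a) = 1 - Pr a.
Proof.
rewrite /Pr -[X in _ = X - _](Ex_cst 1) -ExB; apply: eq_Ex => x /=.
by case: (a x); rewrite ?subrr ?subr0.
Qed.

Lemma markov_Ex f t : 0 < t -> (forall x, 0 <= f x) ->
  Pr (fun x => t < f x) <= Ex f / t.
Proof.
move=> t0 f0; rewrite ler_pdivlMr // mulrC -ExZ; apply: Ex_le => x.
by case: ltP => [/ltW|_]; rewrite ?mulr1 ?mulr0.
Qed.

End FiniteProduct.

(** * Moments of products of centered edge variables *)

Section MomentBound.
Variables (R : realType) (E W : finType) (p : E -> W -> R).
Hypothesis p_ge0 : forall e w, 0 <= p e w.
Hypothesis p_sum1 : forall e, \sum_w p e w = 1.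
Variables (n : nat) (ed : E -> {set 'I_n}) (g : E -> W -> R) (r : R).
Hypothesis ed_inj : injective ed.
Hypothesis r_ge0 : 0 <= r.
Hypothesis g_mean0 : forall e, \sum_w p e w * g e w = 0.
Hypothesis g_le1 : forall e w, `|g e w| <= 1.
Hypothesis g_var : forall e, \sum_w p e w * g e w ^+ 2 <= r.

(** Indexing by vertex sets builds in symmetry; a set that is no edge, such as the singleton of a
    diagonal entry, gets the default 0. *)
Definition edge_entry (s : {set 'I_n}) (x : {ffun E -> W}) : R :=
  if [pick e | ed e == s] is Some e then g e (x e) else 0.

Definition single_edges (H : seq {set 'I_n}) : {set {set 'I_n}} :=
  [set s | count_mem s H == 1%N]%SET.
Definition repeated_edges (H : seq {set 'I_n}) : {set {set 'I_n}} :=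
  [set s | (1 < count_mem s H)%N]%SET.

Lemma edge_entryE e x : edge_entry (ed e) x = g e (x e).
Proof.
rewrite /edge_entry; case: pickP => [e' /eqP/ed_inj -> //|/(_ e)].
by rewrite eqxx.
Qed.

Lemma norm_moment_le e k : (1 < k)%N -> `|\sum_w p e w * g e w ^+ k| <= r.
Proof.
move=> k1; apply: le_trans (g_var e); apply: (le_trans (ler_norm_sum _ _ _)).
apply: ler_sum => w _; rewrite normrM (ger0_norm (p_ge0 e w)) ler_wpM2l //.
by rewrite normrX -[leRHS]real_normK ?num_real // ler_wiXn2l.
Qed.

(** By independence the expectation factors over the edges: an edge occurring once contributes its
    zero mean and annihilates the product, a repeated one contributes at most [r], an absent one
    1. *)
Lemma norm_Ex_edges_le H :
  `|Ex p (fun x => \prod_(s <- H) edge_entry s x)| <=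
    (single_edges H == finset.set0)%:R * r ^+ #|repeated_edges H|.
Proof.
have rhs0 : 0 <= (single_edges H == finset.set0)%:R * r ^+ #|repeated_edges H|.
  by rewrite mulr_ge0 ?exprn_ge0.
have [/allP Hed|/allPn[s sH /codomP sE]] := boolP (all [in codom ed] H); last first.
  rewrite (_ : Ex _ _ = 0) ?normr0 //.
  rewrite -[RHS](Ex_cst p_sum1 0); apply: eq_Ex => x; apply/eqP.
  rewrite prodf_seq_eq0; apply/hasP; exists s => //=; rewrite /edge_entry.
  by case: pickP => // e /eqP es; case: sE; exists e.
have {}prodE x : \prod_(s <- H) edge_entry s x =
    \prod_e g e (x e) ^+ count_mem (ed e) H.
  elim: H Hed {rhs0} => [|s H IH] Hed.
    by rewrite big_nil big1.
  have /codomP[e0 se] : s \in codom ed by apply: Hed; rewrite inE eqxx.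
  rewrite big_cons IH => [|s' s'H]; last by apply: Hed; rewrite inE s'H orbT.
  rewrite /= [RHS](eq_bigr (fun e => (if e == e0 then g e (x e) else 1) *
    g e (x e) ^+ count_mem (ed e) H)); last first.
    move=> e _; rewrite se (inj_eq ed_inj) eq_sym exprD.
    by case: eqVneq => _; rewrite ?expr1 ?expr0.
  rewrite big_split -big_mkcond /= big_pred1_eq se edge_entryE //.
rewrite (eq_Ex p prodE) (Ex_prod p (fun e w => g e w ^+ count_mem (ed e) H)).
have [S0|/set0Pn[s]] := eqVneq (single_edges H) finset.set0; last first.
  rewrite inE => /eqP s1.
  have /codomP[e se] : s \in codom ed.
    by apply: Hed; rewrite -has_pred1 has_count s1.
  rewrite (bigD1 e) //= -se s1.
  by rewrite (eq_bigr (fun w => p e w * g e w)) ?g_mean0 ?mul0r ?normr0.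
rewrite mul1r normr_prod.
have -> : repeated_edges H = (ed @: [set e | (1 < count_mem (ed e) H)%N])%SET.
  apply/setP=> s; rewrite inE; apply/idP/imsetP => [s1|[e]]; last by rewrite inE => ? ->.
  have /codomP[e se] : s \in codom ed.
    by apply: Hed; rewrite -has_pred1 has_count ltnW.
  by exists e; rewrite // inE -se.
rewrite card_imset // -prodr_const [leRHS]big_mkcond /=.
apply: ler_prod => e _; rewrite normr_ge0 inE /=; case: ltnP => h1.
  exact: norm_moment_le.
have := S0 => /setP/(_ (ed e)); rewrite !inE.
case: (count_mem _ _) h1 => [|[|k]] // _ _.
by under eq_bigr do rewrite expr0 mulr1; rewrite p_sum1 normr1.
Qed.

(** The list [H] is the history of edges already walked; carrying it lets the induction on [L]
    follow the recursion of [walk_weight]. An empty [H] gives the entries of the power itself. *)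
Lemma norm_Ex_mxpow_le (M : {ffun E -> W} -> 'M[R]_n) :
  (forall x u, M x u u = 0) ->
  (forall x u v, u != v -> M x u v = edge_entry [set u; v]%SET x) ->
  forall L H u z,
  `|Ex p (fun x => (\prod_(s <- H) edge_entry s x) * iter L (mulmx (M x)) 1%:M u z)|
    <= walk_weight r L (single_edges H) (repeated_edges H) u.
Proof.
move=> Mdiag Mentry; elim=> [|L IH] H u z /=.
  apply: le_trans (norm_Ex_edges_le H).
  under eq_Ex do rewrite mxE mulrC.
  by rewrite ExZ normrM normr_nat; case: eqP => _; rewrite ?mul1r ?mul0r.
rewrite (eq_Ex p (g := fun x => \sum_(v | v != u)
    (\prod_(s <- [set u; v]%SET :: H) edge_entry s x) * iter L (mulmx (M x)) 1%:M v z)).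
  rewrite Ex_sum; apply: (le_trans (ler_norm_sum _ _ _)); apply: ler_sum => v vu.
  apply: (le_trans (IH _ _ _)) => /=; set e := [set u; v]%SET.
  have -> : single_edges (e :: H) =
      if e \in repeated_edges H then single_edges H
      else if e \in single_edges H then (single_edges H :\ e)%SET
      else (e |: single_edges H)%SET.
    apply/setP=> s; rewrite [LHS]inE /= (eq_sym e s).
    case: ifPn => h1; [|case: ifPn => h2; rewrite inE in h2]; rewrite inE in h1;
    by rewrite !inE; case: (eqVneq s e) => [->|_] /=; rewrite ?add0n //; move: h1; try move: h2; case: (count_mem _ _) => [|[|k]].
  have -> : repeated_edges (e :: H) =
      if e \in repeated_edges H then repeated_edges H
      else if e \in single_edges H then (e |: repeated_edges H)%SET
      else repeated_edges H.
    apply/setP=> s; rewrite [LHS]inE /= (eq_sym e s).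
    case: ifPn => h1; [|case: ifPn => h2; rewrite inE in h2]; rewrite inE in h1;
    by rewrite !inE; case: (eqVneq s e) => [->|_] /=; rewrite ?add0n //; move: h1; try move: h2; case: (count_mem _ _) => [|[|k]].
  by case: (e \in repeated_edges H) => //; case: (e \in single_edges H).
move=> x; rewrite mxE mulr_sumr (bigD1 u) //= Mdiag mul0r mulr0 add0r.
apply: eq_bigr => v vu; rewrite big_cons mulrA Mentry 1?eq_sym //.
by rewrite [_ * edge_entry _ _]mulrC.
Qed.

End MomentBound.

(** * Squared Frobenius norm and singular values *)

Section SquaredNorm.
Variable R : realType.

Lemma cauchy_schwarz (I : finType) (a b : I -> R) :
  (\sum_i a i * b i) ^+ 2 <= (\sum_i a i ^+ 2) * (\sum_i b i ^+ 2).
Proof.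
set sa := \sum_i a i ^+ 2; set sb := \sum_i b i ^+ 2; set ab := \sum_i a i * b i.
have sb0 : 0 <= sb by apply: sumr_ge0 => i _; exact: sqr_ge0.
have [sb_eq0|sb_neq0] := eqVneq sb 0.
  have b0 i : b i = 0.
    by apply/eqP; rewrite -sqrf_eq0; move/eqP: sb_eq0; rewrite psumr_eq0 => [/allP/(_ i)|j _];
      [rewrite mem_index_enum => /(_ isT)|exact: sqr_ge0].
  by rewrite /ab big1 => [|i _]; rewrite ?b0 ?mulr0 // expr0n /= sb_eq0 mulr0.
have sb_gt0 : 0 < sb by rewrite lt_def sb_neq0.
have : 0 <= \sum_i (sb * a i - ab * b i) ^+ 2 by apply: sumr_ge0 => i _; exact: sqr_ge0.
rewrite (_ : \sum_i _ = sb * (sa * sb - ab ^+ 2)); last first.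
  transitivity (\sum_i (sb ^+ 2 * a i ^+ 2 - (2 * sb * ab) * (a i * b i) + ab ^+ 2 * b i ^+ 2)).
    by apply: eq_bigr => i _; ring.
  by rewrite !big_split /= sumrN -!mulr_sumr -/sa -/sb -/ab; ring.
by rewrite pmulr_rge0 // subr_ge0.
Qed.

Definition sqn m n (M : 'M[R]_(m, n)) : R := \sum_i \sum_j M i j ^+ 2.
Definition mxdot m n (M N : 'M[R]_(m, n)) : R := \sum_i \sum_j M i j * N i j.

Lemma frobeniusE n (M : 'M[R]_n) : frobenius M = Num.sqrt (sqn M).
Proof. by []. Qed.

Lemma sqn_ge0 m n (M : 'M[R]_(m, n)) : 0 <= sqn M.
Proof. by apply: sumr_ge0 => i _; apply: sumr_ge0 => j _; exact: sqr_ge0. Qed.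

Lemma sqnE m n (M : 'M[R]_(m, n)) : sqn M = mxdot M M.
Proof. by []. Qed.

Lemma mxdotE m n (M N : 'M[R]_(m, n)) : mxdot M N = \tr (M^T *m N).
Proof.
rewrite /mxdot exchange_big; apply: eq_bigr => j _; rewrite mxE.
by apply: eq_bigr => i _; rewrite mxE.
Qed.

Lemma mxdotC m n (M N : 'M[R]_(m, n)) : mxdot M N = mxdot N M.
Proof. by apply: eq_bigr => i _; apply: eq_bigr => j _; rewrite mulrC. Qed.

Lemma mxdotDl m n (M M' N : 'M[R]_(m, n)) : mxdot (M + M') N = mxdot M N + mxdot M' N.
Proof. by rewrite !mxdotE linearD mulmxDl linearD. Qed.

Lemma mxdotDr m n (M N N' : 'M[R]_(m, n)) : mxdot M (N + N') = mxdot M N + mxdot M N'.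
Proof. by rewrite !mxdotE mulmxDr linearD. Qed.

Lemma mxdotNr m n (M N : 'M[R]_(m, n)) : mxdot M (- N) = - mxdot M N.
Proof. by rewrite !mxdotE mulmxN linearN. Qed.

Lemma mxdot_mull m n k (U : 'M[R]_(m, k)) (M : 'M[R]_(m, n)) (N : 'M[R]_(k, n)) :
  mxdot M (U *m N) = mxdot (U^T *m M) N.
Proof. by rewrite !mxdotE trmx_mul trmxK mulmxA. Qed.

Lemma sqnN m n (M : 'M[R]_(m, n)) : sqn (- M) = sqn M.
Proof. by apply: eq_bigr => i _; apply: eq_bigr => j _; rewrite mxE sqrrN. Qed.

Lemma sqn_tr m n (M : 'M[R]_(m, n)) : sqn M^T = sqn M.
Proof.
by rewrite /sqn exchange_big; apply: eq_bigr => i _; apply: eq_bigr => j _; rewrite mxE.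
Qed.

Lemma sqn_eq0 m n (M : 'M[R]_(m, n)) : (sqn M == 0) = (M == 0).
Proof.
apply/idP/eqP => [|->]; last first.
  by rewrite /sqn big1 // => i _; rewrite big1 // => j _; rewrite mxE expr0n.
rewrite psumr_eq0 => [/allP h|i _]; last by apply: sumr_ge0 => j _; exact: sqr_ge0.
apply/matrixP => i j; have /= := h i (mem_index_enum _).
rewrite psumr_eq0 => [/allP/(_ j (mem_index_enum _))/=|k _]; last exact: sqr_ge0.
by rewrite sqrf_eq0 mxE => /eqP.
Qed.

Lemma mxdot_sqr_le m n (M N : 'M[R]_(m, n)) : mxdot M N ^+ 2 <= sqn M * sqn N.
Proof.
rewrite /mxdot /sqn !pair_big /=.
exact: (cauchy_schwarz (fun p : 'I_m * 'I_n => M p.1 p.2) (fun p => N p.1 p.2)).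
Qed.

Lemma sqnD_le m n (M N : 'M[R]_(m, n)) : sqn (M + N) <= 2 * sqn M + 2 * sqn N.
Proof.
rewrite /sqn !mulr_sumr -big_split; apply: ler_sum => i _.
rewrite !mulr_sumr -big_split; apply: ler_sum => j _; rewrite mxE /=.
have := sqr_ge0 (M i j - N i j); rewrite -subr_ge0 => h.
by rewrite -subr_ge0 (_ : _ - _ = (M i j - N i j) ^+ 2) ?sqr_ge0 //; ring.
Qed.

Lemma sqn_col m n (M : 'M[R]_(m, n)) : sqn M = \sum_j sqn (col j M).
Proof.
rewrite /sqn exchange_big; apply: eq_bigr => j _; apply: eq_bigr => i _.
by rewrite big_ord1 mxE.
Qed.

Lemma sqn_mulmx_le m n k (M : 'M[R]_(m, n)) (N : 'M[R]_(n, k)) :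
  sqn (M *m N) <= sqn M * sqn N.
Proof.
rewrite [sqn N]sqn_col mulr_sumr sqn_col; apply: ler_sum => j _.
rewrite /sqn mulr_suml; apply: ler_sum => i _; rewrite big_ord1 !mxE.
apply: le_trans (cauchy_schwarz _ _) _; rewrite le_eqVlt; apply/orP; left; apply/eqP.
by congr (_ * _); apply: eq_bigr => l _; rewrite big_ord1 mxE.
Qed.

Lemma sqn_orth m n k (U : 'M[R]_(k, m)) (M : 'M[R]_(m, n)) :
  U^T *m U = 1%:M -> sqn (U *m M) = sqn M.
Proof. by move=> UU; rewrite !sqnE mxdot_mull mulmxA UU mul1mx. Qed.

Lemma sqn_orthr m n (M : 'M[R]_(m, n)) (V : 'M[R]_n) :
  V^T *m V = 1%:M -> sqn (M *m V) = sqn M.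
Proof.
move=> VV; rewrite -sqn_tr trmx_mul sqn_orth ?sqn_tr //.
by rewrite trmxK; exact: mulmx1C.
Qed.

Definition mxpow n (M : 'M[R]_n) k : 'M[R]_n := iter k (mulmx M) 1%:M.

Lemma mxpowD n (M : 'M[R]_n) k l : mxpow M (k + l) = mxpow M k *m mxpow M l.
Proof.
rewrite /mxpow; elim: k => [|k IH]; first by rewrite /= mul1mx.
by rewrite addSn !iterS IH mulmxA.
Qed.

Lemma sqn_mxpow n (M : 'M[R]_n) k : M^T = M ->
  sqn (mxpow M k) = \sum_u mxpow M (k + k) u u.
Proof.
move=> Msym; rewrite sqnE mxdotE mxpowD; congr (\tr (_ *m _)).
have -> : (mxpow M k)^T = mxpow M k; last by [].
elim: k => [|k IH]; first by rewrite /mxpow /= trmx1.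
have comm : M *m mxpow M k = mxpow M k *m M.
  by have := mxpowD M k 1; rewrite addnC mxpowD /= {1 3}/mxpow /= mulmx1.
by rewrite -addn1 addnC mxpowD trmx_mul IH {1 3}/mxpow /= mulmx1 Msym comm.
Qed.

(* [k |-> |M^k x|^2] is log-convex when M is symmetric. *)
Lemma sqn_mulmx_pow_le n (M : 'M[R]_n) (x : 'cV[R]_n) k : M^T = M ->
  sqn (M *m x) ^+ k.+1 <= sqn (mxpow M k.+1) * sqn x ^+ k.+1.
Proof.
move=> Msym; set a := fun k => sqn (mxpow M k *m x).
have a_ge0 i : 0 <= a i by exact: sqn_ge0.
have aS i : mxpow M i.+1 *m x = M *m (mxpow M i *m x) by rewrite /mxpow iterS mulmxA.
have convex i : a i.+1 ^+ 2 <= a i * a i.+2.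
  rewrite /a {1}sqnE {2}aS mxdot_mull Msym -aS mulrC mxdotC mulrC.
  exact: mxdot_sqr_le.
(* Log-convexity makes the ratios of successive terms increase; this is the division-free form, as
   [a i] may vanish. *)
have growth i : a 1 * a i <= a 0 * a i.+1.
  elim: i => [|i IH]; first by rewrite mulrC.
  have [ai0|ai0] := eqVneq (a i.+1) 0; first by rewrite ai0 mulr0 mulr_ge0.
  have ai_gt0 : 0 < a i.+1 by rewrite lt_def ai0 a_ge0.
  rewrite -(ler_pM2r ai_gt0) -mulrA -expr2.
  apply: le_trans (ler_wpM2l (a_ge0 1) (convex i)) _.
  by rewrite mulrA [leRHS]mulrAC; apply: ler_wpM2r.
have a1 : a 1 = sqn (M *m x) by rewrite /a aS /mxpow /= mul1mx.
have a0 : a 0 = sqn x by rewrite /a /mxpow /= mul1mx.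
have pow i : a 1 ^+ i.+1 <= a 0 ^+ i * a i.+1.
  elim: i => [|i IH]; first by rewrite expr1 expr0 mul1r.
  rewrite exprS; apply: le_trans (ler_wpM2l (a_ge0 1) IH) _.
  rewrite mulrCA exprSr -mulrA; apply: ler_wpM2l => //; first exact: exprn_ge0.
rewrite -a1 -a0; apply: le_trans (pow k) _.
rewrite exprSr mulrCA; apply: ler_wpM2l; first exact: exprn_ge0.
by rewrite a0; exact: sqn_mulmx_le.
Qed.

End SquaredNorm.

(** * Existence of a singular value decomposition *)

Section SVD.
Import complex.
Variable R : realType.

(** An eigenvalue exists over the algebraically closed [R[i]]. It is real because the Hermitian form
    of its eigenvector [w] is self-conjugate, and as a root of the real characteristic polynomial it
    also has a real eigenvector. *)
Lemma symmetric_eigenvalue n (S : 'M[R]_n) : (0 < n)%N -> S^T = S ->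
  exists l, exists2 v : 'cV[R]_n, v != 0 & S *m v = l *: v.
Proof.
move=> n0 Ssym; pose f : {rmorphism R -> R[i]} := GRing.RMorphism.clone _ _ (real_complex R) _.
have [a /eigenvalueP [w wS w0]] := eigenvalue_closed (map_mx f S) n0.
have fconj (x : R) : (f x)^* = f x by apply: conj_Creal; apply/complex_realP; exists x.
have : a \is Num.real.
  pose q := (w *m (map_mx Num.conj w)^T) 0 0.
  have q_gt0 : 0 < q.
    rewrite /q mxE lt_def; apply/andP; split; last first.
      by apply: sumr_ge0 => i _; rewrite !mxE mul_conjC_ge0.
    apply: contra w0 => /eqP q0; apply/eqP/rowP => i; rewrite mxE.
    move/eqP: q0; rewrite psumr_eq0 => [/allP/(_ i (mem_index_enum _))/=|j _]; last first.
      by rewrite !mxE mul_conjC_ge0.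
    by rewrite !mxE mul_conjC_eq0 => /eqP.
  have aq : (w *m map_mx f S *m (map_mx Num.conj w)^T) 0 0 = a * q.
    by rewrite wS -scalemxAl mxE.
  have : (a * q)^* = a * q.
    rewrite -aq.
    transitivity ((map_mx Num.conj (w *m map_mx f S *m (map_mx Num.conj w)^T))^T 0 0).
      by rewrite !mxE.
    rewrite !map_mxM !trmx_mul -map_trmx trmxK.
    have -> : map_mx Num.conj (map_mx Num.conj w) = w.
      by apply/matrixP => i j; rewrite !mxE conjCK.
    have -> : (map_mx Num.conj (map_mx f S))^T = map_mx f S.
      by apply/matrixP => i j; rewrite !mxE fconj -[in RHS]Ssym mxE.
    by rewrite mulmxA.
  rewrite rmorphM /= (conj_Creal (gtr0_real q_gt0)) => /(mulIf (lt0r_neq0 q_gt0)).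
  by move/CrealP.
move=> /complex_realP[l al].
have /eigenvalueP[v vS v0] : eigenvalue S l.
  rewrite eigenvalue_root_char -(fmorph_root f) map_char_poly -eigenvalue_root_char.
  by apply/eigenvalueP; exists w => //; rewrite wS al.
exists l, v^T; first by rewrite trmx_eq0.
by rewrite -[S]Ssym -trmx_mul vS linearZ.
Qed.

Lemma sqnZ m n c (M : 'M[R]_(m, n)) : sqn (c *: M) = c ^+ 2 * sqn M.
Proof.
by rewrite /sqn mulr_sumr; apply: eq_bigr => i _; rewrite mulr_sumr;
  apply: eq_bigr => j _; rewrite mxE exprMn.
Qed.

Lemma unit_vector n (v : 'cV[R]_n) : v != 0 -> exists2 c : R, c != 0 & sqn (c *: v) = 1.
Proof.
move=> v0; have sv : 0 < sqn v by rewrite lt_def sqn_eq0 v0 sqn_ge0.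
exists (Num.sqrt (sqn v))^-1; first by rewrite invr_eq0 sqrtr_eq0 -ltNge.
by rewrite sqnZ exprVn sqr_sqrtr ?ltW // mulVf ?gt_eqF.
Qed.

Lemma mxdotZl m n c (M N : 'M[R]_(m, n)) : mxdot (c *: M) N = c * mxdot M N.
Proof.
by rewrite /mxdot mulr_sumr; apply: eq_bigr => i _; rewrite mulr_sumr;
  apply: eq_bigr => j _; rewrite mxE mulrA.
Qed.

(** An eigenvector of [M^T M] serves as [v] and the normalised [M v] as [u]. If the eigenvalue is 0,
    then [M] is singular and [u] is taken from its left kernel instead. *)
Lemma singular_pair n (M : 'M[R]_n) : (0 < n)%N ->
  exists (s : R) (u v : 'cV[R]_n), [/\ 0 <= s, sqn u = 1, sqn v = 1, M *m v = s *: u & M^T *m u = s *: v].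
Proof.
move=> n0; have [|l [v v0 Sv]] := symmetric_eigenvalue (S := M^T *m M) n0.
  by rewrite trmx_mul trmxK.
have [c c0 cv1] := unit_vector v0; set v1 := c *: v in cv1.
have Sv1 : M^T *m (M *m v1) = l *: v1.
  by rewrite mulmxA /v1 -scalemxAr Sv !scalerA mulrC.
have lE : sqn (M *m v1) = l.
  by rewrite sqnE mxdot_mull Sv1 mxdotZl -sqnE cv1 mulr1.
have l0 : 0 <= l by rewrite -lE sqn_ge0.
have [l_eq0|l_neq0] := eqVneq l 0; last first.
  have s0 : Num.sqrt l != 0 by rewrite sqrtr_eq0 -ltNge lt_def l_neq0.
  exists (Num.sqrt l), ((Num.sqrt l)^-1 *: (M *m v1)), v1; split=> //.
  - by rewrite sqnZ lE exprVn sqr_sqrtr // mulVf.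
  - by rewrite scalerA divff // scale1r.
  - by rewrite -scalemxAr Sv1 scalerA -{2}(sqr_sqrtr l0) expr2 mulKf.
have Mv0 : M *m v1 = 0 by apply/eqP; rewrite -sqn_eq0 lE l_eq0.
have v1_0 : v1 != 0 by rewrite -sqn_eq0 cv1 oner_eq0.
have : ~~ row_free M.
  apply/negP; rewrite row_free_unit => Mu; move: v1_0.
  by rewrite -(mulKmx Mu v1) Mv0 mulmx0 eqxx.
rewrite -kermx_eq0 => /rowV0Pn[w /sub_kermxP wM w0].
have [c' c'0 w1] := unit_vector (v := w^T) ltac:(by rewrite trmx_eq0).
exists 0, (c' *: w^T), v1; split=> //; first by rewrite scale0r.
by rewrite scale0r -scalemxAr -trmx_mul wM trmx0 scaler0.
Qed.

(** The reflection along [e - u] exchanges the two unit vectors. Its columns complete [u] to an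
    orthonormal basis. *)
Lemma householder n (u : 'cV[R]_n.+1) : sqn u = 1 ->
  exists2 H : 'M[R]_n.+1, H^T *m H = 1%:M & H *m delta_mx 0 0 = u.
Proof.
move=> u1; set e : 'cV[R]_n.+1 := delta_mx 0 0.
have e1 : e^T *m e = 1%:M.
  by rewrite /e trmx_delta mul_delta_mx; apply/matrixP => i j; rewrite !ord1 !mxE.
have dotM (x : 'cV[R]_n.+1) : x^T *m x = (sqn x)%:M.
  by rewrite sqnE mxdotE; apply/matrixP => i j; rewrite !ord1 /mxtrace big_ord1 !mxE mulr1n.
have [<-|ue] := eqVneq e u.
  by exists 1%:M; rewrite ?trmx1 ?mulmx1 ?mul1mx.
set w := e - u; have w0 : sqn w != 0 by rewrite sqn_eq0 subr_eq0.
set t := (u^T *m e) 0 0.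
have uE : u^T *m e = t%:M by apply/matrixP => i j; rewrite !ord1 [RHS]mxE eqxx mulr1n.
have eu : e^T *m u = t%:M by rewrite -[u]trmxK -trmx_mul uE tr_scalar_mx.
have wT : w^T = e^T - u^T by rewrite /w linearB.
have wE : sqn w = 2 - 2 * t.
  have := dotM w; rewrite wT {2}/w mulmxBl !mulmxBr e1 eu uE dotM u1.
  by move=> /matrixP/(_ 0 0); rewrite !mxE !eqxx !mulr1n => <-; ring.
have we : w^T *m e = (1 - t)%:M by rewrite wT mulmxBl e1 uE -raddfB.
pose H := 1%:M - (2 / sqn w) *: (w *m w^T).
have Hsym : H^T = H by rewrite /H linearB /= trmx1 linearZ /= trmx_mul trmxK.
exists H.
  rewrite Hsym /H; set P := w *m w^T; set c := 2 / sqn w.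
  have PP : P *m P = sqn w *: P.
    by rewrite /P -mulmxA [w^T *m _]mulmxA dotM mul_scalar_mx scalemxAr.
  rewrite mulmxBl mul1mx mulmxBr mulmx1 -scalemxAl -scalemxAr PP !scalerA.
  rewrite (_ : c * c * sqn w = c + c); last by rewrite /c; field.
  by rewrite scalerDl opprB addrK subrK.
rewrite /H mulmxBl mul1mx -scalemxAl -mulmxA we mul_mx_scalar scalerA.
by rewrite wE (_ : 2 / _ * _ = 1) ?scale1r ?subKr //; field; move: w0; rewrite wE.
Qed.

End SVD.

Section SVDExistence.
Variable R : realType.

Lemma sum_outerE n (U V : 'M[R]_n) (s : 'rV[R]_n) (Q : pred 'I_n) a b :
  (\sum_(i < n | Q i) s 0 i *: (col i U *m (col i V)^T)) a b =
  \sum_(i < n | Q i) s 0 i * (U a i * V b i).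
Proof.
rewrite summxE; apply: eq_bigr => i _; rewrite mxE; congr (_ * _).
by rewrite mxE big_ord1 !mxE.
Qed.

Lemma diag_outerE n (U V : 'M[R]_n) (s : 'rV[R]_n) :
  U *m diag_mx s *m V^T = \sum_(i < n) s 0 i *: (col i U *m (col i V)^T).
Proof.
apply/matrixP => a b; rewrite sum_outerE mxE; apply: eq_bigr => i _.
by rewrite mul_mx_diag !mxE mulrCA mulrA.
Qed.

Lemma block_diag_svd n (U V : 'M[R]_n) (s : 'rV[R]_n) (a : R) :
  block_mx 1%:M 0 0 U *m diag_mx (row_mx (a%:M : 'M[R]_1) s) *m (block_mx 1%:M 0 0 V)^T =
  block_mx a%:M 0 0 (U *m diag_mx s *m V^T).
Proof.
rewrite diag_mx_row tr_block_mx !trmx0 trmx1.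
rewrite mulmx_block !(mulmx0, mul0mx, addr0, add0r, mul1mx).
rewrite mulmx_block !(mulmx0, mul0mx, addr0, add0r, mulmx1).
by congr block_mx; apply/matrixP => i j; rewrite !ord1 !mxE.
Qed.

(** Deflation: completing a singular pair to two orthonormal bases turns [M] into a block matrix
    with [s0] in the corner, and the induction applies to the other block. The values come unsorted;
    [svd_exists] permutes them. *)
Lemma diagonalize n (M : 'M[R]_n) : exists (U : 'M[R]_n) (s : 'rV[R]_n) (V : 'M[R]_n),
  [/\ U^T *m U = 1%:M, V^T *m V = 1%:M, forall i, 0 <= s 0 i
    & M = U *m diag_mx s *m V^T].
Proof.
elim: n M => [|n IH] M.
  exists 1%:M, 0, 1%:M; split; rewrite ?trmx1 ?mul1mx //; first by move=> [].
  by apply/matrixP => -[].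
have [//|s0 [u [v [s0_ge0 u1 v1 Mv Mu]]]] := singular_pair M.
have [H HH He] := householder u1; have [G GG Ge] := householder v1.
have HHT : H *m H^T = 1%:M by exact: mulmx1C.
have GGT : G *m G^T = 1%:M by exact: mulmx1C.
pose N : 'M[R]_(1 + n) := H^T *m M *m G.
have [U [s [V [UU VV s_ge0 NE]]]] := IH (drsubmx N).
have Ncol i : N i 0 = s0 *+ (i == 0).
  transitivity (col 0 N i 0); first by rewrite [RHS]mxE.
  rewrite colE /N -!mulmxA Ge Mv -scalemxAr -He mulmxA HH mul1mx !mxE.
  by case: (i == 0); rewrite ?mulr1 ?mulr0.
have Nrow i : N 0 i = s0 *+ (i == 0).
  transitivity (col 0 N^T i 0); first by rewrite [RHS]mxE [RHS]mxE.
  rewrite colE /N !trmx_mul trmxK -!mulmxA He Mu -scalemxAr -Ge mulmxA GG mul1mx !mxE.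
  by case: (i == 0); rewrite ?mulr1 ?mulr0.
have NB : N = block_mx s0%:M 0 0 (drsubmx N).
  have l0 : lshift n (0 : 'I_1) = 0 :> 'I_(1 + n) by exact: val_inj.
  have r0 (i : 'I_n) : (rshift 1 i == 0 :> 'I_(1 + n)) = false by [].
  rewrite -[LHS]submxK; congr block_mx; apply/matrixP => i j.
  - by rewrite !ord1 [LHS]mxE [LHS]mxE l0 Ncol [RHS]mxE !eqxx.
  - by rewrite !ord1 [LHS]mxE [LHS]mxE l0 Nrow [RHS]mxE r0.
  - by rewrite !ord1 [LHS]mxE [LHS]mxE l0 Ncol [RHS]mxE r0.
pose U1 : 'M[R]_(1 + n) := block_mx 1%:M 0 0 U.
pose V1 : 'M[R]_(1 + n) := block_mx 1%:M 0 0 V.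
have orth (X : 'M[R]_n) : X^T *m X = 1%:M ->
    (block_mx 1%:M 0 0 X : 'M[R]_(1 + n))^T *m block_mx 1%:M 0 0 X = 1%:M.
  move=> XX; rewrite tr_block_mx !trmx0 mulmx_block !mulmx0 !mul0mx !addr0 add0r XX.
  by rewrite trmx1 mulmx1 -scalar_mx_block.
exists (H *m U1), (row_mx s0%:M s : 'rV_(1 + n)), (G *m V1); split.
- by rewrite trmx_mul mulmxA -[_ *m H^T *m H]mulmxA HH mulmx1; exact: orth.
- by rewrite trmx_mul mulmxA -[_ *m G^T *m G]mulmxA GG mulmx1; exact: orth.
- move=> i; case: (split_ordP (i : 'I_(1 + n))) => j ->.
    by rewrite (row_mxEl (s0%:M : 'M[R]_1) s) !ord1 mxE eqxx.
  by rewrite (row_mxEr (s0%:M : 'M[R]_1) s).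
rewrite trmx_mul mulmxA; set D := _ *m V1^T.
have -> : D = H *m N.
  rewrite /D -!mulmxA; congr (_ *m _); rewrite mulmxA NB NE.
  exact: block_diag_svd.
by rewrite /N !mulmxA HHT mul1mx -mulmxA GGT mulmx1.
Qed.

Lemma svd_exists n (M : 'M[R]_n) : exists U s V, is_svd M U s V.
Proof.
have [U [s [V [UU VV s_ge0 ME]]]] := diagonalize M.
pose t := [tuple s 0 i | i < n].
have [p tE] : exists p : 'S_n, sort >=%O t = [tuple tnth t (p i) | i < n] :> seq R.
  by apply/tuple_permP; rewrite perm_sort.
have sE i : s 0 (p i) = nth 0 (sort >=%O t) i.
  by rewrite tE -tnth_nth !tnth_mktuple.
exists (col_perm p U), (col_perm p s), (col_perm p V).
have orth (X : 'M[R]_n) : X^T *m X = 1%:M -> (col_perm p X)^T *m col_perm p X = 1%:M.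
  move=> /matrixP XX; apply/matrixP => i j; have := XX (p i) (p j).
  rewrite !mxE (inj_eq perm_inj) => <-; apply: eq_bigr => k _; by rewrite !mxE.
split; [exact: orth|exact: orth|by move=> i; rewrite mxE| |].
  move=> i j ij; rewrite !mxE !sE.
  have srt : sorted >=%O (sort >=%O t) by apply: sort_sorted; exact: ge_total.
  have := sorted_leq_nth ge_trans ge_refl 0 srt.
  by move=> /(_ i j); rewrite !inE size_sort size_tuple !ltn_ord => /(_ isT isT ij).
rewrite ME diag_outerE; apply/matrixP => a b; rewrite !sum_outerE.
by rewrite (reindex_perm p); apply: eq_bigr => i _; rewrite !mxE.
Qed.

Lemma svdP n (M : 'M[R]_n) : is_svd M (svd M).1.1 (svd M).1.2 (svd M).2.
Proof.
rewrite /svd; have [U [s [V MUV]]] := svd_exists M.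
by case: (xgetPex (1%:M, 0, 1%:M) (P := [set usv | is_svd M usv.1.1 usv.1.2 usv.2])
  (ex_intro _ (U, s, V) MUV)).
Qed.

End SVDExistence.

Lemma mulmx_col (R : pzRingType) m n k (A : 'M[R]_(m, n)) (B : 'M[R]_(n, k)) j :
  col j (A *m B) = A *m col j B.
Proof.
by apply/matrixP => a b; rewrite !mxE; apply: eq_bigr => i _; rewrite !mxE.
Qed.

Section SingularVectors.
Variables (R : realType) (n : nat) (M U V : 'M[R]_n) (s : 'rV[R]_n).
Hypothesis MUV : is_svd M U s V.

Let UU : U^T *m U = 1%:M. Proof. by case: MUV. Qed.
Let VV : V^T *m V = 1%:M. Proof. by case: MUV. Qed.
Let ME : M = U *m diag_mx s *m V^T.
Proof. by rewrite diag_outerE; case: MUV. Qed.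

Lemma orth_parseval (X : 'M[R]_n) (x : 'cV[R]_n) : X^T *m X = 1%:M ->
  \sum_j mxdot (col j X) x ^+ 2 = sqn x.
Proof.
move=> XX; rewrite -[RHS](sqn_orth (U := X^T)) ?trmxK; last exact: mulmx1C.
apply: eq_bigr => j _; rewrite big_ord1 !mxE; congr (_ ^+ 2).
by apply: eq_bigr => i _; rewrite big_ord1 !mxE.
Qed.

Lemma mxdot_col (X : 'M[R]_n) i j : X^T *m X = 1%:M ->
  mxdot (col i X) (col j X) = (i == j)%:R.
Proof.
move=> /matrixP/(_ i j); rewrite !mxE => <-.
by apply: eq_bigr => k _; rewrite big_ord1 !mxE.
Qed.

Lemma svd_mul_col i : M *m col i V = s 0 i *: col i U.
Proof.
have Vi : V^T *m col i V = delta_mx i 0.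
  by rewrite -mulmx_col VV; apply/matrixP => a b; rewrite !mxE !ord1 andbT.
have Di : diag_mx s *m delta_mx i 0 = s 0 i *: (delta_mx i 0 : 'cV_n).
  apply/matrixP => a b; rewrite mul_diag_mx !mxE.
  by case: (eqVneq a i) => [->|] //=; rewrite !mulr0.
by rewrite ME -!mulmxA Vi Di -scalemxAr -colE.
Qed.

Lemma svd_mxdot j (x : 'cV[R]_n) : mxdot (col j U) (M *m x) = s 0 j * mxdot (col j V) x.
Proof.
have e : U^T *m M = diag_mx s *m V^T by rewrite ME !mulmxA UU mul1mx.
have cE (X : 'M[R]_n) (y : 'cV[R]_n) : mxdot (col j X) y = (X^T *m y) j 0.
  by rewrite mxE; apply: eq_bigr => i _; rewrite big_ord1 !mxE.
by rewrite !cE mulmxA e -mulmxA mul_diag_mx mxE.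
Qed.

Lemma svd_sqn_mul (x : 'cV[R]_n) :
  sqn (M *m x) = \sum_j s 0 j ^+ 2 * mxdot (col j V) x ^+ 2.
Proof.
rewrite -(orth_parseval (M *m x) UU); apply: eq_bigr => j _.
by rewrite svd_mxdot exprMn.
Qed.

End SingularVectors.

(** * Truncating the singular values of a perturbed matrix *)

Section Truncation.
Variables (R : realType) (n : nat) (A Q : 'M[R]_n) (K t tau : R) (S : {set 'I_n}).
Let s := singular_values Q.
Let I := [set i | t < singular_values A 0 i]%SET.
Hypothesis AQ : forall x : 'cV[R]_n, sqn ((A - Q) *m x) <= K * sqn x.
Hypothesis AQ_sym : (A - Q)^T = A - Q.
Hypothesis t_ge0 : 0 <= t.
Hypothesis K_ge0 : 0 <= K.
Hypothesis tK : 2 * (tau + K) < t ^+ 2.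
Hypothesis Ssmall : forall j, j \notin S -> s 0 j ^+ 2 <= tau.

(* Otherwise some nonzero combination of the large right singular vectors of [A]
   is orthogonal to the right singular vectors of [Q] indexed by [S]. *)
Lemma card_large_singular_values : (#|I| <= #|S|)%N.
Proof.
rewrite leqNgt; apply/negP => SI.
have svdA := svdP A; have svdQ := svdP Q.
set U := (svd A).1.1 in svdA; set V := (svd A).2 in svdA.
set U' := (svd Q).1.1 in svdQ; set V' := (svd Q).2 in svdQ.
rewrite -/(singular_values A) in svdA; rewrite -/(singular_values Q) -/s in svdQ.
have [UU VV sA_ge0 _ _] := svdA.
pose E : 'M[R]_(#|I|, n) := \matrix_(a, i) (i == enum_val a)%:R.
pose G : 'M[R]_(#|I|, #|S|) :=
  \matrix_(a, b) mxdot (col (enum_val b) V') (col (enum_val a) V).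
have : kermx G != 0.
  rewrite -mxrank_eq0 mxrank_ker -lt0n subn_gt0.
  exact: leq_ltn_trans (rank_leq_col _) SI.
move=> /rowV0Pn[c /sub_kermxP cG c0].
pose d := (c *m E)^T.
have dE a : d (enum_val a) 0 = c 0 a.
  rewrite !mxE (bigD1 a) //= !mxE eqxx mulr1 big1 ?addr0 // => b ba.
  by rewrite mxE (inj_eq enum_val_inj) eq_sym (negPf ba) mulr0.
have d0 i : i \notin I -> d i 0 = 0.
  move=> iI; rewrite !mxE big1 // => a _; rewrite mxE.
  by case: eqP => [ia|]; rewrite ?mulr0 //; move: iI; rewrite ia enum_valP.
pose x := V *m d.
have xV i : mxdot (col i V) x = d i 0.
  transitivity ((V^T *m x) i 0); last by rewrite /x mulmxA VV mul1mx.
  by rewrite mxE; apply: eq_bigr => k _; rewrite big_ord1 !mxE.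
have x_gt0 : 0 < sqn x.
  rewrite lt_def sqn_ge0 andbT sqn_orth // sqn_eq0; apply: contra c0 => /eqP d_0.
  by apply/eqP/rowP => a; rewrite -dE d_0 !mxE.
have xS j : j \in S -> mxdot (col j V') x = 0.
  move=> jS; have /rowP/(_ (enum_rank_in jS j)) := cG; rewrite !mxE => <-.
  transitivity (\sum_k V' k j * x k 0); first by apply: eq_bigr => k _; rewrite big_ord1 !mxE.
  transitivity (\sum_k \sum_a c 0 a * (V' k j * V k (enum_val a))).
    apply: eq_bigr => k _; rewrite mxE mulr_sumr.
    under eq_bigr do rewrite !mxE 2!mulr_sumr.
    rewrite exchange_big /=; apply: eq_bigr => a _; rewrite (bigD1 (enum_val a)) //=.
    rewrite !mxE eqxx mulr1 big1 => [|i ia]; last by rewrite !mxE (negPf ia) !mulr0.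
    by rewrite addr0 mulrA mulrC.
  rewrite exchange_big; apply: eq_bigr => a _; rewrite -mulr_sumr mxE; congr (_ * _).
  apply: eq_bigr => k _; rewrite big_ord1 !mxE enum_rankK_in //.
have Ax : t ^+ 2 * sqn x <= sqn (A *m x).
  rewrite (svd_sqn_mul svdA) -(orth_parseval x VV) mulr_sumr; apply: ler_sum => i _.
  rewrite xV; have [iI|iI] := boolP (i \in I); last by rewrite d0 // expr0n /= !mulr0.
  rewrite ler_wpM2r ?sqr_ge0 // lerXn2r ?nnegrE //.
  by move: iI; rewrite inE => /ltW.
have VV' : V'^T *m V' = 1%:M by case: svdQ.
have Qx : sqn (Q *m x) <= tau * sqn x.
  rewrite (svd_sqn_mul svdQ) -(orth_parseval x VV') mulr_sumr; apply: ler_sum => j _.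
  have [jS|jS] := boolP (j \in S); first by rewrite xS // expr0n /= !mulr0.
  by rewrite ler_wpM2r ?sqr_ge0 // Ssmall.
have : sqn (A *m x) <= 2 * (tau + K) * sqn x.
  have -> : A *m x = Q *m x + (A - Q) *m x by rewrite -mulmxDl addrC subrK.
  apply: le_trans (sqnD_le _ _) _; have := AQ x; move: Qx; lra.
by move=> /(le_trans Ax); rewrite ler_pM2r // leNgt tK.
Qed.

(** The error is measured on the right singular vectors of [A]. On a retained one the truncation
    acts as [A], so the error is at most [K], and at most [|S|] are retained. On a dropped vector
    [v] the error is [|Q v|^2], expanded in the left singular vectors of [Q]: those outside [S]
    yield the tail sum. For those in [S], writing [Q = A - (A - Q)] and moving the symmetric [A - Q]
    to the other side yields [2 t^2 + 2 K] each. *)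
Lemma svd_trunc_error :
  sqn (svd_trunc A t - Q) <=
    #|S|%:R * (3 * K + 2 * t ^+ 2) + \sum_(j | j \notin S) s 0 j ^+ 2.
Proof.
have svdA := svdP A; have svdQ := svdP Q.
have truncE : svd_trunc A t = \sum_(i < n | t < (svd A).1.2 0 i)
    (svd A).1.2 0 i *: (col i (svd A).1.1 *m (col i (svd A).2)^T).
  by rewrite /svd_trunc; case: (svd A) => [[U0 s0] V0].
set U := (svd A).1.1 in svdA truncE; set V := (svd A).2 in svdA truncE.
set U' := (svd Q).1.1 in svdQ; set V' := (svd Q).2 in svdQ.
rewrite -/(singular_values A) in svdA truncE; rewrite -/(singular_values Q) -/s in svdQ.
set sA := singular_values A in svdA truncE.
have [UU VV sA_ge0 _ _] := svdA; have [UU' VV' _ _ _] := svdQ.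
have truncV i : svd_trunc A t *m col i V = (t < sA 0 i)%R%:R *: (A *m col i V).
  rewrite (svd_mul_col svdA) truncE mulmx_suml.
  transitivity (\sum_(k < n | t < sA 0 k) (sA 0 k * (k == i)%:R) *: col k U).
    apply: eq_bigr => k _; rewrite -scalemxAl -mulmxA.
    have -> : (col k V)^T *m col i V = ((k == i)%:R)%:M.
      apply/matrixP => a b; rewrite !ord1 [RHS]mxE eqxx mulr1n -(mxdot_col k i VV).
      by rewrite mxE; apply: eq_bigr => l _; rewrite big_ord1 !mxE.
    by rewrite mul_mx_scalar scalerA.
  rewrite big_mkcond (bigD1 i) //= eqxx big1 ?addr0 => [|k ki].
    by case: ifP => _; rewrite ?mulr1 ?scale1r ?scale0r.
  by rewrite (negPf ki) mulr0 scale0r if_same.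
have sqnV i : sqn (col i V) = 1 by rewrite sqnE mxdot_col // eqxx.
have sqnU i : sqn (col i U') = 1 by rewrite sqnE mxdot_col // eqxx.
have sqnV' i : sqn (col i V') = 1 by rewrite sqnE mxdot_col // eqxx.
rewrite -(sqn_orthr _ VV) sqn_col (bigID (mem I)) /=.
have inI : \sum_(i in I) sqn (col i ((svd_trunc A t - Q) *m V)) <= #|S|%:R * K.
  apply: (@le_trans _ _ (\sum_(i in I) K)).
    apply: ler_sum => i; rewrite inE -/sA => iI; rewrite mulmx_col mulmxBl truncV iI scale1r.
    by rewrite -mulmxBl; apply: le_trans (AQ _) _; rewrite sqnV mulr1.
  rewrite sumr_const -[K *+ _]mulr_natl; apply: ler_wpM2r => //.
  by rewrite ler_nat card_large_singular_values.
have notinI : \sum_(i | i \notin I) sqn (col i ((svd_trunc A t - Q) *m V)) <=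
    #|S|%:R * (2 * K + 2 * t ^+ 2) + \sum_(j | j \notin S) s 0 j ^+ 2.
  have cE i : i \notin I -> sqn (col i ((svd_trunc A t - Q) *m V)) =
      \sum_j mxdot (col j U') (Q *m col i V) ^+ 2.
    rewrite inE -/sA => iI; rewrite orth_parseval // mulmx_col mulmxBl truncV (negPf iI).
    by rewrite scale0r sub0r sqnN.
  have partial (F : 'I_n -> R) : (forall i, 0 <= F i) -> \sum_(i | i \notin I) F i <= \sum_i F i.
    by move=> F0; rewrite [leRHS](bigID (fun i => i \notin I)) /= lerDl sumr_ge0.
  rewrite (eq_bigr _ cE) exchange_big /= (bigID (mem S)) /= lerD //; last first.
    apply: ler_sum => j jS; apply: le_trans (partial _ (fun i => sqr_ge0 _)) _.
    rewrite -[leRHS]mulr1 -(sqnV' j) -(orth_parseval (col j V') VV) mulr_sumr.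
    by apply: ler_sum => i _; rewrite (svd_mxdot svdQ) exprMn mxdotC.
  rewrite mulr_natl -sumr_const; apply: ler_sum => j _.
  set w := (A - Q) *m col j U'.
  have dE i : mxdot (col j U') (Q *m col i V) =
      sA 0 i * mxdot (col i U) (col j U') - mxdot (col i V) w.
    rewrite -[X in mxdot _ (X *m _)](subKr A) mulmxBl mxdotDr mxdotNr (svd_mul_col svdA).
    rewrite mxdotC mxdotZl; congr (_ - _).
    by rewrite mxdot_mull AQ_sym mxdotC.
  apply: (@le_trans _ _ (\sum_(i | i \notin I) (2 * mxdot (col i V) w ^+ 2 +
      2 * t ^+ 2 * mxdot (col i U) (col j U') ^+ 2))).
    apply: ler_sum => i; rewrite inE -/sA -leNgt dE => sAt.
    set a := mxdot _ (col j U'); set b := mxdot _ w.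
    have st : sA 0 i ^+ 2 * a ^+ 2 <= t ^+ 2 * a ^+ 2.
      by rewrite ler_wpM2r ?sqr_ge0 // lerXn2r ?nnegrE.
    have := sqr_ge0 (sA 0 i * a + b); rewrite sqrrD sqrrB exprMn.
    by move: st; move: (sA 0 i ^+ 2 * a ^+ 2) (sA 0 i * a * b) (b ^+ 2) => *; lra.
  rewrite big_split /= -!mulr_sumr lerD //.
    rewrite ler_wpM2l //; apply: le_trans (partial _ (fun i => sqr_ge0 _)) _.
    by rewrite orth_parseval //; apply: le_trans (AQ _) _; rewrite sqnU mulr1.
  rewrite -[leRHS]mulr1 ler_wpM2l ?mulr_ge0 ?sqr_ge0 //.
  apply: le_trans (partial _ (fun i => sqr_ge0 _)) _.
  by rewrite orth_parseval // sqnU.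
apply: le_trans (lerD inI notinI) _.
by rewrite addrA -mulrDr lerD2r ler_wpM2l //; lra.
Qed.

End Truncation.

(** * Universal singular value thresholding *)

Section USVT.
Variable R : realType.

Definition hollow n (Q : 'M[R]_n) : 'M[R]_n := \matrix_(i, j) if i == j then 0 else Q i j.

(** Indices start at 0, so [j.+1] is the rank of a singular value; the largest rank in the set
    bounds its size. *)
Lemma card_ord_succ_le n (d : R) : 0 <= d -> #|[set j : 'I_n | j.+1%:R <= d]%SET|%:R <= d.
Proof.
move=> d0; set S := [set _ | _]%SET.
have [->|[j0 j0S]] := set_0Vmem S; first by rewrite cards0.
have [j jS jmax] := @arg_maxnP _ j0 (fun i => i \in S) (@nat_of_ord n) j0S.
apply: (@le_trans _ _ j.+1%:R); last by move: jS; rewrite /= inE.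
rewrite ler_nat -(size_iota 0 j.+1) cardE -(size_map val).
apply: uniq_leq_size; first by rewrite map_inj_uniq ?enum_uniq //; exact: val_inj.
move=> k /mapP[i]; rewrite mem_enum => iS ->; rewrite mem_iota add0n ltnS.
exact: jmax.
Qed.

(** The clipping in [usvt] is the projection onto an interval that contains [q]. *)
Lemma clip_contraction (x q : R) : 0 <= q <= 1 ->
  (q - (if x < 0 then 0 else if 1 < x then 1 else x)) ^+ 2 <= (x - q) ^+ 2.
Proof.
move=> /andP[q0 q1]; case: ltP => x0; last case: ltP => x1.
- by rewrite subr0 -[leRHS]sqrrN opprB lerXn2r ?nnegrE //; lra.
- by rewrite -[leLHS]sqrrN opprB lerXn2r ?nnegrE //; lra.
- by rewrite -[leLHS]sqrrN opprB.
Qed.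

(* 72 is the constant of the spectral bound, 146 = 2 * 72 + 2 accounts for the
   diagonal of [Q], and the threshold needs 18 ^ 2 > 2 * (146 + 1). *)
Lemma usvt_error n (A Q : 'M[R]_n) (r d C : R) :
  let D := n%:R * r in
  (0 < n)%N -> A^T = A -> Q^T = Q -> (forall u v, 0 <= Q u v <= r) -> 0 < r <= 1 ->
  0 <= d -> 0 <= C ->
  \sum_(j < n | d < j.+1%:R) singular_values Q 0 j ^+ 2 <= C * (D * d) ->
  (forall x : 'cV[R]_n, sqn ((A - hollow Q) *m x) <= 72 * D * sqn x) ->
  sqn (hollow Q - usvt A (18 * Num.sqrt D)) <= (1086 * (1 + C) + C) * (D * d).
Proof.
move=> D n0 Asym Qsym Q0r /andP[r0 r1] d0 C0 tail close.
have n1 : 1 <= n%:R :> R by rewrite ler1n.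
have D0 : 0 < D by rewrite mulr_gt0 // ltr0n.
have rD : r ^+ 2 <= D.
  apply: (@le_trans _ _ r); first by rewrite expr2 ler_piMl // ltW.
  by rewrite /D ler_peMl // ltW.
set t := 18 * Num.sqrt D.
have t2 : t ^+ 2 = 324 * D by rewrite /t exprMn sqr_sqrtr ?ltW //; ring.
pose dg := diag_mx (\row_i Q i i).
have QE : A - Q = (A - hollow Q) - dg.
  apply/matrixP => i j; rewrite !mxE; case: eqVneq => [->|_] /=; last by rewrite subr0.
  by rewrite mulr1n subr0.
have dgx (x : 'cV[R]_n) : sqn (dg *m x) <= D * sqn x.
  apply: (@le_trans _ _ (r ^+ 2 * sqn x)); last by rewrite ler_wpM2r ?sqn_ge0.
  rewrite /sqn mulr_sumr; apply: ler_sum => i _; rewrite mulr_sumr; apply: ler_sum => j _.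
  rewrite mul_diag_mx !mxE exprMn ler_wpM2r ?sqr_ge0 //.
  by have /andP[? ?] := Q0r i i; rewrite lerXn2r ?nnegrE // ltW.
have AQ (x : 'cV[R]_n) : sqn ((A - Q) *m x) <= 146 * D * sqn x.
  rewrite QE mulmxBl; apply: le_trans (sqnD_le _ _) _; rewrite sqnN.
  by have := close x; have := dgx x; lra.
pose s := singular_values Q.
(* [S] holds the indices of rank at most [d] and the later ones whose square exceeds [D]. The tail
   sum is at most [C D d], so there are at most [C d] of the second kind. *)
pose S := [set j : 'I_n | (j.+1%:R <= d) || (D < s 0 j ^+ 2)]%SET.
have Ssmall j : j \notin S -> s 0 j ^+ 2 <= D.
  by rewrite inE negb_or => /andP[_]; rewrite -leNgt.
have AQsym : (A - Q)^T = A - Q by rewrite linearB /= Asym Qsym.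
have := @svd_trunc_error _ n A Q (146 * D) t D S AQ AQsym
  ltac:(by rewrite /t mulr_ge0 ?sqrtr_ge0) ltac:(lra) ltac:(rewrite t2; lra) Ssmall.
rewrite -/s t2 => err.
have sumS : \sum_(j | j \notin S) s 0 j ^+ 2 <= C * (D * d).
  apply: le_trans tail; rewrite [leRHS](bigID (mem S)) /=.
  rewrite (eq_bigl (fun j : 'I_n => (d < j.+1%:R) && (j \notin S))) => [|j].
    by rewrite lerDr sumr_ge0 // => j _; exact: sqr_ge0.
  by rewrite inE negb_or -ltNge; case: (d < _).
have cardS : #|S|%:R <= (1 + C) * d.
  pose S1 := [set j : 'I_n | j.+1%:R <= d]%SET.
  pose S2 := [set j : 'I_n | (d < j.+1%:R) && (D < s 0 j ^+ 2)]%SET.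
  have SE : S = (S1 :|: S2)%SET.
    by apply/setP=> j; rewrite !inE (ltNge d); case: (_ <= d).
  apply: (@le_trans _ _ (#|S1|%:R + #|S2|%:R)).
    by rewrite -natrD ler_nat SE cardsU leq_subr.
  rewrite mulrDl mul1r lerD ?card_ord_succ_le //.
  rewrite -(ler_pM2r D0) -mulrA [d * D]mulrC; apply: le_trans tail.
  rewrite mulr_natl -sumr_const; apply: (@le_trans _ _ (\sum_(j in S2) s 0 j ^+ 2)).
    by apply: ler_sum => j; rewrite inE => /andP[_ /ltW].
  rewrite [leRHS](bigID (mem S2)) /= (eq_bigl (fun j : 'I_n => (d < j.+1%:R) && (j \in S2))) => [|j].
    by rewrite lerDl sumr_ge0 // => j _; exact: sqr_ge0.
  by rewrite inE; case: (d < _).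
have clip : sqn (hollow Q - usvt A t) <= sqn (svd_trunc A t - Q).
  apply: ler_sum => i _; apply: ler_sum => j _; rewrite !mxE.
  case: eqVneq => _; first by rewrite subrr expr0n sqr_ge0.
  apply: clip_contraction; have /andP[q0 qr] := Q0r i j.
  by rewrite q0 (le_trans qr).
apply: le_trans clip _; apply: le_trans err _.
(* With [K = 146 D] and [t^2 = 324 D], the coefficient is [3 * 146 + 2 * 324 = 1086]. *)
apply: (@le_trans _ _ ((1 + C) * d * (3 * (146 * D) + 2 * (324 * D)) + C * (D * d))).
  apply: lerD => //; apply: ler_wpM2r cardS; apply: addr_ge0; exact: mulr_ge0 (mulr_ge0 _ (ltW D0)).
by rewrite le_eqVlt; apply/orP; left; apply/eqP; ring.
Qed.

End USVT.

(** * Permutations *)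

Section FixCore.
Variables (T : finType) (C : {set T}).
Implicit Types s : {perm T}.

Definition moved s : {set T} := [set x in C | s x != x]%SET.

Lemma fix_core s : exists s' : {perm T}, (forall x, x \in C -> s' x = x) /\
  (#|[set x | s' x != s x]%SET| <= 2 * #|moved s|)%N.
Proof.
have [m] := ubnP #|moved s|; elim: m s => // m IH s.
have [s0|[u]] := set_0Vmem (moved s) => [_|um].
  exists s; split=> [x xC|].
    apply/eqP/negP => /negP sx; have : x \in moved s by rewrite inE xC.
    by rewrite s0 inE.
  by rewrite eq_card0 // => x; rewrite !inE eqxx.
pose t := (s * tperm (s u) u)%g.
have tE x : t x = tperm (s u) u (s x) by rewrite permM.
have sub : (moved t \subset moved s :\ u)%SET.
  apply/fintype.subsetP => x; rewrite !inE tE => /andP[xC]; rewrite xC andTb.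
  have [->|xu] := eqVneq x u; first by rewrite tpermL eqxx.
  move=> /= txx; apply: contra txx => /eqP sx; rewrite sx tpermD //.
    by apply: contra xu => /eqP su; rewrite -(inj_eq (@perm_inj _ s)) sx su.
  by rewrite eq_sym.
have card_moved : (#|moved t| < #|moved s|)%N.
  by rewrite (cardsD1 u (moved s)) um ltnS; exact: subset_leq_card.
move=> sm; have [|s' [s'C s't]] := IH t; first exact: leq_trans card_moved _.
exists s'; split=> //.
have st : (#|[set x | t x != s x]%SET| <= 2)%N.
  apply: leq_trans (_ : #|[set u; (s^-1)%g u]%SET| <= 2)%N; last first.
    by rewrite cards2; case: eqP.
  apply: subset_leq_card; apply/fintype.subsetP => x; rewrite !inE tE.
  case: tpermP => [/perm_inj ->|sxu|_ _]; rewrite ?eqxx //.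
  by move=> _; apply/orP; right; rewrite -sxu permK.
apply: (leq_trans (n := #|[set x | s' x != t x] :|: [set x | t x != s x]|%SET)).
  apply: subset_leq_card; apply/fintype.subsetP => x; rewrite !inE.
  by have [->|] := eqVneq (s' x) (t x); rewrite ?orbT.
rewrite cardsU; apply: leq_trans (leq_subr _ _) _.
by apply: leq_trans (leq_add s't st) _; rewrite -[X in (_ + X)%N]muln1 -mulnDr leq_mul2l addn1.
Qed.

(** A permutation with moved set [K] is supported on [K] and the complement of [C]: there are at
    most [|C|^k] choices of [K], then a factorial of the size of the support. *)
Lemma card_moved_le k :
  (#|[set s | #|moved s| == k]%SET| <= #|C| ^ k * (k + #|~: C|) ^ (k + #|~: C|))%N.
Proof.
pose sub K : {set {perm T}} := [set s | perm_on (K :|: ~: C)%SET s]%SET.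
apply: (leq_trans (n := #|\bigcup_(K in [set K : {set T} | (K \subset C) && (#|K| == k)]) sub K|%SET)).
  apply: subset_leq_card; apply/fintype.subsetP => s; rewrite inE => sk.
  apply/finset.bigcupP; exists (moved s); rewrite !inE ?sk ?andbT.
    by apply/fintype.subsetP => x; rewrite !inE => /andP[].
  by apply/fintype.subsetP => x; rewrite !inE => sx; rewrite sx andbT orbN.
apply: (leq_trans (n := \sum_(K in [set K : {set T} | (K \subset C) && (#|K| == k)]%SET)
   (k + #|~: C|%SET) ^ (k + #|~: C|%SET))%N).
  elim/big_rec2: _ => [|K m S]; rewrite ?cards0 // inE => /andP[_ /eqP Kk] Sm.
  rewrite cardsU; apply: leq_trans (leq_subr _ _) _; rewrite leq_add // /sub cardsE card_perm.
  have KC : (#|K :|: ~: C|%SET <= k + #|~: C|%SET)%N.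
    by rewrite cardsU Kk leq_subr.
  have fact_exp m' : (m'`! <= m' ^ m')%N.
    elim: m' => // m' IHm; rewrite factS expnS leq_mul2l /=.
    by apply: leq_trans IHm _; case: m' => // m'; rewrite leq_exp2r.
  by apply: leq_trans (leq_fact KC) _.
rewrite sum_nat_const leq_mul2r; apply/orP; right.
rewrite cards_draws; apply: (@leq_trans (#|C| ^_ k)).
  by rewrite -bin_ffact leq_pmulr ?fact_gt0.
elim: k => [|k IH]; first by rewrite ffactn0.
by rewrite ffactnSr expnSr leq_mul ?leq_subr.
Qed.

End FixCore.

(** * Bounded differences *)

Section BoundedDifferences.
Variables (R : realType) (E W : finType) (p : E -> W -> R).
Hypothesis p_ge0 : forall e w, 0 <= p e w.
Hypothesis p_sum1 : forall e, \sum_w p e w = 1.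
Implicit Types (f : {ffun E -> W} -> R) (x : {ffun E -> W}).

Definition upd x e w : {ffun E -> W} := [ffun a => if a == e then w else x a].

Definition average e f x : R := \sum_w p e w * f (upd x e w).

Definition bounded_diff f (c : E -> R) :=
  forall x e w w', `|f (upd x e w) - f (upd x e w')| <= c e.

Lemma bounded_diff_coord f c :
  (forall (x y : {ffun E -> W}) e, (forall a, a != e -> x a = y a) -> `|f x - f y| <= c e) ->
  bounded_diff f c.
Proof. by move=> fc x e w w'; apply: fc => a ae; rewrite !ffunE (negPf ae). Qed.

(** From [expR y * (1 - y) <= expR y * expR (- y) = 1]: multiplied by [1 - y], the right-hand side
    is [1 + y^2 (1 - 2 y)]. *)
Lemma expR_le_quadratic (y : R) : `|y| <= 2^-1 -> expR y <= 1 + y + 2 * y ^+ 2.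
Proof.
rewrite ler_norml => /andP[y1 y2].
have y0 : 0 < 1 - y by lra.
have h : expR y * (1 - y) <= 1.
  by rewrite (le_trans (ler_wpM2l (expR_ge0 y) (expR_ge1Dx (- y)))) // expRxMexpNx_1.
have yy : 0 <= y ^+ 2 * (1 - 2 * y) by rewrite mulr_ge0 ?sqr_ge0 //; lra.
rewrite -(ler_pM2r y0); apply: le_trans h _.
by rewrite -subr_ge0 (_ : _ - _ = y ^+ 2 * (1 - 2 * y)) //; ring.
Qed.

Lemma updC x a b v w : a != b -> upd (upd x a v) b w = upd (upd x b w) a v.
Proof.
move=> ab; apply/ffunP => c; rewrite !ffunE.
by case: (eqVneq c b) => [->|//]; rewrite eq_sym (negPf ab).
Qed.

Lemma upd_upd x a v w : upd (upd x a v) a w = upd x a w.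
Proof. by apply/ffunP => c; rewrite !ffunE; case: eqP. Qed.

Lemma average_le e f g x : (forall y, f y <= g y) -> average e f x <= average e g x.
Proof. by move=> fg; apply: ler_sum => w _; rewrite ler_wpM2l. Qed.

Lemma weight_upd x e w :
  \prod_a p a (upd x e w a) * p e (x e) = \prod_a p a (x a) * p e w.
Proof.
rewrite (bigD1 e) //= [in RHS](bigD1 e) //= ffunE eqxx.
rewrite (eq_bigr (fun a => p a (x a))) => [|a ae]; last by rewrite ffunE (negPf ae).
by ring.
Qed.

Lemma Ex_average e f : Ex p (average e f) = Ex p f.
Proof.
rewrite /Ex /average.
transitivity (\sum_(z : {ffun E -> W} * W) (\prod_a p a (z.1 a) * p e z.2) * f (upd z.1 e z.2)).
  rewrite -(pair_bigA _ (fun x w => \prod_a p a (x a) * p e w * f (upd x e w))) /=.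
  by apply: eq_bigr => x _; rewrite mulr_sumr; apply: eq_bigr => w _; rewrite mulrA.
(* Exchanging the extra letter with coordinate [e] is an involution preserving the joint weight:
   resampling one coordinate does not change the law. *)
pose h (z : {ffun E -> W} * W) := (upd z.1 e z.2, z.1 e).
have hK : involutive h.
  move=> [x w]; rewrite /h /= upd_upd ffunE eqxx; congr (_, _).
  by apply/ffunP => a; rewrite ffunE; case: eqP => [->|].
rewrite (reindex_inj (inv_inj hK)) /=.
transitivity (\sum_(z : {ffun E -> W} * W) (\prod_a p a (z.1 a) * p e z.2) * f z.1).
  apply: eq_bigr => -[x w] _ /=; rewrite weight_upd upd_upd; congr (_ * f _).
  by apply/ffunP => a; rewrite ffunE; case: eqP => [->|].
rewrite -(pair_bigA _ (fun x w => \prod_a p a (x a) * p e w * f x)) /=.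
by apply: eq_bigr => x _; rewrite -mulr_suml -mulr_sumr p_sum1 mulr1.
Qed.

Lemma average_bounded_diff e f c : (forall a, 0 <= c a) ->
  bounded_diff f c -> bounded_diff (average e f) c.
Proof.
move=> c0 fc x a w w'; rewrite /average -sumrB.
have [->|ae] := eqVneq a e.
  by rewrite big1 ?normr0 // => v _; rewrite !upd_upd subrr.
apply: le_trans (ler_norm_sum _ _ _) _; rewrite -[leRHS]mul1r -(p_sum1 e) mulr_suml.
apply: ler_sum => v _; rewrite -mulrBr normrM (ger0_norm (p_ge0 e v)) ler_wpM2l //.
by rewrite updC // [upd (upd x a w') e v]updC // fc.
Qed.

(** Along coordinate [e] all values lie within [c] of their average, so the quadratic bound on the
    exponential applies, and its linear term averages out. *)
Lemma average_expR e f (l c : R) x : 0 <= l -> l * c <= 2^-1 ->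
  (forall w w', `|f (upd x e w) - f (upd x e w')| <= c) ->
  average e (fun y => expR (l * f y)) x <= expR (l * average e f x + 2 * l ^+ 2 * c ^+ 2).
Proof.
move=> l0 lc fc; set m := average e f x.
have dev w : `|f (upd x e w) - m| <= c.
  rewrite -[f _]mul1r -(p_sum1 e) mulr_suml /m /average -sumrB.
  apply: le_trans (ler_norm_sum _ _ _) _; rewrite -[leRHS]mul1r -(p_sum1 e) mulr_suml.
  apply: ler_sum => v _; rewrite -mulrBr normrM (ger0_norm (p_ge0 e v)).
  by rewrite ler_wpM2l.
apply: (@le_trans _ _ (expR (l * m) *
   \sum_w p e w * (1 + l * (f (upd x e w) - m) + 2 * l ^+ 2 * c ^+ 2))).
  rewrite mulr_sumr; apply: ler_sum => w _.
  rewrite mulrCA; apply: ler_wpM2l => //.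
  have -> : l * f (upd x e w) = l * m + l * (f (upd x e w) - m) by ring.
  rewrite expRD; apply: ler_wpM2l; first exact: expR_ge0.
  have nd : `|l * (f (upd x e w) - m)| <= l * c.
    by rewrite normrM (ger0_norm l0) ler_wpM2l.
  apply: le_trans (expR_le_quadratic (le_trans nd lc)) _.
  rewrite lerD2l exprMn mulrA ler_wpM2l ?mulr_ge0 ?sqr_ge0 // -real_normK ?num_real //.
  by rewrite lerXn2r ?nnegrE // (le_trans _ (dev w)).
have -> : \sum_w p e w * (1 + l * (f (upd x e w) - m) + 2 * l ^+ 2 * c ^+ 2) =
    1 + 2 * l ^+ 2 * c ^+ 2.
  transitivity (\sum_w ((1 + 2 * l ^+ 2 * c ^+ 2 - l * m) * p e w + l * (p e w * f (upd x e w)))).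
    by apply: eq_bigr => w _; ring.
  by rewrite big_split /= -!mulr_sumr p_sum1 -/(average e f x) -/m; ring.
by rewrite expRD; apply: ler_wpM2l; [exact: expR_ge0|exact: expR_ge1Dx].
Qed.

Lemma updates_eq (h : {ffun E -> W} -> R) :
  (forall x e w, h (upd x e w) = h x) -> forall x y, h x = h y.
Proof.
move=> hE x y; pose z s := foldr (fun e z => upd z e (y e)) x s.
have hz s : h (z s) = h x by elim: s => //= e s IH; rewrite hE.
have -> : y = z (enum E); last by rewrite hz.
have zE s a : z s a = if a \in s then y a else x a.
  elim: s => //= e s IH; rewrite ffunE inE.
  by case: eqP => [->|] //=; rewrite IH.
by apply/ffunP => a; rewrite zE mem_enum.
Qed.

(** McDiarmid's argument: coordinates are averaged out one at a time, each costing [2 l^2 c_e^2] in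
    the exponent, while averaging keeps the other differences bounded. The restriction on [l] is
    that of [expR_le_quadratic]. *)
Lemma bounded_diff_expR f c (l : R) : 0 <= l -> (forall e, l * c e <= 2^-1) ->
  (forall e, 0 <= c e) -> bounded_diff f c ->
  Ex p (fun x => expR (l * f x)) <= expR (l * Ex p f + 2 * l ^+ 2 * \sum_e c e ^+ 2).
Proof.
move=> l0 lc c0 fc; pose avs s g := foldr average g s.
have avs_diff s : bounded_diff (avs s f) c.
  by elim: s => //= e s IH; exact: average_bounded_diff.
have avs_le s x : avs s (fun y => expR (l * f y)) x <=
    expR (l * avs s f x + 2 * l ^+ 2 * \sum_(e <- s) c e ^+ 2).
  elim: s x => [|e s IH] x /=; first by rewrite big_nil mulr0 addr0.
  apply: le_trans (average_le e x IH) _.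
  rewrite (_ : average e _ x = average e (fun y => expR (l * avs s f y)) x *
      expR (2 * l ^+ 2 * \sum_(e <- s) c e ^+ 2)); last first.
    by rewrite /average mulr_suml; apply: eq_bigr => w _; rewrite expRD mulrA.
  rewrite big_cons mulrDr addrA expRD.
  apply: ler_wpM2r; first exact: expR_ge0.
  exact: (average_expR l0 (lc e) (avs_diff s x e)).
have Ex_avs s g : Ex p (avs s g) = Ex p g.
  by elim: s => //= e s IH; rewrite Ex_average.
have avs_upd s e : e \in s -> forall x w, avs s f (upd x e w) = avs s f x.
  elim: s => //= a s IH; rewrite inE; have [-> _ x w|ea /= es x w] := eqVneq e a.
    by apply: eq_bigr => v _; rewrite upd_upd.
  by apply: eq_bigr => v _; rewrite updC // IH.
have avs_cst x : avs (enum E) f x = Ex p f.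
  rewrite -(Ex_avs (enum E)) -[LHS](Ex_cst p_sum1); apply: eq_Ex => y.
  apply: updates_eq => z e w; apply: avs_upd; exact: mem_enum.
rewrite -(Ex_avs (enum E)) -[leRHS](Ex_cst p_sum1); apply: Ex_le => // x.
by apply: le_trans (avs_le _ x) _; rewrite avs_cst big_enum.
Qed.

End BoundedDifferences.

(** * Spectral norm of a centered random graph *)

Section RandomGraph.
Variables (R : realType) (n : nat) (W : finType).

Definition pair_set (e : vertex_pair n) : {set 'I_n} := [set (val e).1; (val e).2]%SET.

Lemma pair_set_inj : injective pair_set.
Proof.
move=> [[a b] /= ab] [[c d] /= cd] /eqP; rewrite set2_eq /= ?neq_ltn ?cd //.
case/orP=> /andP[/eqP ac /eqP bd]; apply: val_inj; rewrite /= ac bd //.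
by move: ab; rewrite ac bd ltnNge (ltnW cd).
Qed.

Lemma pair_setP (u v : 'I_n) : u != v ->
  exists2 e : vertex_pair n, pair_set e = [set u; v]%SET &
    val e = (u, v) \/ val e = (v, u).
Proof.
rewrite neq_ltn => /orP[uv|vu].
  by exists (exist _ (u, v) uv) => //; left.
by exists (exist _ (v, u) vu); [exact: finset.setUC|right].
Qed.

Lemma edge_entry_diag (g : vertex_pair n -> W -> R) u x :
  edge_entry pair_set g [set u; u]%SET x = 0.
Proof.
rewrite /edge_entry; case: pickP => // -[[a b] /= ab].
rewrite eq_sym set2_eq /= ?neq_ltn ?ab // andbC orbb => /andP[/eqP ub /eqP ua].
by exfalso; move: ab; rewrite -ua -ub /= ltnn.
Qed.

Definition edge_mx (g : vertex_pair n -> W -> R) (x : {ffun vertex_pair n -> W}) : 'M[R]_n :=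
  \matrix_(u, v) edge_entry pair_set g [set u; v]%SET x.

Lemma edge_mx_sym g x : (edge_mx g x)^T = edge_mx g x.
Proof. by apply/matrixP => u v; rewrite !mxE finset.setUC. Qed.

Lemma edge_mxE g x u v e : pair_set e = [set u; v]%SET -> edge_mx g x u v = g e (x e).
Proof. by move=> uv; rewrite mxE -uv edge_entryE //; exact: pair_set_inj. Qed.

Lemma edge_mx_diag g x u : edge_mx g x u u = 0.
Proof. by rewrite mxE edge_entry_diag. Qed.

Definition adj (sel : W -> bool) := edge_mx (fun _ w => (sel w)%:R).

Definition cadj (sel : W -> bool) (Q : 'M[R]_n) :=
  edge_mx (fun (e : vertex_pair n) w => (sel w)%:R - Q (val e).1 (val e).2).

Lemma cadj_diag sel Q x u : cadj sel Q x u u = 0.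
Proof. exact: edge_mx_diag. Qed.

Lemma cadj_edge sel Q x u v e : pair_set e = [set u; v]%SET ->
  cadj sel Q x u v = (sel (x e))%:R - Q (val e).1 (val e).2.
Proof. exact: edge_mxE. Qed.

Lemma cadjE sel Q x : Q^T = Q -> cadj sel Q x = adj sel x - hollow Q.
Proof.
move=> Qsym; apply/matrixP => u v; rewrite [RHS]mxE [X in _ + X]mxE [X in _ - X]mxE.
have [->|uv] := eqVneq u v; first by rewrite /adj /cadj !edge_mx_diag subr0.
have [e ee ev] := pair_setP uv; rewrite /cadj /adj !(edge_mxE _ _ ee).
by case: ev => ->; rewrite //= -[in LHS]Qsym mxE.
Qed.

Variables (p : vertex_pair n -> W -> R) (sel : W -> bool) (Q : 'M[R]_n) (r : R) (m : nat).
Hypothesis p_ge0 : forall e w, 0 <= p e w.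
Hypothesis p_sum1 : forall e, \sum_w p e w = 1.
Hypothesis sel_mean : forall e, \sum_w p e w * (sel w)%:R = Q (val e).1 (val e).2.
Hypothesis Q_ge0 : forall u v, 0 <= Q u v.
Hypothesis Q_le : forall u v, Q u v <= r.
Hypothesis r01 : 0 < r <= 1.

Let D := n%:R * r.

Lemma centered_le1 (e : vertex_pair n) w : `|(sel w)%:R - Q (val e).1 (val e).2| <= 1.
Proof.
have := Q_ge0 (val e).1 (val e).2; have := Q_le (val e).1 (val e).2.
have /andP[_ r1] := r01; case: (sel w) => h1 h2; rewrite /= ler_norml; apply/andP; split; lra.
Qed.

Lemma centered_mean0 (e : vertex_pair n) : \sum_w p e w * ((sel w)%:R - Q (val e).1 (val e).2) = 0.
Proof.
under eq_bigr do rewrite mulrBr.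
by rewrite sumrB sel_mean -mulr_suml p_sum1 mul1r subrr.
Qed.

Lemma centered_var (e : vertex_pair n) : \sum_w p e w * ((sel w)%:R - Q (val e).1 (val e).2) ^+ 2 <= r.
Proof.
set q := Q _ _; apply: le_trans (Q_le (val e).1 (val e).2).
apply: (@le_trans _ _ (q - q ^+ 2)); last by rewrite gerBl sqr_ge0.
rewrite le_eqVlt; apply/orP; left; apply/eqP.
transitivity (\sum_w ((1 - 2 * q) * (p e w * (sel w)%:R) + q ^+ 2 * p e w)).
  by apply: eq_bigr => w _; case: (sel w) => /=; ring.
by rewrite big_split /= -!mulr_sumr sel_mean p_sum1 -/q; ring.
Qed.

(** The expected value of the right-hand side is at most [n (3 sqrt D)^(2 (m+1))]; the factor [n^3]
    leaves a probability [n^-2] after Markov's inequality. *)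
Definition spectral_bad x : bool :=
  n%:R ^+ 3 * (3 * Num.sqrt D) ^+ (m.+1 + m.+1) < sqn (mxpow (cadj sel Q x) m.+1).

(* Markov's inequality for the trace of a power of the centered matrix. *)
Lemma spectral_bad_le : (0 < n)%N -> (m.+1 + m.+1).+1%:R ^+ 2 <= Num.sqrt D ->
  Pr p spectral_bad <= (n%:R ^+ 2)^-1.
Proof.
move=> n0 Tb; have n0R : 0 < n%:R :> R by rewrite ltr0n.
have /andP[r0 r1] := r01; have D0 : 0 < D by rewrite mulr_gt0.
set b := Num.sqrt D; have b0 : 0 < b by rewrite sqrtr_gt0.
set L := (m.+1 + m.+1)%N in Tb *.
apply: le_trans (markov_Ex p_ge0 _ _) _.
- by rewrite mulr_gt0 // exprn_gt0 // mulr_gt0.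
- by move=> x; exact: sqn_ge0.
rewrite ler_pdivrMr; last by rewrite mulr_gt0 // exprn_gt0 // mulr_gt0.
rewrite mulrA (_ : (n%:R ^+ 2)^-1 * n%:R ^+ 3 = n%:R); last first.
  by rewrite [_ ^+ 3]exprS mulrCA mulVf ?mulr1 // expf_neq0 ?gt_eqF.
rewrite (eq_Ex p (g := fun x => \sum_u mxpow (cadj sel Q x) L u u)); last first.
  by move=> x; rewrite sqn_mxpow // edge_mx_sym.
rewrite Ex_sum.
apply: (@le_trans _ _ (\sum_(u : 'I_n) (3 * b) ^+ L)); last first.
  by rewrite sumr_const card_ord -[leLHS]mulr_natl.
apply: ler_sum => u _.
have := norm_Ex_mxpow_le p_ge0 p_sum1 pair_set_inj (ltW r0) centered_mean0 centered_le1
  centered_var (M := cadj sel Q) (edge_mx_diag _) _ L [::] u u.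
move=> /(_ (fun x v w _ => _)) h.
apply: le_trans (ler_norm _) _.
rewrite (eq_Ex p (g := fun x => \prod_(s <- [::])
    edge_entry pair_set (fun (e : vertex_pair n) w => (sel w)%:R - Q (val e).1 (val e).2) s x *
      iter L (mulmx (cadj sel Q x)) 1%:M u u)); last by move=> x; rewrite big_nil mul1r.
apply: le_trans (h _) _; first by move=> *; rewrite mxE.
have -> : single_edges [::] = finset.set0 :> {set {set 'I_n}}.
  by apply/setP=> s; rewrite !inE.
have -> : repeated_edges [::] = finset.set0 :> {set {set 'I_n}}.
  by apply/setP=> s; rewrite !inE.
apply: le_trans (walk_weight_le (T := L.+1) (b := b) (U := [set u]%SET) r01 b0 _ Tb _ _ _ _) _.
- by rewrite sqr_sqrtr ?ltW // card_ord.
- by move=> e; rewrite !inE.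
- by rewrite inE.
- by rewrite cards1.
- by rewrite -finset.setI_eq0 finset.set0I.
rewrite !cards0 !expr0 mul1r divr1.
rewrite (_ : excess _ u = 0%N) ?expr0 ?mulr1 // /excess big1 // => w _.
rewrite (_ : single_degree _ w = 0%N); last by apply: eq_card0 => v; rewrite !inE.
by case: (w == u).
Qed.

(** In the root of order [m.+1], [n^3] becomes at most 8 since [n <= 2^(m+1)]. With the 9 from
    [(3 sqrt D)^2] this gives 72. *)
Lemma spectral_good x (y : 'cV[R]_n) : (n <= 2 ^ m.+1)%N -> ~~ spectral_bad x ->
  sqn ((cadj sel Q x) *m y) <= 72 * D * sqn y.
Proof.
move=> nm; rewrite -leNgt => good; have /andP[r0 r1] := r01.
have D0 : 0 <= D by rewrite mulr_ge0 // ltW.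
have := sqn_mulmx_pow_le y m (edge_mx_sym (fun (e : vertex_pair n) w => (sel w)%:R - Q (val e).1 (val e).2) x).
rewrite -/(cadj sel Q x) => h.
have : sqn (cadj sel Q x *m y) ^+ m.+1 <= (72 * D * sqn y) ^+ m.+1.
  apply: le_trans h _; rewrite [leRHS]exprMn; apply: ler_wpM2r.
    by rewrite exprn_ge0 // sqn_ge0.
  apply: le_trans good _; rewrite addnn -mul2n exprM.
  have -> : (3 * Num.sqrt D) ^+ 2 = 3 ^+ 2 * D by rewrite exprMn sqr_sqrtr.
  rewrite (_ : 72 * D = 2 ^+ 3 * (3 ^+ 2 * D)); last by ring.
  rewrite [leRHS]exprMn; apply: ler_wpM2r.
    by rewrite exprn_ge0 // mulr_ge0.
  rewrite -exprM mulnC exprM lerXn2r ?nnegrE ?exprn_ge0 //.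
  by rewrite -natrX ler_nat.
have rhs0 : 0 <= 72 * D * sqn y by rewrite mulr_ge0 ?sqn_ge0 // (mulr_ge0 _ D0).
by rewrite ler_pXn2r ?nnegrE ?sqn_ge0.
Qed.

End RandomGraph.

(** * The matching statistic *)

Section Matching.
Variables (R : realType) (n : nat) (C : {set 'I_n}).
Let W : finType := (bool * bool)%type.
Variables (p : vertex_pair n -> W -> R) (Q1 Q2 : 'M[R]_n) (r1 r2 : R).
Hypothesis p_ge0 : forall e w, 0 <= p e w.
Hypothesis p_sum1 : forall e, \sum_w p e w = 1.
Hypothesis mean1 : forall e, \sum_w p e w * (w.1)%:R = Q1 (val e).1 (val e).2.
Hypothesis mean2 : forall e, \sum_w p e w * (w.2)%:R = Q2 (val e).1 (val e).2.
Hypothesis Q1_ge0 : forall u v, 0 <= Q1 u v.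
Hypothesis Q2_ge0 : forall u v, 0 <= Q2 u v.
Hypothesis Q1_le : forall u v, Q1 u v <= r1.
Hypothesis Q2_le : forall u v, Q2 u v <= r2.
Hypothesis r1_01 : 0 <= r1 <= 1.
Hypothesis r2_01 : 0 <= r2 <= 1.
Hypothesis junk_uncorrelated : forall e, ~~ (pair_set e \subset C) ->
  \sum_w p e w * (((w.1)%:R - Q1 (val e).1 (val e).2) *
                  ((w.2)%:R - Q2 (val e).1 (val e).2)) = 0.

Let Om := {ffun vertex_pair n -> W}.
Let ca (x : Om) := cadj (fun w : W => w.1) Q1 x.
Let cb (x : Om) := cadj (fun w : W => w.2) Q2 x.

Definition relabel (s : {perm 'I_n}) (N : 'M[R]_n) : 'M[R]_n :=
  \matrix_(u, v) N (s u) (s v).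

(** Both factors are centered, so this is the covariance of an entry of the first graph with an
    entry of the second. *)
Definition kappa u v u' v' : R := Ex p (fun x => ca x u v * cb x u' v').

Definition signal (s : {perm 'I_n}) : R :=
  2^-1 * \sum_u \sum_v (kappa u v u v - kappa u v (s u) (s v)).

(** A positive value says that [s'] matches the centered graphs better than [s]. *)
Definition matchstat (s s' : {perm 'I_n}) (x : Om) : R :=
  mxdot (ca x) (relabel s' (cb x) - relabel s (cb x)).

Lemma edge_mx_set (g : vertex_pair n -> W -> R) x u v u' v' :
  [set u; v]%SET = [set u'; v']%SET -> edge_mx g x u v = edge_mx g x u' v'.
Proof. by move=> e; rewrite !mxE e. Qed.

Lemma ca_le1 x u v : `|ca x u v| <= 1.
Proof.
have [->|uv] := eqVneq u v; first by rewrite /ca cadj_diag normr0.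
have [e ee _] := pair_setP uv; rewrite /ca (cadj_edge _ _ _ ee).
have := Q1_ge0 (val e).1 (val e).2; have := Q1_le (val e).1 (val e).2.
have /andP[_ ?] := r1_01; rewrite ler_norml.
by case: (x e).1 => /= ? ?; apply/andP; split; lra.
Qed.

Lemma cb_le1 x u v : `|cb x u v| <= 1.
Proof.
have [->|uv] := eqVneq u v; first by rewrite /cb cadj_diag normr0.
have [e ee _] := pair_setP uv; rewrite /cb (cadj_edge _ _ _ ee).
have := Q2_ge0 (val e).1 (val e).2; have := Q2_le (val e).1 (val e).2.
have /andP[_ ?] := r2_01; rewrite ler_norml.
by case: (x e).2 => /= ? ?; apply/andP; split; lra.
Qed.

Lemma kappa_neq u v u' v' : [set u; v]%SET != [set u'; v']%SET -> kappa u v u' v' = 0.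
Proof.
move=> ne; rewrite /kappa.
have [->|uv] := eqVneq u v.
  by rewrite -[RHS](Ex_cst p_sum1); apply: eq_Ex => x; rewrite /ca cadj_diag mul0r.
have [->|uv'] := eqVneq u' v'.
  by rewrite -[RHS](Ex_cst p_sum1); apply: eq_Ex => x; rewrite /cb cadj_diag mulr0.
have [e ee _] := pair_setP uv; have [e' ee' _] := pair_setP uv'.
rewrite (eq_Ex p (g := fun x => (((x e).1)%:R - Q1 (val e).1 (val e).2) *
  (((x e').2)%:R - Q2 (val e').1 (val e').2))); last first.
  by move=> x; rewrite /ca /cb (cadj_edge _ _ _ ee) (cadj_edge _ _ _ ee').
rewrite (Ex_coord2 p_sum1 (fun w : W => (w.1)%:R - Q1 (val e).1 (val e).2)
  (fun w : W => (w.2)%:R - Q2 (val e').1 (val e').2)); last first.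
  by apply: contra ne => /eqP eq; rewrite -ee -ee' eq.
rewrite (Ex_coord p_sum1 e (fun w : W => (w.1)%:R - Q1 (val e).1 (val e).2)).
rewrite (centered_mean0 p_sum1 (sel := fun w : W => w.1)) ?mul0r //.
Qed.

Lemma kappa_junk u v : ~~ ([set u; v]%SET \subset C) -> kappa u v u v = 0.
Proof.
have [-> _|uv] := eqVneq u v.
  rewrite -[RHS](Ex_cst p_sum1); apply: eq_Ex => x.
  by rewrite /ca cadj_diag mul0r.
have [e ee _] := pair_setP uv; rewrite -ee => /junk_uncorrelated <-.
rewrite -(Ex_coord p_sum1 e (fun w : W => ((w.1)%:R - Q1 (val e).1 (val e).2) *
  ((w.2)%:R - Q2 (val e).1 (val e).2))).
by apply: eq_Ex => x; rewrite /ca /cb !(cadj_edge _ _ _ ee).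
Qed.

Lemma Ex_abs_le (sel : W -> bool) (Q : 'M[R]_n) e :
  (forall e, \sum_w p e w * (sel w)%:R = Q (val e).1 (val e).2) ->
  (forall u v, 0 <= Q u v) ->
  \sum_w p e w * `|(sel w)%:R - Q (val e).1 (val e).2| <= 2 * Q (val e).1 (val e).2.
Proof.
move=> meanQ Q_ge0; set q := Q _ _.
apply: (@le_trans _ _ (\sum_w (p e w * (sel w)%:R + q * p e w))).
  apply: ler_sum => w _; rewrite [q * _]mulrC -mulrDr ler_wpM2l //.
  apply: le_trans (ler_normB _ _) _; rewrite normr_nat ger0_norm //.
  exact: Q_ge0.
by rewrite big_split /= -mulr_sumr meanQ p_sum1 -/q; lra.
Qed.

(** One factor is bounded by 1, and a centered Bernoulli variable has absolute mean at most twice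
    its success probability; either factor can take either role. *)
Lemma kappa_le u v u' v' : `|kappa u v u' v'| <= 2 * r1 /\ `|kappa u v u' v'| <= 2 * r2.
Proof.
have /andP[r1_0 _] := r1_01; have /andP[r2_0 _] := r2_01.
have [->|uv] := eqVneq u v.
  rewrite /kappa (_ : Ex _ _ = 0) ?normr0 ?mulr_ge0 //.
  by rewrite -[RHS](Ex_cst p_sum1); apply: eq_Ex => x; rewrite /ca cadj_diag mul0r.
have [->|uv'] := eqVneq u' v'.
  rewrite /kappa (_ : Ex _ _ = 0) ?normr0 ?mulr_ge0 //.
  by rewrite -[RHS](Ex_cst p_sum1); apply: eq_Ex => x; rewrite /cb cadj_diag mulr0.
have [e ee _] := pair_setP uv; have [e' ee' _] := pair_setP uv'.
split; apply: le_trans (norm_Ex_le p_ge0 _) _.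
  apply: (@le_trans _ _ (Ex p (fun x => `|((x e).1)%:R - Q1 (val e).1 (val e).2|))).
    apply: Ex_le => // x; rewrite normrM /ca (cadj_edge _ _ _ ee).
    by rewrite ler_piMr ?cb_le1.
  rewrite (Ex_coord p_sum1 e (fun w : W => `|(w.1)%:R - Q1 (val e).1 (val e).2|)).
  apply: le_trans (Ex_abs_le _ (sel := fun w : W => w.1) mean1 Q1_ge0) _.
  by rewrite ler_wpM2l.
apply: (@le_trans _ _ (Ex p (fun x => `|((x e').2)%:R - Q2 (val e').1 (val e').2|))).
  apply: Ex_le => // x; rewrite normrM /cb (cadj_edge _ _ _ ee').
  by rewrite ler_piMl ?ca_le1.
rewrite (Ex_coord p_sum1 e' (fun w : W => `|(w.2)%:R - Q2 (val e').1 (val e').2|)).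
apply: le_trans (Ex_abs_le _ (sel := fun w : W => w.2) mean2 Q2_ge0) _.
by rewrite ler_wpM2l.
Qed.

Variables (s s' : {perm 'I_n}).
Hypothesis s'_core : forall u, u \in C -> s' u = u.

(** A pair inside the core is not moved. For any other pair the right side vanishes by lack of
    correlation; the image under [s'] is either the same pair again or a different one, which is
    independent. *)
Lemma kappa_core_fixed u v : kappa u v (s' u) (s' v) = kappa u v u v.
Proof.
have [/fintype.subsetP uvC|junk] := boolP ([set u; v]%SET \subset C).
  by rewrite !s'_core //; apply: uvC; rewrite !inE eqxx ?orbT.
rewrite (kappa_junk junk).
have [eq|ne] := eqVneq [set u; v]%SET [set s' u; s' v]%SET; last exact: kappa_neq.
rewrite -[RHS](kappa_junk junk) /kappa; apply: eq_Ex => x.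
by congr (_ * _); exact/edge_mx_set/esym.
Qed.

Definition disagree : {set 'I_n * 'I_n} :=
  [set z | (s' z.1 != s z.1) || (s' z.2 != s z.2)]%SET.

Lemma matchstatE x : matchstat s s' x = \sum_(z in disagree)
  ca x z.1 z.2 * (cb x (s' z.1) (s' z.2) - cb x (s z.1) (s z.2)).
Proof.
rewrite /matchstat /mxdot pair_big /= (bigID (mem disagree)) /= [X in _ + X]big1 ?addr0.
  by apply: eq_bigr => z _; rewrite !mxE.
move=> z; rewrite inE negb_or !negbK => /andP[/eqP e1 /eqP e2].
by rewrite !mxE e1 e2 subrr mulr0.
Qed.

Lemma Ex_matchstat : Ex p (matchstat s s') = 2 * signal s.
Proof.
rewrite /signal mulrA divff ?pnatr_eq0 // mul1r.
transitivity (Ex p (fun x => \sum_u \sum_v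
  (ca x u v * cb x (s' u) (s' v) - ca x u v * cb x (s u) (s v)))).
  apply: eq_Ex => x; apply: eq_bigr => u _; apply: eq_bigr => v _.
  by rewrite !mxE mulrBr.
rewrite Ex_sum; apply: eq_bigr => u _; rewrite Ex_sum; apply: eq_bigr => v _.
by rewrite ExB; congr (_ - _); exact: kappa_core_fixed.
Qed.

(** Only disagreeing pairs contribute, each at most [4 r] to twice the signal. This keeps the
    exponential parameter of [matchstat_tail] admissible; read backwards, it bounds [r] from
    below. *)
Lemma signal_le : signal s <= 2 * r1 * #|disagree|%:R /\ signal s <= 2 * r2 * #|disagree|%:R.
Proof.
have signalE : 2 * signal s = \sum_(z in disagree)
    (kappa z.1 z.2 (s' z.1) (s' z.2) - kappa z.1 z.2 (s z.1) (s z.2)).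
  rewrite -Ex_matchstat (eq_Ex p matchstatE) Ex_sum; apply: eq_bigr => z _.
  by rewrite -ExB; apply: eq_Ex => x; rewrite mulrBr.
have bound r : (forall u v u' v', `|kappa u v u' v'| <= 2 * r) ->
    signal s <= 2 * r * #|disagree|%:R.
  move=> kr; rewrite -(ler_pM2l (ltr0Sn R 1)) signalE.
  apply: (@le_trans _ _ (\sum_(z in disagree) 4 * r)).
    apply: ler_sum => z _; apply: le_trans (ler_norm _) _.
    apply: le_trans (ler_normB _ _) _.
    by have := kr z.1 z.2 (s' z.1) (s' z.2); have := kr z.1 z.2 (s z.1) (s z.2); lra.
  by rewrite sumr_const -[_ *+ _]mulr_natr le_eqVlt; apply/orP; left; apply/eqP; ring.
by split; apply: bound => u v u' v'; have [? ?] := kappa_le u v u' v'.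
Qed.

Lemma card_disagree (k : nat) : (#|[set u | s' u != s u]%SET| <= 2 * k)%N ->
  (#|disagree| <= 4 * k * n)%N.
Proof.
set mv := [set u | _]%SET => mvk.
apply: (@leq_trans #|(finset.setX mv [set: 'I_n] :|: finset.setX [set: 'I_n] mv)%SET|).
  by apply: subset_leq_card; apply/fintype.subsetP => z; rewrite !inE andbT.
rewrite cardsU; apply: leq_trans (leq_subr _ _) _.
rewrite !cardsX cardsT card_ord (mulnC n) addnn -mul2n mulnA leq_mul2r.
apply/orP; right; apply: leq_trans (_ : 2 * (2 * k) <= _)%N; first by rewrite leq_mul2l.
by rewrite mulnA.
Qed.

(* Changing the pair [e] affects at most the terms of the statistic in which [e]
   occurs through the first graph or through one of the two relabelings. *)
Definition influence (e : vertex_pair n) : R := \sum_(z in disagree)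
  (2 * (pair_set e == [set z.1; z.2]%SET)%:R +
   (pair_set e == [set s' z.1; s' z.2]%SET)%:R +
   (pair_set e == [set s z.1; s z.2]%SET)%:R).

Lemma cadj_diff_le (sel : W -> bool) (Q : 'M[R]_n) (x y : Om) e u v :
  (forall a, a != e -> x a = y a) ->
  `|cadj sel Q x u v - cadj sel Q y u v| <= (pair_set e == [set u; v]%SET)%:R.
Proof.
move=> xy; have [->|uv] := eqVneq u v; first by rewrite !cadj_diag subr0 normr0 ler0n.
have [a ae _] := pair_setP uv; rewrite !(cadj_edge _ _ _ ae) -ae.
rewrite (inj_eq (@pair_set_inj n)) [e == a]eq_sym.
have [_|ne] := eqVneq a e; last by rewrite xy // subrr normr0.
rewrite opprB addrA subrK.
by case: (sel (x a)) (sel (y a)) => [] [] /=;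
  rewrite ?subrr ?normr0 ?subr0 ?sub0r ?normrN ?normr1.
Qed.

Lemma matchstat_diff_le (x y : Om) e : (forall a, a != e -> x a = y a) ->
  `|matchstat s s' x - matchstat s s' y| <= influence e.
Proof.
move=> xy; rewrite !matchstatE -sumrB.
apply: le_trans (ler_norm_sum _ _ _) _; apply: ler_sum => z _.
have split6 (a b c a' b' c' : R) :
    a * (b - c) - a' * (b' - c') = (a - a') * (b - c) + a' * (b - b') - a' * (c - c').
  by ring.
rewrite split6; apply: le_trans (ler_normB _ _) _; rewrite lerD //.
  apply: le_trans (ler_normD _ _) _; rewrite lerD // normrM.
    rewrite mulrC ler_pM ?normr_ge0 //; last exact: cadj_diff_le.
    by apply: le_trans (ler_normB _ _) _; rewrite -[leRHS]/(1 + 1) lerD // cb_le1.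
  by rewrite -[leRHS]mul1r ler_pM ?normr_ge0 ?ca_le1 //; exact: cadj_diff_le.
by rewrite normrM -[leRHS]mul1r ler_pM ?normr_ge0 ?ca_le1 //; exact: cadj_diff_le.
Qed.

Lemma matchstat_bounded_diff : bounded_diff (matchstat s s') influence.
Proof. exact: bounded_diff_coord matchstat_diff_le. Qed.

Lemma influence_ge0 e : 0 <= influence e.
Proof. by apply: sumr_ge0 => z _; rewrite !addr_ge0 ?mulr_ge0. Qed.

Lemma count_pair_le (t : {perm 'I_n}) (e : vertex_pair n) :
  \sum_(z in disagree) (pair_set e == [set t z.1; t z.2]%SET)%:R <= 2 :> R.
Proof.
case: e => -[a b] /= ab; rewrite -natr_sum ler_nat.
apply: (@leq_trans (\sum_(z in [set ((t^-1)%g a, (t^-1)%g b); ((t^-1)%g b, (t^-1)%g a)]%SET) 1)%N).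
  rewrite big_mkcond [leqRHS]big_mkcond /=; apply: leq_sum => z _.
  case: ifP => // _; case: eqP => //= /esym/eqP; rewrite /pair_set /=.
  rewrite set2_eq ?neq_ltn ?ab //.
  case: z => z1 z2 /=.
  by case/orP=> /andP[/eqP <- /eqP <-]; rewrite !inE !permK eqxx ?orbT.
by rewrite sum1_card cards2; case: eqP.
Qed.

Lemma influence_le8 e : influence e <= 8.
Proof.
rewrite /influence !big_split /= -mulr_sumr.
have := count_pair_le 1%g e; have := count_pair_le s e; have := count_pair_le s' e.
have -> : \sum_(z in disagree) (pair_set e == [set (1%g : {perm 'I_n}) z.1; (1%g : {perm 'I_n}) z.2]%SET)%:R =
  \sum_(z in disagree) (pair_set e == [set z.1; z.2]%SET)%:R :> R.
  by apply: eq_bigr => z _; rewrite !perm1.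
by lra.
Qed.

Lemma sum_influence : \sum_e influence e <= 4 * #|disagree|%:R.
Proof.
rewrite exchange_big /=; apply: (@le_trans _ _ (\sum_(z in disagree) 4)); last first.
  by rewrite sumr_const -[_ *+ _]mulr_natr.
have le1 (S : {set 'I_n}) : \sum_e (pair_set e == S)%:R <= 1 :> R.
  have [e0 /eqP e0S|none] := pickP (fun e => pair_set e == S); last first.
    by rewrite big1 // => e _; rewrite none.
  rewrite (bigD1 e0) //= e0S eqxx big1 ?addr0 // => e ee0.
  by rewrite -e0S (inj_eq (@pair_set_inj n)) (negPf ee0).
apply: ler_sum => z _; rewrite !big_split /= -mulr_sumr.
by have := le1 [set z.1; z.2]%SET; have := le1 [set s z.1; s z.2]%SET;
  have := le1 [set s' z.1; s' z.2]%SET; lra.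
Qed.

Lemma matchstat_tail (k : nat) : (#|[set u | s' u != s u]%SET| <= 2 * k)%N ->
  0 < signal s ->
  Pr p (fun x => matchstat s s' x <= signal s) <=
    expR (- (signal s ^+ 2 / (1024 * k%:R * n%:R))).
Proof.
move=> mvk X0; set X := signal s in X0 *.
(* [V] bounds the total square of the influences: each is at most 8, they add up to at most
   [4 |disagree|], and [|disagree| <= 4 k n]. *)
have [V VE] : exists V : R, V = 128 * k%:R * n%:R by eexists.
have Dkn : #|disagree|%:R <= 4 * k%:R * n%:R :> R by rewrite -!natrM ler_nat card_disagree.
have /andP[_ r1_1] := r1_01.
have XV : 16 * X <= V.
  have [+ _] := signal_le; rewrite -/X => h.
  have : 2 * r1 * #|disagree|%:R <= 2 * #|disagree|%:R :> R.
    by rewrite -mulrA ler_wpM2l // ler_piMl.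
  by rewrite VE; lra.
have V0 : 0 < V by lra.
have sumc : \sum_e influence e ^+ 2 <= V.
  apply: (@le_trans _ _ (8 * \sum_e influence e)).
    rewrite mulr_sumr; apply: ler_sum => e _; rewrite expr2.
    by rewrite ler_wpM2r ?influence_ge0 ?influence_le8.
  by have := sum_influence; rewrite VE; lra.
(* The statistic has mean [2 X] and the level is [X], so the exponent is [- l X + 2 l^2 V]. This [l]
   minimises it, with value [- X^2 / (8 V)]. *)
pose l := X / (4 * V).
have l0 : 0 <= l.
  by rewrite /l divr_ge0 ?(ltW X0) // mulr_ge0 // ltW.
have lc e : l * influence e <= 2^-1.
  apply: (@le_trans _ _ (l * 8)); first by rewrite ler_wpM2l ?influence_le8.
  rewrite /l mulrAC ler_pdivrMr ?mulr_gt0 //; lra.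
have diffN : bounded_diff (fun x => - matchstat s s' x) influence.
  by move=> x e w w'; rewrite -opprD normrN; exact: matchstat_bounded_diff.
have := bounded_diff_expR p_ge0 p_sum1 l0 lc influence_ge0 diffN.
rewrite ExN Ex_matchstat -/X => mgf.
apply: (@le_trans _ _ (Ex p (fun x => expR (l * X) * expR (l * - matchstat s s' x)))).
  apply: Ex_le => // x; rewrite -expRD -mulrDr; case: (leP (matchstat s s' x) X) => h; last exact: expR_ge0.
  by rewrite -[leLHS]expR0 ler_expR mulr_ge0 // subr_ge0.
rewrite ExZ; apply: le_trans (ler_wpM2l (expR_ge0 _) mgf) _.
rewrite -expRD ler_expR.
apply: (@le_trans _ _ (l * X + (l * - (2 * X) + 2 * l ^+ 2 * V))).
  by rewrite !lerD2l ler_wpM2l // mulr_ge0 ?sqr_ge0.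
rewrite le_eqVlt; apply/orP; left; apply/eqP.
rewrite (_ : 1024 * k%:R * n%:R = 8 * V); last by rewrite VE; ring.
have V1 : V != 0 by exact: lt0r_neq0.

by rewrite /l; field; exact: V1.
Qed.

End Matching.

(** * Relabelled matrices, inner products and perturbation *)

Section Relabel.
Variables (R : realType) (n : nat).
Implicit Types (M N : 'M[R]_n) (s t : {perm 'I_n}).

Lemma perm_mx_conj s N : perm_mx s *m N *m (perm_mx s)^T = relabel s N.
Proof.
rewrite tr_perm_mx -row_permE -col_permE.
by apply/matrixP => u v; rewrite !mxE.
Qed.

Lemma relabelD s M N : relabel s (M + N) = relabel s M + relabel s N.
Proof. by apply/matrixP => u v; rewrite !mxE. Qed.

Lemma sqn_relabel s N : sqn (relabel s N) = sqn N.
Proof.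
rewrite /sqn [RHS](reindex_inj (@perm_inj _ s)); apply: eq_bigr => u _.
by rewrite [RHS](reindex_inj (@perm_inj _ s)); apply: eq_bigr => v _; rewrite mxE.
Qed.

Lemma norm_mxdot_le M N : `|mxdot M N| <= Num.sqrt (sqn M) * Num.sqrt (sqn N).
Proof.
rewrite -sqrtrM ?sqn_ge0 // -sqrtr_sqr ler_wsqrtr //.
exact: mxdot_sqr_le.
Qed.

(** Relabelling preserves the Frobenius norm, so the distances differ only through the inner
    products. *)
Lemma not_argmin M N s t :
  mxdot M (relabel s N) < mxdot M (relabel t N) -> ~ argmin_match M N (perm_mx s).
Proof.
move=> lt [_ /(_ _ (perm_mx_is_perm _ t))]; apply/negP; rewrite -ltNge.
rewrite !perm_mx_conj !frobeniusE.
have mxdotNl (X Y : 'M[R]_n) : mxdot (- X) Y = - mxdot X Y.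
  by rewrite mxdotC mxdotNr mxdotC.
have sqnB (X Y : 'M[R]_n) : sqn (X - Y) = sqn X + sqn Y - 2 * mxdot X Y.
  rewrite [LHS]sqnE !mxdotDl !mxdotDr !mxdotNr !mxdotNl (mxdotC Y X) -!sqnE.
  by ring.
have lt' : sqn (M - relabel t N) < sqn (M - relabel s N).
  by rewrite !sqnB !sqn_relabel; lra.
by rewrite ltr_sqrt // (le_lt_trans (sqn_ge0 _) lt').
Qed.

(* The estimation errors [E1], [E2] enter only through Frobenius norms. *)
Lemma mxdot_perturbed s t (A0 B0 E1 E2 : 'M[R]_n) :
  mxdot A0 (relabel t B0 - relabel s B0) -
    2 * (Num.sqrt (sqn E1) * Num.sqrt (sqn B0) + Num.sqrt (sqn A0) * Num.sqrt (sqn E2)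
         + Num.sqrt (sqn E1) * Num.sqrt (sqn E2)) <=
  mxdot (A0 + E1) (relabel t (B0 + E2)) - mxdot (A0 + E1) (relabel s (B0 + E2)).
Proof.
rewrite !relabelD !mxdotDl !mxdotDr mxdotNr.
have bound (X Y : 'M[R]_n) u : - (Num.sqrt (sqn X) * Num.sqrt (sqn Y)) <= mxdot X (relabel u Y)
    /\ mxdot X (relabel u Y) <= Num.sqrt (sqn X) * Num.sqrt (sqn Y).
  by have := norm_mxdot_le X (relabel u Y); rewrite sqn_relabel ler_norml => /andP.
have [+ _] := bound E1 B0 t; have [_ +] := bound E1 B0 s.
have [+ _] := bound A0 E2 t; have [_ +] := bound A0 E2 s.
have [+ _] := bound E1 E2 t; have [_ +] := bound E1 E2 s.
set e1 := Num.sqrt (sqn E1); set e2 := Num.sqrt (sqn E2).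
set a := Num.sqrt (sqn A0); set b := Num.sqrt (sqn B0).
by lra.
Qed.

Lemma sqn_le_opnorm N (K : R) : (forall x : 'cV[R]_n, sqn (N *m x) <= K * sqn x) ->
  sqn N <= n%:R * K.
Proof.
move=> NK; rewrite sqn_col; apply: (@le_trans _ _ (\sum_(j < n) K)); last first.
  by rewrite sumr_const card_ord mulr_natl.
apply: ler_sum => j _; rewrite colE; apply: le_trans (NK _) _.
rewrite (_ : sqn _ = 1) ?mulr1 // /sqn (bigD1 j) //= big_ord1 mxE !eqxx expr1n.
by rewrite big1 ?addr0 // => i ij; rewrite big_ord1 mxE (negPf ij) expr0n.
Qed.

End Relabel.

(** * Union bound over the permutations *)

Section UnionBound.
Variable R : realType.

(** [k + j] is at most twice the larger of the two; its logarithm is at most [2 ln c] if [k] is the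
    larger and [2 ln j] otherwise. The fifth [k ln c] comes from [c ^ k]. *)
Lemma card_exponent_le (c j k : nat) : (1 < c)%N -> (0 < j <= c)%N -> (0 < k <= c)%N ->
  (c ^ k * (k + j) ^ (k + j))%:R <=
    expR (5 * (k%:R * ln c%:R) + 4 * (j%:R * ln j%:R)) :> R.
Proof.
move=> c1 /andP[j0 jc] /andP[k0 kc].
have c0R : 0 < c%:R :> R by rewrite ltr0n; lia.
have j0R : 0 < j%:R :> R by rewrite ltr0n.
have k0R : 0 < k%:R :> R by rewrite ltr0n.
have kj0R : 0 < (k + j)%:R :> R by rewrite ltr0n; lia.
have lnj0 : 0 <= ln j%:R :> R by rewrite ln_ge0 // ler1n.
have lnc0 : 0 <= ln c%:R :> R by rewrite ln_ge0 // ler1n ltnW.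
have powE (a m : nat) : (0 < a)%N -> (a ^ m)%:R = expR (m%:R * ln a%:R) :> R.
  by move=> a0; rewrite natrX expRM_natl lnK // posrE ltr0n.
rewrite natrM !powE ?addn_gt0 ?k0 // ?(ltnW c1) // -expRD ler_expR.
suff : (k + j)%:R * ln (k + j)%:R <= 4 * (k%:R * ln c%:R) + 4 * (j%:R * ln j%:R) :> R by lra.
have [jk|kj] := leqP j k.
  have : (k + j)%:R * ln (k + j)%:R <= (2 * k%:R) * (2 * ln c%:R) :> R.
    rewrite ler_pM ?ln_ge0 ?ler1n ?addn_gt0 ?k0 //; first by rewrite -natrM ler_nat; lia.
    rewrite [2 * _]mulr_natl -lnXn // ler_ln ?posrE ?exprn_gt0 // -natrX ler_nat.
    by nia.
  by have := mulr_ge0 (ltW j0R) lnj0; lra.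
have : (k + j)%:R * ln (k + j)%:R <= (2 * j%:R) * (2 * ln j%:R) :> R.
  rewrite ler_pM ?ln_ge0 ?ler1n ?addn_gt0 ?k0 //; first by rewrite -natrM ler_nat; lia.
  rewrite [2 * _]mulr_natl -lnXn // ler_ln ?posrE ?exprn_gt0 // -natrX ler_nat.
  by nia.
by have := mulr_ge0 (ltW k0R) lnc0; lra.
Qed.

(** For each number [k] of moved vertices the count leaves [exp (- 5 k ln c) <= c^-5]. There are [c]
    values of [k], and [c^-4 <= n^-2] because [c + j <= 2 c <= c^2]. *)
Lemma sum_perms_exp_le (c j : nat) (C : {set 'I_(c + j)}) (X : {perm 'I_(c + j)} -> R) :
  (1 < c)%N -> (0 < j <= c)%N -> #|C| = c ->
  (forall s, (0 < #|moved C s|)%N ->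
     10 * (#|moved C s|%:R * ln c%:R) + 4 * (j%:R * ln j%:R) <= X s) ->
  \sum_(s | (0 < #|moved C s|)%N) expR (- X s) <= ((c + j)%:R ^+ 2)^-1.
Proof.
move=> c1 jc Cc Xs.
have c0R : 0 < c%:R :> R by rewrite ltr0n; lia.
have lnc0 : 0 <= ln c%:R :> R by rewrite ln_ge0 // ler1n ltnW.
have mvc s : (#|moved C s| <= c)%N.
  apply: leq_trans (_ : #|C| <= c)%N; last by rewrite Cc.
  by apply: subset_leq_card; apply/fintype.subsetP => x; rewrite inE => /andP[].
apply: (@le_trans _ _ (\sum_(k < c) expR (- (5 * ln c%:R)))).
  (* The number of moved vertices runs from 1 to [c], so its predecessor is the index; [c] is
     written as a successor for [inord]. *)
  rewrite (partition_big (fun s => inord #|moved C s|.-1 : 'I_c.-1.+1) predT) //=.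
  rewrite (_ : \sum_(k < c) _ = \sum_(k < c.-1.+1) expR (- (5 * ln c%:R)) :> R); last first.
    by rewrite prednK //; lia.
  apply: ler_sum => k _.
  have kc : (k.+1 <= c)%N by have := ltn_ord k; rewrite [X in (_ < X)%N]prednK //; lia.
  have mvk s : ((0 < #|moved C s|)%N && (inord #|moved C s|.-1 == k)) = (#|moved C s| == k.+1).
    have h := mvc s; apply/andP/eqP => [[m0 /eqP/(congr1 val)]|m].
      by rewrite /= inordK => [<-|]; rewrite ?prednK //; lia.
    rewrite m /=; split=> //; apply/eqP; apply: val_inj; rewrite /= inordK //.
  rewrite (eq_bigl _ _ mvk).
  apply: (@le_trans _ _ (\sum_(s | #|moved C s| == k.+1)
      expR (- (10 * (k.+1%:R * ln c%:R) + 4 * (j%:R * ln j%:R))))).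
    by apply: ler_sum => s /eqP m; rewrite ler_expR lerN2 -m Xs // m.
  rewrite sumr_const -[expR _ *+ _]mulr_natl.
  apply: (@le_trans _ _ (expR (5 * (k.+1%:R * ln c%:R) + 4 * (j%:R * ln j%:R)) *
     expR (- (10 * (k.+1%:R * ln c%:R) + 4 * (j%:R * ln j%:R))))).
    apply: ler_wpM2r; first exact: expR_ge0.
    apply: le_trans (card_exponent_le c1 jc (_ : 0 < k.+1 <= c)%N); last by rewrite kc.
    have := card_moved_le C k.+1; rewrite Cc (_ : #|~: C|%SET = j); last first.
      by have := cardsC C; rewrite Cc card_ord; lia.
    by rewrite ler_nat cardsE.
  rewrite -expRD ler_expR.
  have : ln c%:R <= k.+1%:R * ln c%:R :> R by rewrite ler_peMl // ler1n.
  by lra.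
rewrite sumr_const card_ord -[expR _ *+ _]mulr_natl.
have -> : expR (- (5 * ln c%:R)) = (c%:R ^+ 5)^-1 :> R.
  by rewrite expRN expRM_natl lnK // posrE.
have cj0 : 0 < (c + j)%:R :> R by rewrite ltr0n addn_gt0 ltnW.
rewrite -[X in X * _](invrK) -invfM lef_pV2 ?posrE ?mulr_gt0 ?invr_gt0 ?exprn_gt0 //.
rewrite [_ ^+ 5]exprS mulKf ?gt_eqF // -!natrX ler_nat.
nia.
Qed.

End UnionBound.

(** * Reduction to a finite product space *)

Section Transfer.
Context (d : measure_display) (T : measurableType d) (R : realType).
Variable P : probability T R.

Lemma expectation_finite (W : finType) (h : T -> W) (g : W -> R) :
  (forall w, measurable [set t | h t = w]) ->
  'E_P[fun t => g (h t)]%E = (\sum_w fine (P [set t | h t = w]) * g w)%:E.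
Proof.
move=> mh; rewrite unlock.
transitivity (\int[P]_t \sum_w ((g w)%:E * (\1_[set t | h t = w] t)%:E))%E.
  apply: eq_integral => t _; rewrite (bigD1 (h t)) //= indicE mem_set //= mule1.
  rewrite big1 ?adde0 // => w wt; rewrite indicE memNset ?mule0 //= => htw.
  by rewrite htw eqxx in wt.
rewrite integral_sum //; last first.
  by move=> w; apply: integrableZl => //; exact: integrable_indic.
rewrite -sumEFin; apply: eq_bigr => w _.
rewrite integralZl //; last exact: integrable_indic.
by rewrite integral_indic // setIT EFinM fineK ?fin_num_measure // muleC.
Qed.

Variables (n : nat) (Q1 Q2 rho : 'M[R]_n) (A B : T -> 'M[R]_n).
Hypothesis AB : corrER P Q1 Q2 rho A B.

Let W : finType := (bool * bool)%type.
Let Om := {ffun vertex_pair n -> W}.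

(** Entries are 0 or 1, so the comparison with 1 loses nothing: both graphs are recovered from this
    finite-valued map. *)
Definition edges_of (t : T) : Om :=
  [ffun e : vertex_pair n => (A t (val e).1 (val e).2 == 1, B t (val e).1 (val e).2 == 1)].

Definition edge_law (e : vertex_pair n) (w : W) : R :=
  fine (P [set t | edges_of t e = w]).

Let pt (w : W) : R * R := ((w.1)%:R, (w.2)%:R).
Let X (e : vertex_pair n) (t : T) := (A t (val e).1 (val e).2, B t (val e).1 (val e).2).

Lemma graph_entry (G : 'M[R]_n) u v : is_graph G -> G u v = (G u v == 1)%:R.
Proof.
by case=> _ _ /(_ u v)[->|->]; rewrite ?eqxx // eq_sym oner_eq0.
Qed.

Lemma edges_of_fiber e w : [set t | edges_of t e = w] = X e @^-1` [set pt w].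
Proof.
apply/seteqP; split=> t /=; rewrite ffunE /X /pt.
  move=> <- /=; congr (_, _); apply: graph_entry.
    exact: (corrER_graphA AB).
  exact: (corrER_graphB AB).
case: w => -[] [] /= [-> ->]; rewrite ?eqxx ?[0 == 1]eq_sym ?oner_eq0 //.
Qed.

Lemma measurable_pt w : measurable [set pt w].
Proof.
rewrite (_ : [set pt w] = [set (w.1)%:R] `*` [set (w.2)%:R]); last first.
  by apply/seteqP; split=> [x ->|[x y] [/= -> ->]].
by apply: measurableX; exact: measurable_set1.
Qed.

Lemma measurable_fiber e w : measurable [set t | edges_of t e = w].
Proof.
rewrite edges_of_fiber -[_ @^-1` _]setTI.
have : measurable_fun setT (X e).
  by apply: measurable_fun_pair; [exact: (corrER_measA AB)|exact: (corrER_measB AB)].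
by move=> /(_ measurableT _ (measurable_pt w)).
Qed.

Lemma edges_of_eq (x : Om) :
  [set t | edges_of t = x] = \bigcap_(e in [set` [set: vertex_pair n]%SET]) X e @^-1` [set pt (x e)].
Proof.
apply/seteqP; split=> t /=.
  by move=> tx e _; rewrite -edges_of_fiber /= tx.
by move=> tX; apply/ffunP => e; have := tX e; rewrite -edges_of_fiber /=; apply; rewrite inE.
Qed.

Lemma measurable_edges_of (x : Om) : measurable [set t | edges_of t = x].
Proof.
rewrite edges_of_eq; apply: fin_bigcap_measurable; first exact: finite_finset.
by move=> e _; rewrite -edges_of_fiber; exact: measurable_fiber.
Qed.

(** The fiber over [x] is an intersection over all vertex pairs of events about a single pair, to
    which mutual independence applies. *)
Lemma law_edges_of (x : Om) :
  fine (P [set t | edges_of t = x]) = \prod_e edge_law e (x e).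
Proof.
have := corrER_indep AB [set: vertex_pair n]%SET (S := fun e => [set pt (x e)])
  (fun e => measurable_pt (x e)).
rewrite edges_of_eq => ->.
have -> : (\prod_(i in [set: vertex_pair n]%SET) P (X i @^-1` [set pt (x i)]) =
    (\prod_e edge_law e (x e))%:E)%E.
  rewrite (eq_bigr (fun e => (edge_law e (x e))%:E)) => [|e _]; last first.
    rewrite /edge_law edges_of_fiber fineK //.
    by rewrite fin_num_measure // -edges_of_fiber; exact: measurable_fiber.
  rewrite -(big_morph EFin (@EFinM R) (erefl : 1%:E = 1%E)); congr EFin.
  by apply: eq_bigl => e; rewrite inE.
by [].
Qed.

Lemma edge_law_ge0 e w : 0 <= edge_law e w.
Proof. exact/fine_ge0/measure_ge0. Qed.

Lemma expectation_edge e (g : W -> R) :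
  'E_P[fun t => g (edges_of t e)]%E = (\sum_w edge_law e w * g w)%:E.
Proof. by apply: expectation_finite => w; exact: measurable_fiber. Qed.

Lemma edge_law_sum1 e : \sum_w edge_law e w = 1.
Proof.
have := expectation_edge e (fun=> 1); rewrite (_ : (fun t => 1) = cst 1) // expectation_cst.
by move=> [->]; apply: eq_bigr => w _; rewrite mulr1.
Qed.

Lemma expectation_edges (g : Om -> R) : 'E_P[fun t => g (edges_of t)]%E = (Ex edge_law g)%:E.
Proof.
rewrite (expectation_finite _ measurable_edges_of); congr EFin.
by apply: eq_bigr => x _; rewrite law_edges_of.
Qed.

Lemma probability_edges (S : pred Om) : P [set t | S (edges_of t)] = (Pr edge_law S)%:E.
Proof.
have mS : measurable [set t | S (edges_of t)].
  rewrite (_ : [set t | _] = \bigcup_(x in [set x | S x]) [set t | edges_of t = x]).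
    apply: fin_bigcup_measurable => [|x _]; last exact: measurable_edges_of.
    exact: finite_finset.
  by apply/seteqP; split=> t /= => [St|[x Sx ->] //]; exists (edges_of t).
rewrite -(expectation_indic P mS) -expectation_edges; congr expectation.
by apply/funext => t; rewrite indicE; congr (nat_of_bool _)%:R; apply/idP/idP; rewrite inE.
Qed.

Lemma adjA t : A t = adj R (fun w : W => w.1) (edges_of t).
Proof.
have [As A0 _] := corrER_graphA AB t; apply/matrixP => u v.
have [->|uv] := eqVneq u v; first by rewrite A0 /adj edge_mx_diag.
have [e ee ev] := pair_setP uv; rewrite /adj (edge_mxE _ _ ee) ffunE /=.
rewrite -graph_entry; last exact: (corrER_graphA AB).
by case: ev => ->; rewrite //= -[in LHS]As mxE.
Qed.

Lemma adjB t : B t = adj R (fun w : W => w.2) (edges_of t).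
Proof.
have [As A0 _] := corrER_graphB AB t; apply/matrixP => u v.
have [->|uv] := eqVneq u v; first by rewrite A0 /adj edge_mx_diag.
have [e ee ev] := pair_setP uv; rewrite /adj (edge_mxE _ _ ee) ffunE /=.
rewrite -graph_entry; last exact: (corrER_graphB AB).
by case: ev => ->; rewrite //= -[in LHS]As mxE.
Qed.

Lemma expectation_graph (G : T -> 'M[R]_n) u v q :
  (forall t, is_graph (G t)) -> measurable_fun setT (fun t => G t u v) ->
  P [set t | G t u v = 1] = q%:E -> 'E_P[fun t => G t u v]%E = q%:E.
Proof.
move=> Gg mG <-; have mG1 : measurable [set t | G t u v = 1].
  by have := mG measurableT _ (measurable_set1 1); rewrite setTI.
rewrite -(expectation_indic P mG1); congr expectation; apply/funext => t.
rewrite (graph_entry _ _ (Gg t)) indicE; congr (nat_of_bool _)%:R.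
by apply/eqP/idP; rewrite inE.
Qed.

Lemma pair_neq (e : vertex_pair n) : (val e).1 != (val e).2.
Proof. by case: e => -[a b] /= ab; rewrite neq_ltn ab. Qed.

Lemma edge_law_mean1 e : \sum_w edge_law e w * (w.1)%:R = Q1 (val e).1 (val e).2.
Proof.
have := expectation_graph (corrER_graphA AB) (corrER_measA AB _ _)
  (corrER_probA AB (pair_neq e)).
rewrite (_ : (fun t => _) = (fun t => (((edges_of t e).1)%:R : R))); last first.
  apply/funext => t; rewrite ffunE /=; apply: graph_entry; exact: (corrER_graphA AB).
by rewrite (expectation_edge e (fun w => (w.1)%:R)) => -[].
Qed.

Lemma edge_law_mean2 e : \sum_w edge_law e w * (w.2)%:R = Q2 (val e).1 (val e).2.
Proof.
have := expectation_graph (corrER_graphB AB) (corrER_measB AB _ _)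
  (corrER_probB AB (pair_neq e)).
rewrite (_ : (fun t => _) = (fun t => (((edges_of t e).2)%:R : R))); last first.
  apply/funext => t; rewrite ffunE /=; apply: graph_entry; exact: (corrER_graphB AB).
by rewrite (expectation_edge e (fun w => (w.2)%:R)) => -[].
Qed.

Lemma expectationA u v : 'E_P[fun t => A t u v]%E = (hollow Q1 u v)%:E.
Proof.
rewrite mxE; have [->|uv] := eqVneq u v.
  rewrite (_ : (fun t => A t v v) = cst 0) ?expectation_cst //.
  by apply/funext => t; have [_ ->] := corrER_graphA AB t.
exact: expectation_graph (corrER_graphA AB) (corrER_measA AB _ _) (corrER_probA AB uv).
Qed.

Lemma expectationB u v : 'E_P[fun t => B t u v]%E = (hollow Q2 u v)%:E.
Proof.
rewrite mxE; have [->|uv] := eqVneq u v.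
  rewrite (_ : (fun t => B t v v) = cst 0) ?expectation_cst //.
  by apply/funext => t; have [_ ->] := corrER_graphB AB t.
exact: expectation_graph (corrER_graphB AB) (corrER_measB AB _ _) (corrER_probB AB uv).
Qed.

Lemma covariance_kappa u v u' v' :
  covariance P (fun t => A t u v) (fun t => B t u' v') =
  (kappa edge_law Q1 Q2 u v u' v')%:E.
Proof.
rewrite unlock expectationA expectationB /kappa -expectation_edges; congr expectation.
apply/funext => t /=; rewrite !(cadjE, corrER_symQ1 AB, corrER_symQ2 AB) //.
by rewrite -adjA -adjB [X in _ = X * _]mxE [X in _ = _ * X]mxE [X in _ = (_ + X) * _]mxE [X in _ = _ * (_ + X)]mxE.
Qed.

Lemma chiX_signal (s : {perm 'I_n}) : chiX P A B (perm_mx s) = signal edge_law Q1 Q2 s.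
Proof.
rewrite /chiX /signal; congr (_ * _); apply: eq_bigr => u _; apply: eq_bigr => v _.
rewrite (_ : (fun w => (perm_mx s *m B w *m (perm_mx s)^T) u v) = (fun w => B w (s u) (s v))).
  by rewrite !covariance_kappa.
by apply/funext => t; rewrite perm_mx_conj mxE.
Qed.

Lemma edge_law_uncorrelated e : rho (val e).1 (val e).2 = 0 ->
  \sum_w edge_law e w * (((w.1)%:R - Q1 (val e).1 (val e).2) *
                          ((w.2)%:R - Q2 (val e).1 (val e).2)) = 0.
Proof.
move=> rho0; have := corrER_cov AB (pair_neq e); rewrite rho0 mul0r covariance_kappa => -[k0].
rewrite -[RHS]k0.
pose F (w : W) := ((w.1)%:R - Q1 (val e).1 (val e).2) * ((w.2)%:R - Q2 (val e).1 (val e).2).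
transitivity (Ex edge_law (fun x => F (x e))); first by rewrite (Ex_coord edge_law_sum1 e F).
have ee : pair_set e = [set (val e).1; (val e).2]%SET by [].
by apply: eq_Ex => x; rewrite !(cadj_edge _ _ _ ee).
Qed.

End Transfer.

(** * The fixed-size bound *)

Section FixedSize.
Variables (R : realType) (c j : nat).
Let n := (c + j)%N.
Let W : finType := (bool * bool)%type.

Definition core : {set 'I_n} := [set lshift j i | i : 'I_c]%SET.

Lemma card_core : #|core| = c.
Proof. by rewrite card_imset ?card_ord //; exact: lshift_inj. Qed.

(** Diagonal entries of a permutation matrix mark fixed points, so the sum over the core counts the
    core vertices left in place. *)
Lemma core_perms_moved k (s : {perm 'I_n}) :
  core_perms k (perm_mx s : 'M[R]_(c + j)) <-> #|moved core s| = k.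
Proof.
have fixedE : \sum_(i < c) (perm_mx s : 'M[R]_(c + j)) (lshift j i) (lshift j i) =
    c%:R - #|moved core s|%:R.
  apply/eqP; rewrite eq_sym subr_eq; apply/eqP.
  have -> : #|moved core s| = #|[set i : 'I_c | s (lshift j i) != lshift j i]%SET|.
    rewrite -(card_imset _ (@lshift_inj c j)); apply: eq_card => x; rewrite inE.
    apply/andP/imsetP => [[/imsetP[i _ ->] si]|[i]]; first by exists i; rewrite ?inE.
    by rewrite inE => si ->; split=> //; apply/imsetP; exists i.
  rewrite -[X in X%:R = _](card_ord c) -cardsT -(cardsID [set i | s (lshift j i) != lshift j i]%SET).
  rewrite finset.setTI natrD addrC; congr (_ + _).
  rewrite -sum1_card natr_sum big_mkcond /=; apply: eq_bigr => i _.
  by rewrite !inE !mxE andbT negbK; case: (_ == _).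
split=> [[_]|<-]; last by split; [exact: perm_mx_is_perm|exact: fixedE].
by rewrite fixedE => /subrI/eqP; rewrite eqr_nat => /eqP.
Qed.

Variables (p : vertex_pair n -> W -> R) (Q1 Q2 : 'M[R]_n) (r1 r2 d1 d2 K0 : R) (m k0 : nat).
Hypothesis p_ge0 : forall e w, 0 <= p e w.
Hypothesis p_sum1 : forall e, \sum_w p e w = 1.
Hypothesis mean1 : forall e, \sum_w p e w * (w.1)%:R = Q1 (val e).1 (val e).2.
Hypothesis mean2 : forall e, \sum_w p e w * (w.2)%:R = Q2 (val e).1 (val e).2.
Hypothesis Q1_sym : Q1^T = Q1.
Hypothesis Q2_sym : Q2^T = Q2.
Hypothesis Q1_ge0 : forall u v, 0 <= Q1 u v.
Hypothesis Q2_ge0 : forall u v, 0 <= Q2 u v.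
Hypothesis Q1_le : forall u v, Q1 u v <= r1.
Hypothesis Q2_le : forall u v, Q2 u v <= r2.
Hypothesis r1_01 : 0 < r1 <= 1.
Hypothesis r2_01 : 0 < r2 <= 1.
Hypothesis junk_uncorrelated : forall e, ~~ (pair_set e \subset core) ->
  \sum_w p e w * (((w.1)%:R - Q1 (val e).1 (val e).2) *
                  ((w.2)%:R - Q2 (val e).1 (val e).2)) = 0.
Hypothesis c_gt1 : (1 < c)%N.
Hypothesis jc : (0 < j <= c)%N.
Hypothesis nm : (n <= 2 ^ m.+1)%N.
Hypothesis dense1 : (m.+1 + m.+1).+1%:R ^+ 2 <= Num.sqrt (n%:R * r1).
Hypothesis dense2 : (m.+1 + m.+1).+1%:R ^+ 2 <= Num.sqrt (n%:R * r2).
Hypothesis d1_ge0 : 0 <= d1.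
Hypothesis d2_ge0 : 0 <= d2.
Hypothesis d2_le : d2 <= n%:R.
Hypothesis K0_ge0 : 0 <= K0.
Hypothesis tail1 : \sum_(i < n | d1 < i.+1%:R) singular_values Q1 0 i ^+ 2 <= K0 * (n%:R * r1 * d1).
Hypothesis tail2 : \sum_(i < n | d2 < i.+1%:R) singular_values Q2 0 i ^+ 2 <= K0 * (n%:R * r2 * d2).
Hypothesis signal_gt0 : forall s, (0 < #|moved core s|)%N -> 0 < signal p Q1 Q2 s.
Hypothesis signal_large : forall s, (0 < #|moved core s|)%N ->
  10 * (#|moved core s|%:R * ln c%:R) + 4 * (j%:R * ln j%:R) <=
  signal p Q1 Q2 s ^+ 2 / (1024 * #|moved core s|%:R * n%:R).

Let K := 1086 * (1 + K0) + K0.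

Hypothesis signal_k0 : forall s, (k0 < #|moved core s|)%N ->
  4 * K * (Num.sqrt n%:R * n%:R * ((Num.sqrt r1 + Num.sqrt r2) *
    (Num.sqrt (r1 * d1) + Num.sqrt (r2 * d2)))) <= signal p Q1 Q2 s.

Definition repaired (s : {perm 'I_n}) : {perm 'I_n} := projT1 (cid (fix_core core s)).

Lemma repaired_core s u : u \in core -> repaired s u = u.
Proof. by move=> uC; have [-> //] := projT2 (cid (fix_core core s)). Qed.

Lemma card_repaired s : (#|[set u | repaired s u != s u]%SET| <= 2 * #|moved core s|)%N.
Proof. by have [] := projT2 (cid (fix_core core s)). Qed.

Definition bad (x : {ffun vertex_pair n -> W}) : bool :=
  [|| spectral_bad (fun w : W => w.1) Q1 r1 m x, spectral_bad (fun w : W => w.2) Q2 r2 m x |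
    [exists s, (0 < #|moved core s|)%N &&
       (matchstat Q1 Q2 s (repaired s) x <= signal p Q1 Q2 s)]].

Let r1_01' : 0 <= r1 <= 1. Proof. by have /andP[/ltW -> ->] := r1_01. Qed.
Let r2_01' : 0 <= r2 <= 1. Proof. by have /andP[/ltW -> ->] := r2_01. Qed.
Let n_gt0 : (0 < n)%N. Proof. by rewrite addn_gt0 ltnW. Qed.

(** The spectral events of the two graphs and the union over permutations cost [n^-2] each. *)
Lemma bad_le : Pr p bad <= 3 / n%:R ^+ 2.
Proof.
apply: le_trans (Pr_or p_ge0 _ _) _.
rewrite (_ : 3 / _ = (n%:R ^+ 2)^-1 + ((n%:R ^+ 2)^-1 + (n%:R ^+ 2)^-1)); last by ring.
apply: lerD.
  exact: (spectral_bad_le p_ge0 p_sum1 mean1 Q1_ge0 Q1_le r1_01 n_gt0 dense1).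
apply: le_trans (Pr_or p_ge0 _ _) _; apply: lerD.
  exact: (spectral_bad_le p_ge0 p_sum1 mean2 Q2_ge0 Q2_le r2_01 n_gt0 dense2).
apply: le_trans (Pr_exists p_ge0 _ _) _.
apply: le_trans (sum_perms_exp_le c_gt1 jc card_core signal_large).
apply: ler_sum => s mv.
exact: (matchstat_tail p_ge0 p_sum1 mean1 mean2 Q1_ge0 Q2_ge0 Q1_le Q2_le r1_01' r2_01'
  junk_uncorrelated (@repaired_core s) (card_repaired s) (signal_gt0 mv)).
Qed.

Lemma sqrtr_le (a b : R) : 0 <= b -> a <= b ^+ 2 -> Num.sqrt a <= b.
Proof. by move=> b0 ab; rewrite -(ger0_norm b0) -sqrtr_sqr ler_wsqrtr. Qed.

(** The statistic has mean twice the signal. One half is given up to fluctuations; the other absorbs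
    the estimation errors, which stay below the signal once more than [k0] core vertices move. *)
Lemma good_not_argmin x s : ~~ bad x -> (k0 < #|moved core s|)%N ->
  let A := adj R (fun w : W => w.1) x in
  let B := adj R (fun w : W => w.2) x in
  ~ argmin_match (A - usvt A (18 * Num.sqrt (n%:R * r1)))
                 (B - usvt B (18 * Num.sqrt (n%:R * r2))) (perm_mx s).
Proof.
move=> good ks A B.
move: good; rewrite /bad !negb_or => /and3P[good1 good2 goods].
move/existsPn in goods.
have := goods s; rewrite (leq_ltn_trans _ ks) //= -ltNge => stat.
apply: (not_argmin (t := repaired s)).
set A0 := cadj (fun w : W => w.1) Q1 x; set B0 := cadj (fun w : W => w.2) Q2 x.
set E1 := hollow Q1 - usvt A (18 * Num.sqrt (n%:R * r1)).
set E2 := hollow Q2 - usvt B (18 * Num.sqrt (n%:R * r2)).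
have -> : A - usvt A (18 * Num.sqrt (n%:R * r1)) = A0 + E1.
  by rewrite /A0 /E1 cadjE // addrA subrK.
have -> : B - usvt B (18 * Num.sqrt (n%:R * r2)) = B0 + E2.
  by rewrite /B0 /E2 cadjE // addrA subrK.
rewrite -subr_gt0; apply: lt_le_trans (mxdot_perturbed _ _ _ _ _ _).
rewrite subr_gt0; apply: le_lt_trans stat.
apply: le_trans (signal_k0 ks).
have n0 : 0 <= n%:R :> R by [].
have /andP[r1_0 _] := r1_01'; have /andP[r2_0 _] := r2_01'.
have opA (y : 'cV[R]_n) : sqn (A0 *m y) <= 72 * (n%:R * r1) * sqn y.
  exact: (spectral_good r1_01 y nm good1).
have opB (y : 'cV[R]_n) : sqn (B0 *m y) <= 72 * (n%:R * r2) * sqn y.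
  exact: (spectral_good r2_01 y nm good2).
(* As [72 <= K], a single constant serves both the noise and the estimation errors. *)
have K1086 : 1086 <= K by rewrite /K; have := K0_ge0; lra.
have e1E : sqn E1 <= K * (n%:R * r1 * d1).
  apply: usvt_error => //; [exact: edge_mx_sym|by move=> u v; rewrite Q1_ge0 Q1_le|].
  by move=> y; rewrite /A -cadjE //; exact: opA.
have e2E : sqn E2 <= K * (n%:R * r2 * d2).
  apply: usvt_error => //; [exact: edge_mx_sym|by move=> u v; rewrite Q2_ge0 Q2_le|].
  by move=> y; rewrite /B -cadjE //; exact: opB.
have aE : sqn A0 <= n%:R * (72 * (n%:R * r1)) by apply: sqn_le_opnorm => y; exact: opA.
have bE : sqn B0 <= n%:R * (72 * (n%:R * r2)) by apply: sqn_le_opnorm => y; exact: opB.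
set rho1 := Num.sqrt r1; set rho2 := Num.sqrt r2; set x0 := Num.sqrt n%:R.
set dl1 := Num.sqrt (r1 * d1); set dl2 := Num.sqrt (r2 * d2).
set k := Num.sqrt K.
have K0' : 0 <= K by lra.
have sq (y : R) : 0 <= y -> Num.sqrt y ^+ 2 = y by exact: sqr_sqrtr.
have e1 : Num.sqrt (sqn E1) <= k * x0 * dl1.
  apply: sqrtr_le; first by rewrite !mulr_ge0 ?sqrtr_ge0.
  by rewrite !exprMn !sq ?mulr_ge0 // -!mulrA in e1E *.
have e2 : Num.sqrt (sqn E2) <= k * x0 * dl2.
  apply: sqrtr_le; first by rewrite !mulr_ge0 ?sqrtr_ge0.
  by rewrite !exprMn !sq ?mulr_ge0 // -!mulrA in e2E *.
have le72 (r : R) : 0 <= r -> n%:R * (72 * (n%:R * r)) <= K * n%:R ^+ 2 * r.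
  move=> r0; rewrite (_ : n%:R * _ = 72 * (n%:R ^+ 2 * r)); last by ring.
  by rewrite -mulrA ler_wpM2r ?mulr_ge0 ?sqr_ge0 //; lra.
have a : Num.sqrt (sqn A0) <= k * n%:R * rho1.
  apply: sqrtr_le; first by rewrite !mulr_ge0 ?sqrtr_ge0.
  by rewrite !exprMn !sq //; apply: le_trans aE _; exact: le72.
have b : Num.sqrt (sqn B0) <= k * n%:R * rho2.
  apply: sqrtr_le; first by rewrite !mulr_ge0 ?sqrtr_ge0.
  by rewrite !exprMn !sq //; apply: le_trans bE _; exact: le72.
(* Because [d2 <= n], the product of the norms of [E1] and [E2] obeys the same bound as that of [E1]
   and [B0]. *)
have dl2_le : dl2 <= x0 * rho2.
  by rewrite /dl2 /x0 /rho2 -sqrtrM // ler_wsqrtr // mulrC ler_wpM2r.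
have [h1 h2 h3 h4 h5] : [/\ 0 <= rho1, 0 <= rho2, 0 <= x0, 0 <= dl1 & 0 <= dl2].
  by split; exact: sqrtr_ge0.
have kk : k * k = K by rewrite -expr2 sq.
have xx : x0 * x0 = n%:R by rewrite -expr2 sq.
have k_ge0 : 0 <= k by exact: sqrtr_ge0.
have t1 : Num.sqrt (sqn E1) * Num.sqrt (sqn B0) <= K * (x0 * n%:R * (dl1 * rho2)).
  apply: le_trans (ler_pM (sqrtr_ge0 _) (sqrtr_ge0 _) e1 b) _.
  by rewrite -kk le_eqVlt; apply/orP; left; apply/eqP; ring.
have t2 : Num.sqrt (sqn A0) * Num.sqrt (sqn E2) <= K * (x0 * n%:R * (rho1 * dl2)).
  apply: le_trans (ler_pM (sqrtr_ge0 _) (sqrtr_ge0 _) a e2) _.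
  by rewrite -kk le_eqVlt; apply/orP; left; apply/eqP; ring.
have t3 : Num.sqrt (sqn E1) * Num.sqrt (sqn E2) <= K * (x0 * n%:R * (dl1 * rho2)).
  apply: le_trans (ler_pM (sqrtr_ge0 _) (sqrtr_ge0 _) e1 e2) _.
  apply: (@le_trans _ _ (k * x0 * dl1 * (k * x0 * (x0 * rho2)))).
    by rewrite ler_wpM2l ?mulr_ge0 // ler_wpM2l ?mulr_ge0.
  by rewrite -kk -xx le_eqVlt; apply/orP; left; apply/eqP; ring.
apply: (@le_trans _ _ (2 * (K * (x0 * n%:R * (dl1 * rho2)) + K * (x0 * n%:R * (rho1 * dl2)) +
   K * (x0 * n%:R * (dl1 * rho2))))).
  by apply: ler_wpM2l => //; apply: lerD => //; exact: lerD.
rewrite -subr_ge0 (_ : _ - _ = 2 * (K * (x0 * n%:R)) *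
  (2 * (rho1 * dl1) + rho1 * dl2 + 2 * (rho2 * dl2))); last by ring.
by rewrite mulr_ge0 ?addr_ge0 ?mulr_ge0.
Qed.

End FixedSize.

(** * Numerical conditions and the probability bound for one n *)

Section MatchingBound.
Variable R : realType.

Lemma quarter_le_ln (c : nat) : (1 < c)%N -> 4^-1 <= ln c%:R :> R.
Proof.
move=> c1; have c2 : 2 <= c%:R :> R by rewrite ler_nat.
rewrite -ler_expR lnK ?posrE; last by lra.
apply: le_trans (expR_le_quadratic _) _; first by rewrite ger0_norm; lra.
by lra.
Qed.

(** Walks of length [L], about [2 log n], require [(L+1)^2 <= sqrt (n r)]. With [n r >= sqrt n] this
    follows from [(L+1)^8 <= n]. *)
Lemma trunc_log_pow8 (n : nat) : (2 ^ 60 <= n)%N ->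
  (((trunc_log 2 n).+1 + (trunc_log 2 n).+1).+1 ^ 8 <= n)%N.
Proof.
move=> n60; have m60 : (60 <= trunc_log 2 n)%N by exact: trunc_log_max.
have n0 : (0 < n)%N by apply: leq_trans n60; rewrite expn_gt0.
clear n60.
have /andP[+ _] := trunc_log_bounds (isT : 1 < 2)%N n0; apply: leq_trans.
elim: (trunc_log 2 n) m60 => // m IH; rewrite leq_eqVlt => /orP[/eqP <-|].
  (* At exponent 60 the base is 123, below [2^7], and [2^56 <= 2^60]. *)
  apply: (@leq_trans ((2 ^ 7) ^ 8)); first by rewrite leq_exp2r.
  by rewrite -expnM leq_exp2l.
rewrite ltnS => m60; apply: (@leq_trans (2 * (m.+1 + m.+1).+1 ^ 8)); last first.
  by rewrite [leqRHS]expnS leq_mul2l IH.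
have -> : (m.+2 + m.+2).+1 = ((m.+1 + m.+1).+1 + 2)%N by rewrite addnS addSn !addn2.
have y25 : (25 <= (m.+1 + m.+1).+1)%N by rewrite ltnW // ltnS ltn_addl // ltnS; exact: leq_trans m60.
rewrite -(ler_nat R) natrM !natrX natrD; rewrite -(ler_nat R) in y25.
move: ((m.+1 + m.+1).+1%:R : R) y25 => y y25.
(* Raising the exponent by 1 adds 2 to the base, a factor of at most [27/25], whose eighth power is
   below 2. *)
have y1 : y + 2 <= 27 / 25 * y by lra.
have y3 : 0 <= y by exact: le_trans y25.
have y2 : 0 <= y + 2 by rewrite addr_ge0.
apply: (@le_trans _ _ ((27 / 25 * y) ^+ 8)).
  by apply: lerXn2r; rewrite ?nnegrE // (le_trans y2).
rewrite exprMn; apply: ler_wpM2r; first exact: exprn_ge0.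
by clear; lra.
Qed.

(** Clearing denominators with [n <= 2 c] produces [10 * 2048 = 20480] and [4 * 2048 = 8192]; their
    sum is below [256^2], which is why 256 is taken in the growth conditions. *)
Lemma exponent_bound (k c n L y X : R) : 1 <= k -> 0 <= L -> 0 <= y -> 0 < n -> n <= 2 * c ->
  k ^+ 2 * (c * L) <= 256^-1 ^+ 2 * X -> k * (c * y) <= 256^-1 ^+ 2 * X ->
  10 * (k * L) + 4 * y <= X / (1024 * k * n).
Proof.
move=> k1 L0 y0 n0 n2c h1 h2; have k0 : 0 < k by exact: lt_le_trans k1.
have k1024 : 0 < 1024 * k by rewrite pmulr_rgt0 ?ltr0n.
rewrite ler_pdivlMr; last exact: mulr_gt0.
apply: (@le_trans _ _ ((10 * (k * L) + 4 * y) * (1024 * k * (2 * c)))).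
  apply: ler_wpM2l; last exact: ler_wpM2l (ltW k1024) _ _ n2c.
  by rewrite addr_ge0 ?mulr_ge0 // ltW.
rewrite (_ : _ * _ = 20480 * (k ^+ 2 * (c * L)) + 8192 * (k * (c * y))); last by ring.
have c0 : 0 <= c by lra.
have X0 : 0 <= k ^+ 2 * (c * L) by rewrite mulr_ge0 ?sqr_ge0 ?mulr_ge0.
by move: h1 h2 X0; move: (k ^+ 2 * _) (k * _) => a b; lra.
Qed.

Lemma core_perm1 (c j : nat) : (0 < c)%N -> (0 < j)%N ->
  exists s : {perm 'I_(c + j)}, #|moved (core c j) s| = 1%N.
Proof.
move=> c0 j0; pose u := lshift j (Ordinal c0); pose v := rshift c (Ordinal j0).
have uv : u != v by rewrite -val_eqE /= addn0 neq_ltn c0.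
have ucore : u \in core c j by apply/imsetP; exists (Ordinal c0).
have vcore : v \notin core c j.
  by apply/imsetP => -[i _ /(congr1 val)] /= e; have := ltn_ord i; rewrite -e addn0 ltnn.
exists (tperm u v); apply/eqP/cards1P; exists u; apply/setP=> x; rewrite !inE.
have [->|xu] := eqVneq x u; first by rewrite ucore tpermL eq_sym uv.
have [->|xv] := eqVneq x v; first by rewrite (negPf vcore).
by rewrite tpermD 1?eq_sym // eqxx andbF.
Qed.

Lemma junk_block (c j : nat) (Rc : 'M[R]_c) (e : vertex_pair (c + j)) :
  ~~ (pair_set e \subset core c j)%SET ->
  block_mx Rc 0 0 (0 : 'M[R]_j) (val e).1 (val e).2 = 0.
Proof.
case: e => -[u v] /= uv; rewrite /pair_set /=.
case: (split_ordP u) => a ->; case: (split_ordP v) => b ->;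
  rewrite ?block_mxEul ?block_mxEur ?block_mxEdl ?block_mxEdr ?mxE //.
rewrite finset.subUset !finset.sub1set => /negP[].
by apply/andP; split; apply/imsetP; [exists a|exists b].
Qed.

(* The signal of a transposition of a core and a junk vertex is at most 8 n r,
   so the hypotheses on the signal force n r >= sqrt n: the graphs are dense
   enough for the walk count with walks of length about 2 log n. *)
Lemma matching_bound (c j N : nat) (d : measure_display) (T : measurableType d)
    (P : probability T R) (Q1 Q2 : 'M[R]_(c + j)) (Rc : 'M[R]_c)
    (A B : T -> 'M[R]_(c + j)) (r1 r2 d1 d2 K0 dl : R) (k0 : nat) :
  let K := 1086 * (1 + K0) + K0 in
  (c + j)%N = N -> (1 < c)%N -> (0 < j <= c)%N ->
  (((trunc_log 2 N).+1 + (trunc_log 2 N).+1).+1 ^ 8 <= N)%N ->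
  corrER P Q1 Q2 (block_mx Rc 0 0 0) A B ->
  0 <= r1 <= 1 -> 0 <= r2 <= 1 ->
  (forall u v, Q1 u v <= r1) -> (forall u v, Q2 u v <= r2) ->
  0 <= d1 -> 0 <= d2 <= N%:R -> 0 <= K0 -> 0 <= dl ->
  \sum_(i < c + j | d1 < i.+1%:R) singular_values Q1 0 i ^+ 2 <= K0 * (N%:R * r1 * d1) ->
  \sum_(i < c + j | d2 < i.+1%:R) singular_values Q2 0 i ^+ 2 <= K0 * (N%:R * r2 * d2) ->
  (forall k, (1 <= k <= c)%N -> forall Q : 'M[R]_(c + j), core_perms k Q ->
     c%:R `^ (2^-1 + dl) * Num.sqrt (ln c%:R) <= 256^-1 * (chiX P A B Q / k%:R)) ->
  (forall k, (1 <= k <= c)%N -> forall Q : 'M[R]_(c + j), core_perms k Q ->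
     Num.sqrt (c%:R * j%:R * ln j%:R) <= 256^-1 * (chiX P A B Q / Num.sqrt k%:R)) ->
  c%:R `^ (1 - dl) / Num.sqrt (ln c%:R) * (Num.sqrt r1 + Num.sqrt r2) *
    (Num.sqrt (r1 * d1) + Num.sqrt (r2 * d2)) <= K^-1 * k0%:R ->
  let Ahat w := A w - usvt (A w) (18 * Num.sqrt (N%:R * r1)) in
  let Bhat w := B w - usvt (B w) (18 * Num.sqrt (N%:R * r2)) in
  ((1 - 5 / N%:R ^+ 2)%:E <=
   P [set w | argmin_match (Ahat w) (Bhat w) `&`
              \bigcup_(k in [set k | (k0 < k)%N]) core_perms (c := c) (j := j) k = set0])%E.
Proof.
move=> K cjN c1 jc logN AB r1_01 r2_01 Q1r Q2r d1_0 /andP[d2_0 d2N] K0_0 dl0 tail1 tail2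
  hX1 hX2 hk0; subst N; set n := (c + j)%N in logN d2N tail1 tail2 *.
cbv zeta.
set Ahat := (fun w => A w - usvt (A w) _); set Bhat := (fun w => B w - usvt (B w) _).
have c0R : 0 < c%:R :> R by rewrite ltr0n ltnW.
have c1R : 1 <= c%:R :> R by rewrite ler1n ltnW.
have n2c : n%:R <= 2 * c%:R :> R 
  by rewrite -natrM ler_nat mul2n -addnn leq_add2l; case/andP: jc.
have n1R : 1 <= n%:R :> R by rewrite ler1n addn_gt0 ltnW.
have lnc : 4^-1 <= ln c%:R :> R by exact: quarter_le_ln.
have lnc0 : 0 < ln c%:R :> R by lra.
have sln : 2^-1 <= Num.sqrt (ln c%:R) :> R.
  rewrite -(ger0_norm (_ : 0 <= 2^-1)) // -sqrtr_sqr ler_wsqrtr //.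
  by apply: le_trans lnc; rewrite expr2 -invfM -natrM.
have lnj : 0 <= ln j%:R :> R by rewrite ln_ge0 // ler1n; case/andP: jc.
set p := edge_law P A B.
pose sg s := signal (p) Q1 Q2 s.
have p_ge0 e w : 0 <= p e w by exact: edge_law_ge0.
have p_sum1 e : \sum_w p e w = 1 by exact: (edge_law_sum1 AB).
have mean1 := edge_law_mean1 AB; have mean2 := edge_law_mean2 AB.
have Q1_0 u v : 0 <= Q1 u v by have /andP[] := corrER_Q1_01 AB u v.
have Q2_0 u v : 0 <= Q2 u v by have /andP[] := corrER_Q2_01 AB u v.
have unc e : ~~ (pair_set e \subset core c j)%SET -> _ :=
  fun h => edge_law_uncorrelated AB (junk_block Rc h).
have mvc s : (#|moved (core c j) s| <= c)%N.
  apply: leq_trans (_ : #|core c j| <= c)%N; last by rewrite card_core.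
  by apply: subset_leq_card; apply/fintype.subsetP => x; rewrite inE => /andP[].
have X1 s : (0 < #|moved (core c j) s|)%N ->
    #|moved (core c j) s|%:R * (c%:R `^ (2^-1 + dl) * Num.sqrt (ln c%:R)) <= 256^-1 * sg s.
  move=> k; have kR : 0 < #|moved (core c j) s|%:R :> R by rewrite ltr0n.
  rewrite mulrC -ler_pdivlMr // -[leRHS]mulrA /sg /p -(chiX_signal AB); apply: hX1.
    by rewrite k mvc.
  exact/core_perms_moved.
have X2 s : (0 < #|moved (core c j) s|)%N ->
    Num.sqrt #|moved (core c j) s|%:R * Num.sqrt (c%:R * j%:R * ln j%:R) <= 256^-1 * sg s.
  move=> k; have kR : 0 < Num.sqrt #|moved (core c j) s|%:R :> R by rewrite sqrtr_gt0 ltr0n.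
  rewrite mulrC -ler_pdivlMr // -[leRHS]mulrA /sg /p -(chiX_signal AB); apply: hX2.
    by rewrite k mvc.
  exact/core_perms_moved.
have powc : Num.sqrt c%:R <= c%:R `^ (2^-1 + dl).
  by rewrite -powR12_sqrt //; apply: ler_powR => //; rewrite lerDl.
have X1' s : (0 < #|moved (core c j) s|)%N ->
    #|moved (core c j) s|%:R * (Num.sqrt c%:R * Num.sqrt (ln c%:R)) <= 256^-1 * sg s.
  move=> k; apply: le_trans (X1 s k); rewrite ler_wpM2l // ler_wpM2r ?sqrtr_ge0 //.
have sg0 s : (0 < #|moved (core c j) s|)%N -> 0 < sg s.
  move=> k; have := X1' s k.
  have : 0 < #|moved (core c j) s|%:R * (Num.sqrt c%:R * Num.sqrt (ln c%:R)) :> R.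
    by apply: mulr_gt0; [rewrite ltr0n|apply: mulr_gt0; rewrite sqrtr_gt0].
  by lra.
have dense r : (forall s, sg s <= 2 * r * #|disagree s (repaired s)|%:R) -> 0 <= r <= 1 ->
    0 < r /\ ((trunc_log 2 n).+1 + (trunc_log 2 n).+1).+1%:R ^+ 2 <= Num.sqrt (n%:R * r).
  move=> sgr /andP[r0 _]; have [|s s1] := @core_perm1 c j (ltnW c1); first by case/andP: jc.
  have := X1' s; rewrite s1 mul1r => /(_ isT) h1.
  have dis : #|disagree s (repaired s)|%:R <= 4 * n%:R :> R.
    by rewrite -natrM ler_nat; have := card_repaired s; rewrite s1 => /card_disagree; rewrite muln1.
  have h2 : sg s <= 2 * r * (4 * n%:R) by apply: le_trans (sgr s) _; rewrite ler_wpM2l ?mulr_ge0.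
  have h3 : Num.sqrt c%:R * 2^-1 <= Num.sqrt c%:R * Num.sqrt (ln c%:R) :> R.
    by rewrite ler_wpM2l ?sqrtr_ge0.
  (* For a permutation moving one core vertex the signal lies between [128 sqrt c] and [8 n r]. *)
  have nr : 16 * Num.sqrt c%:R <= n%:R * r by move: h1 h2 h3; lra.
  have sc : 0 < Num.sqrt c%:R :> R by rewrite sqrtr_gt0.
  have np : 0 < n%:R :> R by exact: lt_le_trans n1R.
  split.
    by rewrite -(pmulr_rgt0 _ np); apply: lt_le_trans nr; rewrite pmulr_rgt0 ?ltr0n.
  set t := (_.+1)%N in logN *.
  rewrite -[leLHS]ger0_norm ?sqr_ge0 // -sqrtr_sqr ler_wsqrtr // -exprM.
  apply: le_trans nr.
  (* Under the root the 16 becomes 256, and [256 c >= n], so the bound on the eighth power of [t]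
     suffices. *)
  have -> : 16 * Num.sqrt c%:R = Num.sqrt (256 * c%:R) :> R.
    rewrite sqrtrM ?ler0n // (_ : 256 = 16 ^+ 2) ?sqrtr_sqr ?ger0_norm ?ler0n //.
    by rewrite -natrX.
  rewrite -[leLHS]ger0_norm ?exprn_ge0 // -sqrtr_sqr ler_wsqrtr // -exprM.
  apply: (@le_trans _ _ n%:R); first by rewrite -natrX ler_nat.
  by lra.
have [r1_gt0 dense1] : 0 < r1 /\
    ((trunc_log 2 n).+1 + (trunc_log 2 n).+1).+1%:R ^+ 2 <= Num.sqrt (n%:R * r1).
  apply: dense => // s.
  by have [] := signal_le p_ge0 p_sum1 mean1 mean2 Q1_0 Q2_0 Q1r Q2r r1_01 r2_01 unc s
    (@repaired_core c j s).
have [r2_gt0 dense2] : 0 < r2 /\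
    ((trunc_log 2 n).+1 + (trunc_log 2 n).+1).+1%:R ^+ 2 <= Num.sqrt (n%:R * r2).
  apply: dense => // s.
  by have [] := signal_le p_ge0 p_sum1 mean1 mean2 Q1_0 Q2_0 Q1r Q2r r1_01 r2_01 unc s
    (@repaired_core c j s).
have large s : (0 < #|moved (core c j) s|)%N ->
    10 * (#|moved (core c j) s|%:R * ln c%:R) + 4 * (j%:R * ln j%:R) <=
    sg s ^+ 2 / (1024 * #|moved (core c j) s|%:R * n%:R).
  move=> mv; have := X1' s mv; have := X2 s mv; have sgs := sg0 s mv.
  have : 1 <= #|moved (core c j) s|%:R :> R by rewrite ler1n.
  move: (#|moved (core c j) s|%:R : R) => k k1 h2 h1.
  have k0R : 0 <= k by lra.
  have sq (a b : R) : 0 <= a -> a <= b -> a ^+ 2 <= b ^+ 2.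
    by move=> a0 ab; rewrite lerXn2r ?nnegrE // (le_trans a0).
  have := sq _ _ _ h1; rewrite !mulr_ge0 ?sqrtr_ge0 // => /(_ isT).
  have := sq _ _ _ h2; rewrite !mulr_ge0 ?sqrtr_ge0 // => /(_ isT).
  rewrite !exprMn !sqr_sqrtr ?mulr_ge0 // ?(ltW lnc0) //.
  move=> g2 g1; apply: (@exponent_bound _ c%:R) => //; first exact: ltW.
  - by rewrite mulr_ge0.
  - exact: lt_le_trans n1R.
  - by rewrite [c%:R * (_ * _)]mulrA.
have k0_signal s : (k0 < #|moved (core c j) s|)%N ->
    4 * K * (Num.sqrt n%:R * n%:R * ((Num.sqrt r1 + Num.sqrt r2) *
      (Num.sqrt (r1 * d1) + Num.sqrt (r2 * d2)))) <= sg s.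
  move=> ks; have mv : (0 < #|moved (core c j) s|)%N by exact: leq_ltn_trans ks.
  set S := (Num.sqrt r1 + Num.sqrt r2) * (Num.sqrt (r1 * d1) + Num.sqrt (r2 * d2)).
  have S0 : 0 <= S by rewrite mulr_ge0 ?addr_ge0 ?sqrtr_ge0.
  have K0' : 0 < K by rewrite /K; move: K0_0; lra.
  set u := c%:R `^ (2^-1 + dl) * Num.sqrt (ln c%:R).
  set v := c%:R `^ (1 - dl) / Num.sqrt (ln c%:R).
  have u0 : 0 < u by rewrite mulr_gt0 ?powR_gt0 ?sqrtr_gt0.
  (* [u] is the growth of the signal per moved vertex and [v] the factor in the bound on [k0]; [dl]
     and the logarithms cancel in the product. *)
  have uv : u * v = Num.sqrt c%:R * c%:R.
    have c_neq0 x : (x == 0 :> R) ==> (c%:R != 0 :> R) by rewrite (gt_eqF c0R) implybT.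
    rewrite /u /v mulrACA divff ?gt_eqF ?sqrtr_gt0 // mulr1 -powRD //.
    rewrite (_ : 2^-1 + dl + (1 - dl) = 2^-1 + 1); last by rewrite addrACA subrr addr0.
    by rewrite powRD // powR12_sqrt // powRr1.
  have vS : v * S <= K^-1 * #|moved (core c j) s|%:R.
    rewrite /S mulrA; apply: le_trans hk0 _; rewrite ler_wpM2l ?invr_ge0 ?(ltW K0') //.
    by rewrite ler_nat ltnW.
  have h : K * (u * v * S) <= 256^-1 * sg s.
    apply: le_trans (X1 s mv); rewrite -/u -(mulrA u) (mulrCA K) [leRHS]mulrC.
    by apply: ler_wpM2l; [exact: ltW|rewrite -ler_pdivlMl].
  have sn : Num.sqrt n%:R <= 2 * Num.sqrt c%:R :> R.
    rewrite -[2]ger0_norm // -sqrtr_sqr -sqrtrM ?sqr_ge0 // ler_wsqrtr //; lra.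
  have step : 4 * K * (Num.sqrt n%:R * n%:R * S) <= 4 * K * (2 * Num.sqrt c%:R * (2 * c%:R) * S).
    by rewrite ler_wpM2l ?mulr_ge0 ?(ltW K0') // ler_wpM2r // ler_pM ?sqrtr_ge0.
  apply: le_trans step _.
  (* The 16 collects the initial 4, [sqrt n <= 2 sqrt c] and [n <= 2 c]; the constant [256^-1] in
     the growth condition outweighs it. *)
  rewrite (_ : _ * _ = 16 * (K * (u * v * S))); last by rewrite uv; ring.
  have : 0 <= K * (u * v * S) by rewrite uv !mulr_ge0 ?sqrtr_ge0 ?(ltW K0') ?(ltW c0R).
  by move: h; lra.
have r1_01' : 0 < r1 <= 1 by rewrite r1_gt0; case/andP: r1_01.
have r2_01' : 0 < r2 <= 1 by rewrite r2_gt0; case/andP: r2_01.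
have nm : (n <= 2 ^ (trunc_log 2 n).+1)%N by exact/ltnW/trunc_log_ltn.
(* The event depends on the two graphs only through their edges, so it becomes a predicate on the
   finite product space. *)
pose S x := `[< argmin_match
    (adj R fst x - usvt (adj R fst x) (18 * Num.sqrt (n%:R * r1)))
    (adj R snd x - usvt (adj R snd x) (18 * Num.sqrt (n%:R * r2))) `&`
  \bigcup_(k in [set k | (k0 < k)%N]) core_perms (c := c) (j := j) k = set0 >].
have -> : [set w | argmin_match (Ahat w) (Bhat w) `&`
    \bigcup_(k in [set k | (k0 < k)%N]) core_perms (c := c) (j := j) k = set0] =
    [set w | S (edges_of A B w)].
  apply/seteqP; split=> w /=; rewrite /S /Ahat /Bhat -(adjA AB) -(adjB AB) => h.
    exact/asboolP.
  by move/asboolP: h.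
rewrite (probability_edges AB) lee_fin.
set bd := bad (p) Q1 Q2 r1 r2 (trunc_log 2 n).
apply: (@le_trans _ _ (1 - Pr (p) bd)).
  rewrite lerD2l lerN2; apply: (@le_trans _ _ (3 / n%:R ^+ 2)).
    exact: (bad_le p_ge0 p_sum1 mean1 mean2 Q1_0 Q2_0 Q1r Q2r r1_01' r2_01' unc c1 jc
      dense1 dense2 sg0 large).
  by rewrite ler_wpM2r ?invr_ge0 ?sqr_ge0 // ler_nat.
rewrite -(PrC p_sum1); apply: Pr_sub => // x good; apply/asboolP.
rewrite -subset0 => M [am [k /= k0k Mk]].
have [/is_perm_mxP[s sM] _] := Mk; rewrite sM in Mk am.
have /core_perms_moved sk := Mk.
have ks : (k0 < #|moved (core c j) s|)%N by rewrite sk.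
exact: (good_not_argmin (corrER_symQ1 AB) (corrER_symQ2 AB) Q1_0 Q2_0 Q1r Q2r r1_01' r2_01'
  c1 nm d1_0 d2_0 d2N K0_0 tail1 tail2 k0_signal good ks am).
Qed.

End MatchingBound.

Theorem theorem14 (R : realType)
  (nc nj : nat -> nat)
  (hnc : forall n, (1 < n)%N ->
     [/\ (nc n + nj n = n)%N, (nj n <= nc n)%N & (1 <= nj n)%N])
  (d : nat -> measure_display)
  (T : forall n, measurableType (d n))
  (P : forall n, probability (T n) R)
  (Q1 Q2 : forall n, 'M[R]_(nc n + nj n))
  (Rc : forall n, 'M[R]_(nc n))
  (A B : forall n, T n -> 'M[R]_(nc n + nj n))
  (hRc : forall n, (1 < n)%N -> forall u v, 0 < Rc n u v <= 1)
  (hAB : forall n, (1 < n)%N ->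
     corrER (P n) (Q1 n) (Q2 n) (block_mx (Rc n) 0 0 0) (@A n) (@B n))
  (r1 r2 d1 d2 : nat -> R)
  (hr1 : forall n, (1 < n)%N ->
     0 <= r1 n <= 1 /\ forall u v, Q1 n u v <= r1 n)
  (hr2 : forall n, (1 < n)%N ->
     0 <= r2 n <= 1 /\ forall u v, Q2 n u v <= r2 n)
  (hdeg1 : is_omega (fun n => min_row_sum (Q1 n)) (fun n => ln n%:R))
  (hdeg2 : is_omega (fun n => min_row_sum (Q2 n)) (fun n => ln n%:R))
  (hd1 : forall n, 0 <= d1 n)
  (hd2 : forall n, 0 <= d2 n)
  (hd1o : d1 =o_\oo (fun n => n%:R : R))
  (hd2o : d2 =o_\oo (fun n => n%:R : R))
  (htail1 :
     (fun n => \sum_(j < nc n + nj n | d1 n < j.+1%:R)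
                 singular_values (Q1 n) 0 j ^+ 2)
       =O_\oo (fun n => n%:R * r1 n * d1 n : R))
  (htail2 :
     (fun n => \sum_(j < nc n + nj n | d2 n < j.+1%:R)
                 singular_values (Q2 n) 0 j ^+ 2)
       =O_\oo (fun n => n%:R * r2 n * d2 n : R))
  (delta : nat -> R)
  (hdelta : forall n, 0 <= delta n)
  (hX1 : forall e : R, 0 < e -> \forall n \near \oo,
     forall k : nat, (1 <= k <= nc n)%N ->
     forall Q : 'M[R]_(nc n + nj n), core_perms k Q ->
       (nc n)%:R `^ (2^-1 + delta n) * Num.sqrt (ln (nc n)%:R)
         <= e * (chiX (P n) (@A n) (@B n) Q / k%:R))
  (hX2 : forall e : R, 0 < e -> \forall n \near \oo,
     forall k : nat, (1 <= k <= nc n)%N ->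
     forall Q : 'M[R]_(nc n + nj n), core_perms k Q ->
       Num.sqrt ((nc n)%:R * (nj n)%:R * ln (nj n)%:R)
         <= e * (chiX (P n) (@A n) (@B n) Q / Num.sqrt k%:R)) :
  exists a1 a2 : R, [/\ 0 < a1, 0 < a2 &
    forall k0 : nat -> nat,
      (forall n, (0 < k0 n)%N) ->
      is_omega (fun n => (k0 n)%:R)
        (fun n => (nc n)%:R `^ (1 - delta n) / Num.sqrt (ln (nc n)%:R) *
                  (Num.sqrt (r1 n) + Num.sqrt (r2 n)) *
                  (Num.sqrt (r1 n * d1 n) + Num.sqrt (r2 n * d2 n))) ->
      \forall n \near \oo,
        let Ahat w := A n w - usvt (A n w) (a1 * Num.sqrt (n%:R * r1 n)) in
        let Bhat w := B n w - usvt (B n w) (a2 * Num.sqrt (n%:R * r2 n)) in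
        ((1 - 5 / n%:R ^+ 2)%:E <=
         P n [set w | argmin_match (Ahat w) (Bhat w) `&`
                      \bigcup_(k in [set k | (k0 n < k)%N])
                         core_perms (c := nc n) (j := nj n) k = set0])%E].
Proof.
exists 18, 18; split=> // k0 _ hk0.
have [C1 C1_0 hC1] := (eqO_exP _ _ _).1 htail1.
have [C2 C2_0 hC2] := (eqO_exP _ _ _).1 htail2.
(* One constant for both tail conditions; the reciprocal of the resulting error constant is then the
   epsilon at which the condition on [k0] is used. *)
pose K0 : R := C1 + C2.
have K_gt0 : 0 < (1086 * (1 + K0) + K0)^-1 by rewrite invr_gt0 /K0; lra.
have hk0' := (eqoP _ _ _).1 hk0 _ K_gt0.
have hd2' := (eqoP _ _ _).1 hd2o _ (ltr01 : 0 < 1 :> R).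
have e256 : 0 < 256^-1 :> R by rewrite invr_gt0 ltr0n.
near=> n.
have n60 : (2 ^ 60 <= n)%N by near: n; exact: nbhs_infty_ge.
have n4 : (3 < n)%N by apply: leq_trans n60; rewrite -[4%N]/(2 ^ 2)%N leq_exp2l.
have logn := trunc_log_pow8 R n60; clear n60.
have n1 : (1 < n)%N by exact: leq_trans n4.
have [cjn jc j1] := hnc n n1; have [r1_01 Q1r] := hr1 n n1; have [r2_01 Q2r] := hr2 n n1.
apply: (@matching_bound R (nc n) (nj n) n _ _ (P n) (Q1 n) (Q2 n) (Rc n) (@A n) (@B n)
  (r1 n) (r2 n) (d1 n) (d2 n) K0 (delta n) (k0 n)) => //.
- by move: cjn jc n4; move: (nc n) (nj n) => a b; clear; lia.
- by rewrite j1.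
- exact: hAB.
- rewrite hd2 /=; have : `|d2 n| <= 1 * `|n%:R : R| by near: n; exact: hd2'.
  by rewrite mul1r !ger0_norm.
- by rewrite addr_ge0 // ltW.
- have : `|\sum_(j < nc n + nj n | d1 n < j.+1%:R) singular_values (Q1 n) 0 j ^+ 2| <=
      C1 * `|n%:R * r1 n * d1 n| by near: n; exact: hC1.
  have D0 : 0 <= n%:R * r1 n * d1 n by rewrite !mulr_ge0 //; case/andP: r1_01.
  rewrite (ger0_norm D0) => /(le_trans (ler_norm _))/le_trans; apply.
  by rewrite ler_wpM2r // /K0 lerDl ltW.
- have : `|\sum_(j < nc n + nj n | d2 n < j.+1%:R) singular_values (Q2 n) 0 j ^+ 2| <=
      C2 * `|n%:R * r2 n * d2 n| by near: n; exact: hC2.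
  have D0 : 0 <= n%:R * r2 n * d2 n by rewrite !mulr_ge0 //; case/andP: r2_01.
  rewrite (ger0_norm D0) => /(le_trans (ler_norm _))/le_trans; apply.
  by rewrite ler_wpM2r // /K0 lerDr ltW.
- by near: n; exact: hX1.
- by near: n; exact: hX2.
- apply: le_trans (ler_norm _) _; rewrite -[X in _ <= _ * X](ger0_norm (ler0n R (k0 n))).
  by near: n; exact: hk0'.
Unshelve. all: by end_near.
Qed.
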